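(* In the linear domain-varying coefficient model with sample splitting, as described in the context, assume (Smoothness), (Data), (Balance) and (Kernel). Let $\hat{\boldsymbol\theta}_{\mathrm{DVCM}}(u_0)$ be computed with polynomial order $l=\lfloor\beta\rfloor$ and bandwidth $$h=\mathrm{med}\Big(e_0(n/\gamma)^{-\frac{1}{2\beta+1}},\,d_{(1)}(u_0),\,d_{(K)}(u_0)\Big),\qquad e_0>0\text{ a constant},$$ and let the symmetric positive definite matrix $Q$ used in $\hat{\boldsymbol\theta}_{\mathrm{TL}}(u_0)$ satisfy $$\frac12\,\frac{\sigma^2(u_0)}{n_0}\,M\big(\hat{\boldsymbol\theta}_{\mathrm{DVCM}}(u_0)\big)^{-1}\preceq Q\preceq 2\,\frac{\sigma^2(u_0)}{n_0}\,M\big(\hat{\boldsymbol\theta}_{\mathrm{DVCM}}(u_0)\big)^{-1}.$$ Then for any $u_0\in\mathcal U$ and any $p\times p$ matrix $A\succeq0$ there is a constant $C>0$, not depending on $n_0,\dots,n_K,K,\gamma$, such that $$\sup_{\theta_j\in\mathcal H(\beta,L)\ \forall j\in[p]}\mathbb E\big[\|\hat{\boldsymbol\theta}_{\mathrm{TL}}(u_0)-\boldsymbol\theta(u_0)\|_A^2\big]\le C\Big(n_0^{-1}\wedge\max\big\{(K/\gamma)^{-2\beta},\,(n/\gamma)^{-\frac{2\beta}{2\beta+1}},\,n^{-1}\big\}\Big).$$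
   Context: Model. There are $K+1$ domains $k=0,\dots,K$; $k=0$ is the target and $k=1,\dots,K$ are sources. Domain $k$ has an identifier $U_k\in\mathcal U$ ($\mathcal U\subset\mathbb R$ compact, the support of $U$) and observations $(X_{ki},Y_{ki})$, $i\in\mathcal I_k$, $|\mathcal I_k|=n_k$, with $X_{ki}\in\mathbb R^p$ ($p$ fixed) and $Y_{ki}=X_{ki}^\top\boldsymbol\theta(U_k)+\varepsilon_{ki}$, where $\boldsymbol\theta=(\theta_1,\dots,\theta_p)^\top$ is an unknown function; the $\varepsilon_{ki}$ are independent within and across domains, independent of $X_{ki}$ conditionally on $U_k$, with $\mathbb E[\varepsilon_{ki}\mid U_k]=0$, $\mathrm{Var}(\varepsilon_{ki}\mid U_k)=\sigma^2(U_k)$. The realization of $U_0$ is $u_0$. Put $n=\sum_{k=0}^Kn_k$, $\bar n=n/(K+1)$, $d_k(u_0)=|U_k-u_0|$, and let $d_{(1)}(u_0)\le\dots\le d_{(K)}(u_0)$ be the order statistics of $d_1(u_0),\dots,d_K(u_0)$; $\mathrm{med}$ is the median of three numbers. Sample splitting. $2n_0$ target observations are available, split into two halves indexed by $\mathcal I_0$ and $\mathcal I_0^*$ of size $n_0$ each. DVCM estimator. For $l=\lfloor\beta\rfloor$ and $h>0$: $\boldsymbol\Phi_l(x)=(1,x,x^2/2!,\dots,x^l/l!)^\top$, $Z_{ki}=\boldsymbol\Phi_l((U_k-u_0)/h)\otimes X_{ki}$, $\mathbf Z$ is the matrix with rows $Z_{ki}^\top$ and $\mathbf y$ the vector of $Y_{ki}$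 ($0\le k\le K$, $i\in\mathcal I_k$), $S_h=\sum_{k,i}W((U_k-u_0)/h)$, $\mathbf W=S_h^{-1}\mathrm{diag}\{W((U_k-u_0)/h)\}_{k,i}$, $\mathbf A_l=[I_p,\mathbf 0_{p\times lp}]$, and $\hat{\boldsymbol\theta}_{\mathrm{DVCM}}(u_0)=\mathbf A_l(\mathbf Z^\top\mathbf W\mathbf Z)^{-1}\mathbf Z^\top\mathbf W\mathbf y$. Transfer estimator. With $\mathbf X_0$ the matrix with rows $X_{0i}^\top$ and $\mathbf y_0$ the vector of $Y_{0i}$, $i\in\mathcal I_0^*$, $$\hat{\boldsymbol\theta}_{\mathrm{TL}}(u_0)=\big(\tfrac1{n_0}\mathbf X_0^\top\mathbf X_0+Q\big)^{-1}\big(\tfrac1{n_0}\mathbf X_0^\top\mathbf y_0+Q\hat{\boldsymbol\theta}_{\mathrm{DVCM}}(u_0)\big).$$ Notation. $M(\hat{\boldsymbol\theta})=\mathbb E[(\hat{\boldsymbol\theta}-\boldsymbol\theta)(\hat{\boldsymbol\theta}-\boldsymbol\theta)^\top]$; $M(\hat{\boldsymbol\theta}_{\mathrm{DVCM}}(u_0))$ is assumed invertible. $\|x\|_A^2=x^\top Ax$; $A\succeq B$ means $A-B$ is positive semidefinite; $x\wedge y=\min(x,y)$. $\mathcal H(\beta,L)$ ($\beta,L>0$) is the Hölder class of functions having $l=\lfloor\beta\rfloor$ derivatives with $|g^{(l)}(u)-g^{(l)}(u')|\le L|u-u'|^{\beta-l}$. (Smoothness) $\theta_j\in\mathcal H(\beta,L)$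 for all $j\in[p]$. (Data) (a) The $U_k$ are i.i.d. with density $\gamma^{-1}f((u-u^* )/\gamma)$, where $f$ is supported on a compact $\mathcal B\subset\mathbb R$ with $a_0'\le f\le a_0$ on $\mathcal B$ (constants $0<a_0'\le a_0$), $u^*\in\mathcal B$ and $0<\gamma<\infty$; $\|X_{ki}\|_2\le1$ a.s. (b) $\mathbb E[|Y|^4\mid U=u]$ is continuous in $u$ (hence bounded on the support of $U$). (c) There is a constant $\lambda_0>0$ such that for $h\ge d_{(1)}(u_0)$, a.s. $\|\mathbf A_l(\mathbf Z^\top\mathbf W\mathbf Z)^{-1}\mathbf A_l^\top\|_2\le\lambda_0^{-1}$. (Balance) There are positive constants $b_0',b_0$ with $n_k/\bar n\in[b_0',b_0]$ for $k=1,\dots,K$, and $n_0/\bar n\le b_0$. (Kernel) $W(u)=\frac12\mathbf 1\{|u|\le1\}$.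
   Formalization: The compact support B of f is also assumed to satisfy Leb(B ∩ [b-t,b+t]) ≥ ct for all b in B and 0<t≤1, with some c>0 (true for finite unions of nondegenerate intervals); for arbitrary compact B, such as one with a cusp at the target, the stated rate fails. *)

(* Defs.v *)
From HB Require Import structures.
From mathcomp Require Export all_boot all_order all_algebra.
From mathcomp Require Export all_classical all_reals all_analysis.

Set Implicit Arguments.
Unset Strict Implicit.
Unset Printing Implicit Defensive.

Export Order.TTheory GRing.Theory Num.Theory.
Export numFieldNormedType.Exports.


Local Open Scope classical_set_scope.
Local Open Scope ring_scope.

Section Matrices.
Context {R : realType}.

Definition quad m (A : 'M[R]_m) (x : 'cV[R]_m) : R := (x^T *m A *m x) 0 0.

Definition psd m (A : 'M[R]_m) : Prop := A^T = A /\ forall x, 0 <= quad A x.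

Definition posdef m (A : 'M[R]_m) : Prop :=
  A^T = A /\ forall x, x != 0 -> 0 < quad A x.

Definition loewner_le m (A B : 'M[R]_m) : Prop := psd (B - A).

Definition norm2 m (x : 'cV[R]_m) : R := Num.sqrt (\sum_i x i 0 ^+ 2).

Definition opnorm2 m (A : 'M[R]_m) : R :=
  sup [set norm2 (A *m x) | x in [set x | norm2 x <= 1]].

End Matrices.

Section Hoelder.
Context {R : realType}.

(* Convention: floor beta, not the largest integer strictly below beta. *)
Definition hoelder (beta L : R) (g : R -> R) : Prop :=
  let l := Num.truncn beta in
  (forall j, (j < l)%N -> forall u, derivable (derive1n j g) u 1) /\
  forall u v, `|derive1n l g u - derive1n l g v|
              <= L * `|u - v| `^ (beta - l%:R).

Definition hoelder_class p (beta L : R) : set ('I_p -> R -> R) :=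
  [set theta | forall j, hoelder beta L (theta j)].

End Hoelder.

Section Estimators.
Context {R : realType}.

Definition boxcar (u : R) : R := 2^-1 * (`|u| <= 1)%R%:R.

Definition med3 (a b c : R) : R := nth 0 (sort <=%R [:: a; b; c]) 1.

Context {K p : nat}.
(* n k is the size of I_k, for k = 0 (target) and k = 1, ..., K (sources);
   n ord0 is also the size of the second half I_0^* of the target sample. *)
Variable n : 'I_K.+1 -> nat.

Definition ntot : nat := \sum_k n k.
Definition nbar : R := ntot%:R / K.+1%:R.

(* d_(j)(u0), for 1 <= j <= K *)
Definition dist_ord (u0 : R) (u : 'I_K.+1 -> R) (j : nat) : R :=
  nth 0 (sort <=%R [seq `|u (lift ord0 k) - u0| | k <- enum 'I_K]) j.-1.

Definition bandwidth (beta e0 gamma u0 : R) (u : 'I_K.+1 -> R) : R :=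
  med3 (e0 * (ntot%:R / gamma) `^ (- (2 * beta + 1)^-1))
       (dist_ord u0 u 1) (dist_ord u0 u K).

Variables (l : nat) (h u0 : R) (u : 'I_K.+1 -> R).

Definition scaled_id (k : 'I_K.+1) : R := (u k - u0) / h.

(* Block (k, a) of Z, whose rows are the Phi_l((u_k - u0)/h) (x) X_ki. *)
Definition Zmx (X : forall k, 'M[R]_(n k, p)) :
    'M[R]_(\sum_k n k, \sum_(a < l.+1) p) :=
  \mxblock_(k < K.+1, a < l.+1) ((scaled_id k ^+ a / a`!%:R) *: X k).

Definition Ssum : R := \sum_k \sum_(i < n k) boxcar (scaled_id k).

Definition Wmx : 'M[R]_(\sum_k n k) :=
  \mxdiag_(k < K.+1) (Ssum^-1 * boxcar (scaled_id k))%:M.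

(* [I_p, 0, ..., 0] *)
Definition Amx : 'M[R]_(p, \sum_(a < l.+1) p) :=
  \mxrow_(a < l.+1) ((a == ord0)%:R)%:M.

Definition gram (X : forall k, 'M[R]_(n k, p)) : 'M[R]_(\sum_(a < l.+1) p) :=
  (Zmx X)^T *m Wmx *m Zmx X.

Definition dvcm (X : forall k, 'M[R]_(n k, p)) (y : forall k, 'cV[R]_(n k)) :
    'cV[R]_p :=
  Amx *m invmx (gram X) *m (Zmx X)^T *m Wmx *m (\mxcol_k y k).

(* invmx is the identity on singular matrices, hence the explicit
   invertibility requirement. *)
Definition gram_cond (lambda0 : R) (X : forall k, 'M[R]_(n k, p)) : Prop :=
  gram X \in unitmx /\ opnorm2 (Amx *m invmx (gram X) *m Amx^T) <= lambda0^-1.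

End Estimators.

Definition transfer {R : realType} {p : nat} (n0 : nat) (X0 : 'M[R]_(n0, p))
    (y0 : 'cV[R]_n0) (Q : 'M[R]_p) (th : 'cV[R]_p) : 'cV[R]_p :=
  invmx (n0%:R^-1 *: (X0^T *m X0) + Q)
    *m (n0%:R^-1 *: (X0^T *m y0) + Q *m th).

Section Probability.
Context {R : realType} {d : measure_display} {Omega : measurableType d}.
Variable P : probability Omega R.

Definition sigma_gen (J : Type) (Z : J -> Omega -> R) : set (set Omega) :=
  <<s [set D | exists j B, measurable B /\ D = Z j @^-1` B] >>.

Definition indep_sigma (I : finType) (F : I -> set (set Omega)) : Prop :=
  forall D : I -> set Omega, (forall i, F i (D i)) ->
    P (\bigcap_(i in setT) D i) = (\prod_i fine (P (D i)))%:E.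

(* V is a version of the conditional expectation of Z given G. *)
Definition is_cond_exp (G : set (set Omega)) (Z V : Omega -> R) : Prop :=
  [/\ P.-integrable setT (EFin \o Z),
      P.-integrable setT (EFin \o V),
      (forall B, measurable B -> G (V @^-1` B)) &
      forall D, G D ->
        (\int[P]_(w in D) (Z w)%:E = \int[P]_(w in D) (V w)%:E)%E].

(* Given the identifiers, the eps_o are mutually independent and independent
   of the covariates, the conditional law nu_o(V_o) of eps_o being a function
   of the identifier V_o of its domain; G is generated by all identifiers and
   covariates. *)
Definition noise_cond_indep (I : finType) (G : set (set Omega))
    (V eps : I -> Omega -> R) : Prop :=
  exists nu : I -> R.-pker (measurableTypeR R) ~> (measurableTypeR R),
    forall (D : set Omega) (E : I -> set R), G D -> (forall o, measurable (E o)) ->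
      P (D `&` \bigcap_(o in setT) (eps o @^-1` E o)) =
      (\int[P]_(w in D) (\prod_o fine (nu o (V o w) (E o)))%:E)%E.

End Probability.

Section Model.
Context {R : realType}.

Definition base_density (f : R -> R) (B : set R) (a0' a0 : R) : Prop :=
  [/\ compact B, measurable_fun setT f,
      (forall x, ~ B x -> f x = 0) &
      forall x, B x -> a0' <= f x <= a0].

(* Holds for finite unions of nondegenerate compact intervals. It excludes
   isolated points and cusps, near which few identifiers fall, so that the
   distance d_(1)(u0) need not be of order gamma / K. *)
Definition mass_regular (B : set R) : Prop :=
  exists2 c : R, 0 < c &
    forall b t, B b -> 0 < t <= 1 ->
      ((c * t)%:E <= lebesgue_measure (B `&` `[(b - t)%R, (b + t)%R]))%E.

Context {K p : nat}.
Variable n : 'I_K.+1 -> nat.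

(* inl (k, i): i in I_k;  inr i: i in I_0^*. *)
Definition obs : finType := ({k : 'I_K.+1 & 'I_(n k)} + 'I_(n ord0))%type.

Definition dom (o : obs) : 'I_K.+1 :=
  match o with inl t => tag t | inr _ => ord0 end.

Definition obs1 (k : 'I_K.+1) (i : 'I_(n k)) : obs :=
  inl (Tagged (fun k => 'I_(n k)) i).

Definition obs2 (i : 'I_(n ord0)) : obs := inr i.

Context {d : measure_display} {Omega : measurableType d}.
Variables (P : probability Omega R) (U : 'I_K.+1 -> Omega -> R).
Variables (X : obs -> Omega -> 'rV[R]_p) (eps : obs -> Omega -> R).

Definition Yobs (theta : 'I_p -> R -> R) (o : obs) (w : Omega) : R :=
  (X o w *m \col_j theta j (U (dom o) w)) 0 0 + eps o w.

Definition Xfst (w : Omega) (k : 'I_K.+1) : 'M[R]_(n k, p) :=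
  \matrix_(i, j) X (obs1 i) w 0 j.
Definition yfst (theta : 'I_p -> R -> R) (w : Omega) (k : 'I_K.+1) :
    'cV[R]_(n k) := \col_i Yobs theta (obs1 i) w.
Definition Xsnd (w : Omega) : 'M[R]_(n ord0, p) :=
  \matrix_(i, j) X (obs2 i) w 0 j.
Definition ysnd (theta : 'I_p -> R -> R) (w : Omega) : 'cV[R]_(n ord0) :=
  \col_i Yobs theta (obs2 i) w.

Definition ids (w : Omega) : 'I_K.+1 -> R := fun k => U k w.

Definition sigma_ids : set (set Omega) := sigma_gen U.

Definition sigma_design : set (set Omega) :=
  sigma_gen (fun c : 'I_K.+1 + obs * 'I_p =>
    match c with inl k => U k | inr oj => fun w => X oj.1 w 0 oj.2 end).

Definition sigma_fst : set (set Omega) :=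
  sigma_gen (fun c : 'I_K.+1 + {k : 'I_K.+1 & 'I_(n k)} * 'I_p =>
    match c with inl k => U k | inr tj => fun w => X (inl tj.1) w 0 tj.2 end).

Definition sigma_snd (i : 'I_(n ord0)) : set (set Omega) :=
  sigma_gen (fun (j : 'I_p) w => X (obs2 i) w 0 j).

Definition measurable_data : Prop :=
  [/\ forall k, measurable_fun setT (U k),
      forall o j, measurable_fun setT (fun w => X o w 0 j) &
      forall o, measurable_fun setT (eps o)].

(* Expectations are taken given the event that U_0 is u0. *)
Definition identifiers (u0 gamma ustar : R) (f : R -> R) : Prop :=
  [/\ forall w, U ord0 w = u0,
      indep_sigma P (fun k : 'I_K => sigma_gen (fun _ : unit => U (lift ord0 k))) &
      forall (k : 'I_K) (B : set R), measurable B ->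
        (P (U (lift ord0 k) @^-1` B) =
         \int[lebesgue_measure]_(x in B)
           (gamma^-1 * f ((x - ustar) / gamma))%:E)%E].

Definition noise (sigma2 : R -> R) : Prop :=
  [/\ noise_cond_indep P sigma_design (fun o => U (dom o)) eps,
      forall o, is_cond_exp P sigma_ids (eps o) (fun=> 0) &
      forall o, is_cond_exp P sigma_ids (fun w => eps o w ^+ 2)
                            (fun w => sigma2 (U (dom o) w))].

(* The second half of the target sample consists of independent draws,
   independent of the data entering the DVCM estimator (the noise being dealt
   with by noise_cond_indep). *)
Definition sample_split : Prop :=
  indep_sigma P (fun i : option 'I_(n ord0) =>
    match i with None => sigma_fst | Some i => sigma_snd i end).

Definition bounded_covariates : Prop :=
  forall o, {ae P, forall w, norm2 (X o w)^T <= 1}.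

Definition fourth_moment (theta : 'I_p -> R -> R) (m : R -> R) : Prop :=
  forall o, is_cond_exp P sigma_ids (fun w => `|Yobs theta o w| ^+ 4)
                        (fun w => m (U (dom o) w)).

Definition balanced (b0' b0 : R) : Prop :=
  (forall k : 'I_K, b0' <= (n (lift ord0 k))%:R / nbar n <= b0) /\
  (n ord0)%:R / nbar n <= b0.

Definition theta_dvcm (beta e0 gamma u0 : R) (theta : 'I_p -> R -> R)
    (w : Omega) : 'cV[R]_p :=
  dvcm (Num.truncn beta) (bandwidth n beta e0 gamma u0 (ids w)) u0 (ids w)
       (Xfst w) (yfst theta w).

Definition theta_tl (beta e0 gamma u0 : R) (Q : 'M[R]_p)
    (theta : 'I_p -> R -> R) (w : Omega) : 'cV[R]_p :=
  transfer (Xsnd w) (ysnd theta w) Q (theta_dvcm beta e0 gamma u0 theta w).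

(* Imposed at the bandwidth in use, which is at least d_(1)(u0); at the bandwidth
   d_(1)(u0) itself the rank of gram may be only 2p, so it cannot be invertible
   at all h >= d_(1)(u0) once l >= 2. *)
Definition design_cond (beta e0 gamma u0 lambda0 : R) : Prop :=
  {ae P, forall w,
    gram_cond (Num.truncn beta) (bandwidth n beta e0 gamma u0 (ids w)) u0
              (ids w) lambda0 (Xfst w)}.

Definition mse_dvcm (beta e0 gamma u0 : R) (theta : 'I_p -> R -> R) :
    'M[R]_p :=
  let err w := theta_dvcm beta e0 gamma u0 theta w - \col_j theta j u0 in
  \matrix_(i, j) fine 'E_P[fun w => (err w *m (err w)^T) i j].

Definition risk_tl (beta e0 gamma u0 : R) (A Q : 'M[R]_p)
    (theta : 'I_p -> R -> R) : \bar R :=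
  'E_P[fun w => quad A (theta_tl beta e0 gamma u0 Q theta w
                        - \col_j theta j u0)].

End Model.

(* Main.v *)
Require Import Defs.
From mathcomp Require Import finmap measurable_realfun ring lra.

(** Given the identifiers and the covariates, both estimators are affine in the
    noise, so every second moment below is a squared bias plus a noise variance.

    DVCM. The estimator is H y for a matrix H that reproduces polynomials of
    degree at most l, so its error is H applied to the Taylor remainders plus
    the noise ([dvcm_err]).  For the boxcar kernel W^2 = W / N, where N counts
    the observations in the window, hence H H^T = A G^-1 A^T / N and the design
    condition bounds each squared row norm of H by 1 / (lambda0 N)
    ([dvcm_blk_sqr]).  Cauchy-Schwarz then bounds the squared bias by a multiple
    of h^(2 beta) ([dvcm_decomp]), and the mean squared error is of the order of
    E h^(2 beta) + E (1/N).  An identifier falls within gamma t of u0 with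
    probability at least a multiple of t ([near_event_lower]).  So the nearest
    distance is of order gamma / K, with exponential tails ([first_moment]); and
    either the window contains everything and N = n, or N is of order n h / gamma
    by Chebyshev's inequality ([near_count_inv], [inv_count_moment]).
    These are the three terms of the maximum.

    Transfer. Let S be the Gram matrix of the second target half, divided by n0,
    and R = (S + Q)^-1.  The error is R (X0^T eps / n0 + Q err), err being the
    DVCM error.  The two parts are uncorrelated and err is independent of X0, so
    with s = sigma2(u0) / n0 and M the DVCM mean squared error matrix, the i-th
    coordinate has second moment E [s (R e_i)^T S (R e_i) + (Q R e_i)^T M (Q R e_i)].
    Since M <= 2 s Q^-1, this is at most 2 s E R_ii ([transfer_moment]).  On the
    one hand R <= Q^-1 <= (2/s) M, which gives 4 M_ii and the DVCM rate.  On the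
    other hand R_ii <= 2/c as soon as S >= (c/2) I, and this fails with
    probability O(1/n0); as M_ii is bounded, this gives the rate 1/n0
    ([resol_moment]).

    Why E S >= c I.  The design condition only concerns the observations in the
    window ([gram_lower]).  It is carried to the target by the moments of Y: for
    the constant coefficients r t, the conditional fourth moment of Y is about
    r^4 E (X t)^4 when r is large, and it is a continuous function of the
    identifier ([target_second_moment]).

    Noise. The moments of the noise are prescribed given the identifiers only.
    As its conditional law given identifiers and covariates is a function of the
    identifiers, they remain valid given the whole design ([cond_exp_transfer]). *)

Set Implicit Arguments.
Unset Strict Implicit.
Unset Printing Implicit Defensive.

Local Open Scope classical_set_scope.
Local Open Scope ring_scope.

(** * Expectation of real random variables *)

Section Expectation.
Context {R : realType} {d : measure_display} {Omega : measurableType d}.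
Variable P : probability Omega R.

Definition intg (f : Omega -> R) : Prop := P.-integrable setT (EFin \o f).

Definition expect (f : Omega -> R) : R := \int[P]_w f w.

Lemma intg_meas f : intg f -> measurable_fun setT f.
Proof. by move=> /integrableP[/measurable_EFinP]. Qed.

Lemma intgD f g : intg f -> intg g -> intg (fun w => f w + g w).
Proof. by move=> If Ig; exact: (integrableD measurableT If Ig). Qed.

Lemma intgZ c f : intg f -> intg (fun w => c * f w).
Proof. by move=> If; exact: (integrableZl measurableT c If). Qed.

Lemma intgN f : intg f -> intg (fun w => - f w).
Proof. by move=> If; exact: (integrableN If). Qed.

Lemma intgB f g : intg f -> intg g -> intg (fun w => f w - g w).
Proof. by move=> If Ig; apply: intgD => //; exact: intgN. Qed.

Lemma intg_sum (I : Type) (s : seq I) (Q : pred I) (f : I -> Omega -> R) :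
  (forall i, Q i -> intg (f i)) -> intg (fun w => \sum_(i <- s | Q i) f i w).
Proof.
move=> If; rewrite /intg /comp.
under eq_fun do rewrite -sumEFin.
exact: (integrable_sum _ _ If).
Qed.

Lemma intg_le (f g : Omega -> R) : measurable_fun setT f -> intg g ->
  (forall w, `|f w| <= g w) -> intg f.
Proof.
move=> mf Ig fg; apply: (le_integrable measurableT _ _ Ig).
  exact/measurable_EFinP.
by move=> w _ /=; rewrite lee_fin (le_trans (fg w)) ?ler_norm.
Qed.

Lemma intg_cst c : intg (fun=> c).
Proof. exact: (finite_measure_integrable_cst P c measurableT). Qed.

Lemma intg_bnd (f : Omega -> R) c : measurable_fun setT f -> (forall w, `|f w| <= c) -> intg f.
Proof. by move=> mf fc; apply: (intg_le mf (intg_cst c)). Qed.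

Lemma intg_bndM (f g : Omega -> R) c : measurable_fun setT f -> (forall w, `|f w| <= c) ->
  intg g -> intg (fun w => f w * g w).
Proof.
move=> mf fc Ig.
apply: (@intg_le _ (fun w => `|c| * `|g w|)).
- by apply: measurable_funM => //; exact: intg_meas.
- by apply: intgZ; exact: (integrable_norm Ig).
- move=> w; rewrite normrM ler_wpM2r//.
  exact: le_trans (fc w) (ler_norm _).
Qed.

Lemma expect_ext (f g : Omega -> R) : f =1 g -> expect f = expect g.
Proof. by move=> fg; congr (expect _); apply/funext. Qed.

Lemma expectD f g : intg f -> intg g ->
  expect (fun w => f w + g w) = expect f + expect g.
Proof. exact: RintegralD. Qed.

Lemma expectB f g : intg f -> intg g ->
  expect (fun w => f w - g w) = expect f - expect g.
Proof. exact: RintegralB. Qed.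

Lemma expectZ c f : intg f -> expect (fun w => c * f w) = c * expect f.
Proof. exact: RintegralZl. Qed.

Lemma expect_cst c : expect (fun=> c) = c.
Proof. by rewrite /expect Rintegral_cst//= probability_setT mulr1. Qed.

Lemma expectM0 (f : Omega -> R) : expect (fun w => f w * 0) = 0.
Proof. by under expect_ext do rewrite mulr0; exact: expect_cst. Qed.

Lemma expect_sum (I : Type) (s : seq I) (Q : pred I) (f : I -> Omega -> R) :
  (forall i, Q i -> intg (f i)) ->
  expect (fun w => \sum_(i <- s | Q i) f i w) = \sum_(i <- s | Q i) expect (f i).
Proof.
move=> If; elim: s => [|i s IHs].
  by under expect_ext do rewrite big_nil; rewrite big_nil expect_cst.
rewrite big_cons; have [Qi|nQi] := ifP.
  rewrite -IHs -expectD; [|exact: If|exact: intg_sum].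
  by apply: expect_ext => w; rewrite big_cons Qi.
by rewrite -IHs; apply: expect_ext => w; rewrite big_cons nQi.
Qed.

Lemma expect_le (f g : Omega -> R) : intg f -> intg g -> (forall w, f w <= g w) ->
  expect f <= expect g.
Proof. by move=> If Ig fg; apply: le_Rintegral. Qed.

Lemma expect_ge0 (f : Omega -> R) : (forall w, 0 <= f w) -> 0 <= expect f.
Proof. by move=> f0; apply: Rintegral_ge0. Qed.

Lemma expect_norm f : intg f -> `|expect f| <= expect (fun w => `|f w|).
Proof. exact: le_normr_Rintegral. Qed.

Lemma expect_fin f : intg f -> (\int[P]_w (f w)%:E)%E = (expect f)%:E.
Proof. by move=> If; rewrite /expect /Rintegral fineK//; exact: integrable_fin_num. Qed.

Lemma expect_ae (f g : Omega -> R) : intg f -> measurable_fun setT g ->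
  {ae P, forall w, f w = g w} -> expect f = expect g.
Proof.
move=> If mg fg; rewrite /expect /Rintegral; congr fine.
apply: ae_eq_integral => //.
- exact: measurable_int If.
- exact/measurable_EFinP.
- by apply: filterS fg => w /= -> .
Qed.

Lemma expect_ae_le (f g : Omega -> R) : intg f -> intg g ->
  {ae P, forall w, f w <= g w} -> expect f <= expect g.
Proof.
move=> If Ig fg; have mf := intg_meas If; have mg := intg_meas Ig.
have <- : expect (fun w => Num.max (f w) (g w)) = expect g.
  apply/esym/expect_ae => //; first exact: measurable_maxr.
  by apply: filterS fg => w fgw; rewrite max_r.
apply: expect_le => //.
  apply: (@intg_le _ (fun w => `|f w| + `|g w|)); first exact: measurable_maxr.
    by apply: intgD; [exact: (integrable_norm If)|exact: (integrable_norm Ig)].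
  by move=> w; rewrite maxEle; case: ifP => _; rewrite ?lerDl ?lerDr.
by move=> w; rewrite le_max lexx.
Qed.

Lemma intg_indicM (A : set Omega) f : measurable A -> intg f ->
  intg (fun w => \1_A w * f w).
Proof.
move=> mA If; apply: (@intg_bndM _ _ 1) => //.
by move=> w; rewrite indicE; case: (w \in A); rewrite ?normr1 ?normr0.
Qed.

Lemma expectZr c f : intg f -> expect (fun w => f w * c) = expect f * c.
Proof. exact: RintegralZr. Qed.

Lemma expectMB (g f1 f2 : Omega -> R) c : measurable_fun setT g ->
  (forall w, `|g w| <= c) -> intg f1 -> intg f2 ->
  expect (fun w => g w * (f1 w - f2 w)) =
  expect (fun w => g w * f1 w) - expect (fun w => g w * f2 w).
Proof.
move=> mg gc I1 I2; rewrite -expectB; try exact: intg_bndM gc _.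
by apply: expect_ext => w; rewrite mulrBr.
Qed.

Lemma expect_indicB (A : set Omega) f g : measurable A -> intg f -> intg g ->
  expect (fun w => \1_A w * (f w - g w)) =
  expect (fun w => \1_A w * f w) - expect (fun w => \1_A w * g w).
Proof.
move=> mA If Ig; rewrite -expectB; try exact: intg_indicM.
by apply: expect_ext => w; rewrite mulrBr.
Qed.

Lemma expect_indic (A : set Omega) : measurable A -> expect \1_A = fine (P A).
Proof.
by move=> mA; rewrite /expect /Rintegral integral_indic// setIT.
Qed.

Lemma expect_in (A : set Omega) f :
  \int[P]_(w in A) f w = expect (fun w => \1_A w * f w).
Proof.
rewrite Rintegral_mkcond; apply: expect_ext => w.
by rewrite /patch indicE; case: (w \in A); rewrite ?mul1r ?mul0r.
Qed.

Lemma intg_ae_bnd (f : Omega -> R) c : measurable_fun setT f ->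
  {ae P, forall w, `|f w| <= c} -> intg f.
Proof.
move=> mf fc; apply/integrableP; split; first exact/measurable_EFinP.
apply: (@le_lt_trans _ _ (\int[P]_w (`|c|)%:E)%E); last first.
  by rewrite integral_cst//= probability_setT mule1 ltry.
apply: ae_ge0_le_integral => //.
- by do 2 apply: measurableT_comp => //; exact/measurable_EFinP.
- by apply: filterS fc => w h _; rewrite /= lee_fin (le_trans h)// ler_norm.
Qed.

End Expectation.

(** * Sub-sigma-algebras given by generators *)

Section SubSigma.
Context {R : realType} {d : measure_display} {Omega : measurableType d}.

(** Measurability for the sigma-algebra generated by S, kept as a predicate on
    functions of Omega because several such sigma-algebras coexist. *)
Definition smeas (S : set (set Omega)) (g : Omega -> R) : Prop :=
  measurable_fun [set: g_sigma_algebraType S] g.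

Lemma smeas_sub (S S' : set (set Omega)) g :
  S `<=` <<s S' >> -> smeas S g -> smeas S' g.
Proof.
move=> SS' mg _ Y mY; have := mg measurableT Y mY.
rewrite !setTI; apply: smallest_sub => //; exact: smallest_sigma_algebra.
Qed.

Lemma smeasW (S : set (set Omega)) g :
  S `<=` measurable -> smeas S g -> measurable_fun setT g.
Proof.
move=> SM mg _ Y mY; have := mg measurableT Y mY.
by apply: smallest_sub => //; exact: sigma_algebra_measurable.
Qed.

Lemma smeas_gen (S : set (set Omega)) g :
  (forall B, measurable B -> S (g @^-1` B)) -> smeas S g.
Proof.
by move=> Sg _ Y mY; rewrite setTI; apply: sub_sigma_algebra; exact: Sg.
Qed.

Lemma gen_measurable (S : set (set Omega)) D : S `<=` measurable -> <<s S >> D -> measurable D.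
Proof.
by move=> SM; apply: smallest_sub => //; exact: sigma_algebra_measurable.
Qed.

Variable P : probability Omega R.
Let E := expect P.

Import HBNNSimple.

(** The functional g |-> E [g h] is determined by its values on indicators:
    split g into positive and negative parts, approximate each by simple
    functions, and pass to the limit with |g h| as dominating function. *)
Lemma expect_mono0 (S : set (set Omega)) (h g : Omega -> R) :
  S `<=` measurable -> intg P h -> smeas S g ->
  intg P (fun w => g w * h w) ->
  (forall D, <<s S >> D -> E (fun w => \1_D w * h w) = 0) ->
  E (fun w => g w * h w) = 0.
Proof.
move=> SM Ih mg Igh H.
wlog g0 : g mg Igh / forall w, 0 <= g w.
  move=> W.
  have mp : smeas S (fun w => Num.max (g w) 0) by apply: measurable_maxr.
  have mn : smeas S (fun w => Num.max (- g w) 0).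
    by apply: measurable_maxr => //; exact: measurable_funN.
  have Ibd (k : Omega -> R) : smeas S k -> (forall w, `|k w| <= `|g w|) ->
      intg P (fun w => k w * h w).
    move=> mk kg; apply: (@intg_le _ _ _ _ _ (fun w => `|g w * h w|)).
    - by apply: measurable_funM; [exact: smeasW mk|exact: intg_meas Ih].
    - exact: (integrable_norm Igh).
    - by move=> w; rewrite !normrM ler_wpM2r.
  have Ip : intg P (fun w => Num.max (g w) 0 * h w).
    by apply: Ibd => // w; rewrite maxEle; case: ifP; rewrite ?normr0.
  have In : intg P (fun w => Num.max (- g w) 0 * h w).
    by apply: Ibd => // w; rewrite maxEle; case: ifP; rewrite ?normr0 ?normrN.
  transitivity (E (fun w => Num.max (g w) 0 * h w - Num.max (- g w) 0 * h w)).
    apply: expect_ext => w; rewrite -mulrBl; congr (_ * _).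
    rewrite !maxEle oppr_le0; case: (leP (g w) 0) => ?; case: (leP 0 (g w)) => ?; try lra.
  have p0 (k : Omega -> R) w : 0 <= Num.max (k w) 0 by rewrite le_max lexx orbT.
  by rewrite [E _](expectB Ip In) -/E (W _ mp Ip (p0 _)) (W _ mn In (p0 _)) subrr.
pose mgE : measurable_fun [set: g_sigma_algebraType S] (EFin \o g) :=
  (measurable_EFinP _ _).2 mg.
pose g_ := nnsfun_approx measurableT mgE.
have mgn n : smeas S (g_ n) by exact: measurable_funPT.
have gcvg w : EFin \o g_^~ w @ \oo --> (g w)%:E.
  by apply: (@cvg_nnsfun_approx _ _ _ _ measurableT _ mgE) => // x _; rewrite lee_fin.
have gnd w : nondecreasing_seq (fun n => g_ n w).
  by move=> m n mn; exact/lefP/nd_nnsfun_approx.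
have gle n w : g_ n w <= g w.
  rewrite -lee_fin /g_ nnsfun_approxE.
  by apply: (@le_approx _ _ _ setT (EFin \o g)) => // x _; rewrite lee_fin.
have Ign n : intg P (fun w => g_ n w * h w).
  apply: (@intg_le _ _ _ _ _ (fun w => `|g w * h w|)).
  - by apply: measurable_funM; [exact: smeasW (mgn n)|exact: intg_meas Ih].
  - exact: (integrable_norm Igh).
  - by move=> w; rewrite !normrM ler_wpM2r// ger0_norm// ger0_norm.
have En n : E (fun w => g_ n w * h w) = 0.
  transitivity (E (fun w => \sum_(y <- fset_set (range (g_ n)))
      y * (\1_(g_ n @^-1` [set y]) w * h w))).
    apply: expect_ext => w; rewrite fimfunE fsbig_finite//= mulr_suml.
    by apply: eq_bigr => y _; rewrite mulrA.
  have sD (y : R) : <<s S >> (g_ n @^-1` [set y]).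
    by rewrite -[X in <<s _ >> X]setTI; exact: (mgn n measurableT [set y]).
  have Ii (y : R) : intg P (fun w => \1_(g_ n @^-1` [set y]) w * h w).
    by apply: intg_indicM => //; exact: gen_measurable (sD y).
  rewrite [E _]expect_sum; last by move=> i _; apply: intgZ; exact: Ii.
  by apply: big1 => i _; rewrite expectZ -/E ?H ?mulr0//.
have [| | | | | _ _ W] := @dominated_convergence _ _ _ P setT measurableT
  (fun n w => (g_ n w * h w)%:E) (fun w => (g w * h w)%:E)
  (fun w => `|g w * h w|%:E).
- by move=> n; apply/measurable_EFinP/(intg_meas (Ign n)).
- exact/measurable_EFinP/(intg_meas Igh).
- apply: aeW => w _.
  under eq_fun do rewrite EFinM; rewrite EFinM.
  by apply: cvgeZr => //; exact: gcvg.
- exact: (integrable_norm Igh).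
- apply: aeW => w n _; rewrite lee_fin !normrM ler_wpM2r//.
  by rewrite ger0_norm// ger0_norm.
have W0 : [sequence (\int[P]_x (g_ n x * h x)%:E)%E]_n = fun=> 0%:E.
  by apply/funext => n /=; rewrite (expect_fin (Ign n)) -/E En.
rewrite W0 (expect_fin Igh) -/E in W.
apply/EFin_inj; move/cvg_lim : W => <- //.
by apply/cvg_lim => //; exact: cvg_cst.
Qed.

End SubSigma.

(** * Conditional moments of the noise given identifiers and covariates *)

Section CondLaw.
Context {R : realType} {d : measure_display} {Omega : measurableType d}.
Variable P : probability Omega R.
Let E := expect P.

Import HBSimple.

(** Simple functions are dense in L1 of the law of eps. *)
Lemma simple_approx (eps : Omega -> R) (phi : R -> R) (e : R) :
  measurable_fun setT eps -> measurable_fun setT phi ->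
  intg P (phi \o eps) -> 0 < e ->
  exists (s : seq R) (A : R -> set R), (forall y, measurable (A y)) /\
    E (fun w => `|phi (eps w) - \sum_(y <- s) y * \1_(A y) (eps w)|) <= e.
Proof.
move=> meps mphi Iphi e0.
have Ipush : (pushforward P eps).-integrable setT (EFin \o phi).
  apply: (integrable_pushforward meps) => //; exact/measurable_EFinP.
have [g [Ig _ cvg]] := approximation_sfun_integrable measurableT Ipush.
have mg n : measurable_fun setT (g n) by exact: measurable_funPT.
have Ign n : intg P (fun w => g n (eps w)).
  apply: (@intg_bnd _ _ _ _ _ (\sum_(y <- fset_set (range (g n))) `|y|)).
    exact: measurableT_comp (mg n) meps.
  move=> w; rewrite (big_fsetD1 (g n (eps w)))/=; last first.
    by rewrite in_fset_set//; apply: mem_set; exists (eps w).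
  by rewrite lerDl sumr_ge0.
have Idn n : intg P (fun w => `|phi (eps w) - g n (eps w)|).
  by apply: (integrable_norm (intgB Iphi (Ign n))).
have [n Hn] : exists n, (\int[pushforward P eps]_z `|(phi z)%:E - (g n z)%:E| < e%:E)%E.
  move/fine_cvgP : cvg => [fin_ cvg].
  have /cvgrPdist_lt /(_ e e0) := cvg.
  move=> near1; have [n _ H] := filterI fin_ near1.
  have [] := H n (leqnn n); rewrite /= sub0r normrN => finn ltn.
  exists n; rewrite -(fineK finn) lte_fin.
  exact: le_lt_trans (ler_norm _) ltn.
exists (fset_set (range (g n))), (fun y => g n @^-1` [set y]); split.
  by move=> y; rewrite -[X in measurable X]setTI; exact: (mg n).
have -> : E (fun w => `|phi (eps w) -
    \sum_(y <- fset_set (range (g n))) y * \1_(g n @^-1` [set y]) (eps w)|) =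
  E (fun w => `|phi (eps w) - g n (eps w)|).
  by apply: expect_ext => w; rewrite [in RHS]fimfunE fsbig_finite.
rewrite -lee_fin -(expect_fin (Idn n)); apply: ltW; apply: le_lt_trans Hn.
rewrite ge0_integral_pushforward//=.
apply: ((measurable_EFinP setT (fun x => `|phi x - g n x|)).2 _).
by apply: measurableT_comp => //; exact: measurable_funB.
Qed.

(** Any conditional moment of eps given the design is a function of the
    identifiers, because the conditional law q is; it must therefore be the
    moment V known given the identifiers.  Concretely, a simple function Zn of
    eps has conditional expectation Vn = sum_y y q(A_y) for both
    sigma-algebras.  If Zn is L1-close to phi(eps), then Vn is L1-close to V:
    both depend on the identifiers only, so the L1 norm of Vn - V is read off
    its integrals over {V <= Vn} and the complement. *)
Lemma cond_exp_transfer (Sid Sde : set (set Omega)) (eps : Omega -> R)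
    (phi : R -> R) (V : Omega -> R) (q : set R -> Omega -> R) :
  Sde `<=` measurable -> Sid `<=` <<s Sde >> ->
  measurable_fun setT eps -> measurable_fun setT phi ->
  intg P (phi \o eps) -> intg P V -> smeas Sid V ->
  (forall A, measurable A -> smeas Sid (q A)) ->
  (forall A, measurable A -> forall w, 0 <= q A w <= 1) ->
  (forall D A, <<s Sde >> D -> measurable A ->
     E (fun w => \1_D w * \1_A (eps w)) = E (fun w => \1_D w * q A w)) ->
  (forall D, <<s Sid >> D ->
     E (fun w => \1_D w * phi (eps w)) = E (fun w => \1_D w * V w)) ->
  forall D, <<s Sde >> D ->
     E (fun w => \1_D w * phi (eps w)) = E (fun w => \1_D w * V w).
Proof.
move=> SdeM Sidde meps mphi Iphi IV mV mq q01 Hq HV D sD.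
have mid D' : <<s Sid >> D' -> <<s Sde >> D'.
  apply: smallest_sub => //; exact: smallest_sigma_algebra.
have mde := gen_measurable SdeM.
have SidM : Sid `<=` measurable by move=> B /Sidde; exact: mde.
apply/eqP; rewrite -subr_eq0 -normr_le0; apply/ler_addgt0Pr => e e0; rewrite add0r.
have e3 : 0 < e / 3 by rewrite divr_gt0.
have [s [A [mA HA]]] := simple_approx meps mphi Iphi e3.
pose Zn w := \sum_(y <- s) y * \1_(A y) (eps w).
pose Vn w := \sum_(y <- s) y * q (A y) w.
have mqT y : measurable_fun setT (q (A y)) by exact: smeasW SidM (mq _ (mA y)).
have I1 y : intg P (fun w => \1_(A y) (eps w)).
  apply: (@intg_bnd _ _ _ _ _ 1).
    by apply: (@measurableT_comp _ _ _ _ _ _ (\1_(A y) : R -> R)).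
  by move=> w; rewrite indicE; case: (_ \in _); rewrite ?normr1 ?normr0.
have Iq y : intg P (q (A y)).
  apply: (@intg_bnd _ _ _ _ _ 1) => // w.
  by case/andP : (q01 _ (mA y) w) => *; rewrite ger0_norm.
have IZn : intg P Zn by apply: intg_sum => y _; apply: intgZ; exact: I1.
have IVn : intg P Vn by apply: intg_sum => y _; apply: intgZ; exact: Iq.
have IZ : intg P (fun w => phi (eps w)) by exact: Iphi.
have mVn : smeas Sid Vn.
  apply: measurable_sum => y; apply: measurable_funM => //; exact: mq.
have HZV D' : <<s Sde >> D' ->
    E (fun w => \1_D' w * Zn w) = E (fun w => \1_D' w * Vn w).
  move=> sD'.
  transitivity (E (fun w => \sum_(y <- s) y * (\1_D' w * \1_(A y) (eps w)))).
    by apply: expect_ext => w; rewrite mulr_sumr; apply: eq_bigr => y _; rewrite mulrCA.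
  transitivity (E (fun w => \sum_(y <- s) y * (\1_D' w * q (A y) w))); last first.
    by apply: expect_ext => w; rewrite mulr_sumr; apply: eq_bigr => y _; rewrite mulrCA.
  have Im k : intg P k -> intg P (fun w => \1_D' w * k w).
    by apply: intg_indicM; exact: mde.
  rewrite /E expect_sum; last by move=> y _; apply/intgZ/Im; exact: I1.
  rewrite expect_sum; last by move=> y _; apply/intgZ/Im; exact: Iq.
  apply: eq_bigr => y _; rewrite expectZ; last by apply: Im; exact: I1.
  rewrite expectZ; last by apply: Im; exact: Iq.
  by rewrite -/E (Hq _ _ sD' (mA y)).
pose Dz := E (fun w => `|phi (eps w) - Zn w|).
have IDz : intg P (fun w => `|phi (eps w) - Zn w|) by exact: (integrable_norm (intgB _ _)).
have bndZ D' : measurable D' -> `|E (fun w => \1_D' w * (phi (eps w) - Zn w))| <= Dz.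
  move=> mD'; have IBZ := intgB IZ IZn.
  apply: le_trans (expect_norm _) _; first exact: intg_indicM.
  apply: expect_le => //; first exact: (integrable_norm (intg_indicM _ IBZ)).
  move=> w; rewrite normrM ger0_norm// indicE.
  by case: (_ \in _); rewrite ?mul1r ?mul0r.
have diffV D' : <<s Sid >> D' -> E (fun w => \1_D' w * (Vn w - V w)) =
    - E (fun w => \1_D' w * (phi (eps w) - Zn w)).
  move=> sD'; have mD' := mde _ (mid _ sD').
  by rewrite /E !expect_indicB// -/E HV// HZV ?opprB//; exact: mid.
have bndV D' : <<s Sid >> D' -> `|E (fun w => \1_D' w * (Vn w - V w))| <= Dz.
  by move=> sD'; rewrite diffV// normrN; apply: bndZ; exact: mde _ (mid _ sD').
pose B := [set w | V w <= Vn w].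
have sB : <<s Sid >> B.
  have := @measurable_fun_ler _ (g_sigma_algebraType Sid) R setT V Vn mV mVn measurableT [set true].
  rewrite setTI => /(_ _).
  have -> : (fun x => V x <= Vn x) @^-1` [set true] = B by [].
  by apply.
have sCB : <<s Sid >> (~` B) by exact: sigma_algebraC.
have bndVn : E (fun w => `|Vn w - V w|) <= Dz + Dz.
  have IBV := intgB IVn IV.
  have mB := mde _ (mid _ sB); have mCB := mde _ (mid _ sCB).
  have -> : E (fun w => `|Vn w - V w|) = E (fun w =>
      \1_B w * (Vn w - V w) + - 1 * (\1_(~` B) w * (Vn w - V w))).
    apply: expect_ext => w; rewrite !indicE in_setC; case: (boolP (w \in B)).
      move=> /set_mem /= VVn; rewrite ger0_norm ?subr_ge0//=; lra.
    move=> wB; have {wB} : Vn w < V w.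
      by rewrite ltNge; apply/negP => VVn; move/negP: wB; apply; apply: mem_set.
    by move=> VVn; rewrite ltr0_norm ?subr_lt0//=; lra.
  rewrite /E expectD; [|exact: intg_indicM|apply: intgZ; exact: intg_indicM].
  rewrite expectZ; last exact: intg_indicM.
  rewrite mulN1r; apply: lerD; apply: le_trans (ler_norm _) _; rewrite ?normrN; exact: bndV.
have mD := mde _ sD.
have -> : E (fun w => \1_D w * phi (eps w)) - E (fun w => \1_D w * V w) =
    E (fun w => \1_D w * (phi (eps w) - Zn w)) + E (fun w => \1_D w * (Vn w - V w)).
  by rewrite /E !expect_indicB// -/E HZV//; lra.
have bnd2 : `|E (fun w => \1_D w * (Vn w - V w))| <= Dz + Dz.
  have IBV := intgB IVn IV.
  apply: le_trans bndVn; apply: le_trans (expect_norm _) _; first exact: intg_indicM.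
  apply: expect_le => //; try exact: (integrable_norm (intg_indicM _ IBV)).
    exact: (integrable_norm IBV).
  move=> w; rewrite normrM indicE.
  by case: (_ \in _); rewrite ?normr1 ?normr0 ?mul1r ?mul0r.
apply: le_trans (ler_normD _ _) _; have b1 := bndZ _ mD.
have : Dz <= e / 3 by [].
lra.
Qed.

End CondLaw.

Section Noise.
Context {R : realType} {d : measure_display} {Omega : measurableType d}.
Variable P : probability Omega R.
Let E := expect P.

Lemma sigma_fun_preimage (eps : Omega -> R) D :
  <<s [set eps @^-1` A | A in (@measurable _ R)] >> D ->
  exists2 A, measurable A & D = eps @^-1` A.
Proof.
have : sigma_algebra setT [set eps @^-1` A | A in (@measurable _ R)].
  have -> : [set eps @^-1` A | A in (@measurable _ R)] =
      preimage_set_system setT eps (@measurable _ R).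
    by apply/seteqP; split=> B [A mA] <-; exists A; rewrite ?setTI.
  exact/sigma_algebra_preimage/sigma_algebra_measurable.
by move=> /sigma_algebra_id -> [A mA <-]; exists A.
Qed.

Lemma expect_mono0_fun (eps h : Omega -> R) :
  measurable_fun setT eps -> intg P h -> intg P (fun w => eps w * h w) ->
  (forall A, measurable A -> E (fun w => \1_A (eps w) * h w) = 0) ->
  E (fun w => eps w * h w) = 0.
Proof.
move=> meps Ih Ieh H.
apply: (@expect_mono0 _ _ _ P [set eps @^-1` A | A in (@measurable _ R)]) => //.
- by move=> _ [A mA <-]; rewrite -[X in measurable X]setTI; exact: meps.
- by apply: smeas_gen => B mB; exists B.
- by move=> D /sigma_fun_preimage[A mA ->]; exact: (H A mA).
Qed.

Context {I : finType}.
Variables (Sid Sde : set (set Omega)) (V eps : I -> Omega -> R).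
Hypothesis SdeM : Sde `<=` measurable.
Hypothesis Sidde : Sid `<=` <<s Sde >>.
Hypothesis mV : forall o, smeas Sid (V o).
Hypothesis meps : forall o, measurable_fun setT (eps o).
Hypothesis Hindep : noise_cond_indep P <<s Sde >> V eps.

(** Taking all but one or two of the Borel sets to be the whole line in the
    product formula gives the conditional law of one noise variable, and the
    conditional independence of two. *)
Lemma cond_laws : exists q : I -> set R -> Omega -> R,
  [/\ forall o A, measurable A -> smeas Sid (q o A),
      forall o A, measurable A -> forall w, 0 <= q o A w <= 1,
      forall o D A, <<s Sde >> D -> measurable A ->
        E (fun w => \1_D w * \1_A (eps o w)) = E (fun w => \1_D w * q o A w) &
      forall o o' D A A', o != o' -> <<s Sde >> D -> measurable A -> measurable A' ->
        E (fun w => \1_D w * (\1_A (eps o w) * \1_A' (eps o' w))) =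
        E (fun w => \1_D w * (q o A w * q o' A' w))].
Proof.
have [nu Hnu] := Hindep.
pose q o A w := fine (nu o (V o w) A).
have mq o A : measurable A -> smeas Sid (q o A).
  move=> mA; apply: (@measurableT_comp _ _ _ _ _ _ (fun v => fine (nu o v A))) (mV o).
  by apply: measurableT_comp => //; exact: measurable_kernel.
have q01 o A : measurable A -> forall w, 0 <= q o A w <= 1.
  move=> mA w; have le1 : (nu o (V o w) A <= 1)%E.
    rewrite -(@prob_kernel _ _ _ _ _ (nu o) (V o w)).
    by apply: le_measure => //; apply: mem_set => //; exact: measurableT.
  rewrite /q fine_ge0//= -lee_fin fineK// ge0_fin_numE//.
  exact: le_lt_trans le1 (ltry _).
have qT o w : q o setT w = 1 by rewrite /q prob_kernel.
have SidM : Sid `<=` measurable by move=> B /Sidde; exact: gen_measurable.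
have base (D : set Omega) (F : I -> set R) : <<s Sde >> D -> (forall o, measurable (F o)) ->
    E (fun w => \1_D w * \prod_o \1_(F o) (eps o w)) = E (fun w => \1_D w * \prod_o q o (F o) w).
  move=> sD mF; have mD := gen_measurable SdeM sD.
  have := Hnu D F sD mF => /(congr1 fine); rewrite -/(Rintegral P D _) expect_in -/E => <-.
  have -> : (fun w => \1_D w * \prod_o \1_(F o) (eps o w)) =
      \1_(D `&` \bigcap_(o in [set: I]) eps o @^-1` F o) :> (Omega -> R).
    apply/funext => w; rewrite indicI /=; congr (_ * _).
    rewrite indicE; case: (boolP (w \in _)) => [/set_mem h|/negP h].
      rewrite big1// => o _; rewrite indicE mem_set//; exact: h.
    have [k hk] : exists k, ~ F k (eps k w).
      apply: contra_notP h => h; apply: mem_set => o _ /=.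
      by apply: contrapT => no; apply: h; exists o.
    by rewrite (bigD1 k)//= indicE memNset// mul0r.
  rewrite /E expect_indic//; apply: measurableI => //.
  rewrite -[X in measurable X]/(\bigcap_(o in [set: I]) _).
  apply: fin_bigcap_measurable => // o _.
  by rewrite -[X in measurable X]setTI; exact: meps.
exists q; split => //.
- move=> o D A sD mA.
  have := @base D (fun o' => if o' == o then A else setT) sD.
  have -> : (fun w => \1_D w * \prod_o0 \1_(if o0 == o then A else setT) (eps o0 w)) =
      (fun w => \1_D w * \1_A (eps o w)) :> (Omega -> R).
    apply/funext => w; congr (_ * _); rewrite (bigD1 o)//= eqxx big1 ?mulr1//.
    by move=> o' /negPf ->; rewrite indicT.
  have -> : (fun w => \1_D w * \prod_o0 q o0 (if o0 == o then A else setT) w) =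
      (fun w => \1_D w * q o A w).
    apply/funext => w; congr (_ * _); rewrite (bigD1 o)//= eqxx big1 ?mulr1//.
    by move=> o' /negPf ->; rewrite qT.
  by apply => o'; case: ifP.
- move=> o o' D A A' oo' sD mA mA'.
  have o'o : o' == o = false by rewrite eq_sym (negPf oo').
  have := @base D (fun k => if k == o then A else if k == o' then A' else setT) sD.
  have -> : (fun w => \1_D w * \prod_o0 \1_(if o0 == o then A else if o0 == o' then A' else setT) (eps o0 w)) =
      (fun w => \1_D w * (\1_A (eps o w) * \1_A' (eps o' w))) :> (Omega -> R).
    apply/funext => w; congr (_ * _); rewrite (bigD1 o)//= eqxx; congr (_ * _).
    rewrite (bigD1 o') ?o'o//= ?o'o eqxx big1 ?mulr1//.
    by move=> k /andP[/negPf -> /negPf ->]; rewrite indicT.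
  have -> : (fun w => \1_D w * \prod_o0 q o0 (if o0 == o then A else if o0 == o' then A' else setT) w) =
      (fun w => \1_D w * (q o A w * q o' A' w)).
    apply/funext => w; congr (_ * _); rewrite (bigD1 o)//= eqxx; congr (_ * _).
    rewrite (bigD1 o') ?o'o//= ?o'o eqxx big1 ?mulr1//.
    by move=> k /andP[/negPf -> /negPf ->]; rewrite qT.
  by apply => k; case: ifP => //; case: ifP.
Qed.

Hypothesis Ieps2 : forall o, intg P (fun w => eps o w ^+ 2).
Variable v : I -> Omega -> R.
Hypothesis mv : forall o, smeas Sid (v o).
Hypothesis Iv : forall o, intg P (v o).
Hypothesis eps1 : forall o D, <<s Sid >> D -> E (fun w => \1_D w * eps o w) = 0.
Hypothesis eps2 : forall o D, <<s Sid >> D ->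
  E (fun w => \1_D w * eps o w ^+ 2) = E (fun w => \1_D w * v o w).

Lemma intg_sqr1 (f : Omega -> R) :
  measurable_fun setT f -> intg P (fun w => f w ^+ 2) -> intg P f.
Proof.
move=> mf If; apply: (@intg_le _ _ _ _ _ (fun w => 1 + f w ^+ 2)) => //.
  by apply: intgD => //; exact: intg_cst.
move=> w; rewrite -real_normK ?num_real//.
have := sqr_ge0 (`|f w| - 1); have := normr_ge0 (f w); nra.
Qed.

Lemma intg_sqrM (f g : Omega -> R) :
  measurable_fun setT f -> measurable_fun setT g ->
  intg P (fun w => f w ^+ 2) -> intg P (fun w => g w ^+ 2) ->
  intg P (fun w => f w * g w).
Proof.
move=> mf mg If Ig; apply: (@intg_le _ _ _ _ _ (fun w => f w ^+ 2 + g w ^+ 2)).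
- exact: measurable_funM.
- exact: intgD.
- move=> w; rewrite normrM -(real_normK (num_real (f w))) -(real_normK (num_real (g w))).
  have := sqr_ge0 (`|f w| - `|g w|); have := normr_ge0 (f w); have := normr_ge0 (g w); nra.
Qed.

Let Ieps o : intg P (eps o). Proof. exact: intg_sqr1. Qed.

Lemma noise_mean (g : Omega -> R) c o : smeas Sde g -> (forall w, `|g w| <= c) ->
  E (fun w => g w * eps o w) = 0.
Proof.
move=> mg gc; have mgT := smeasW SdeM mg.
apply: (@expect_mono0 _ _ _ P Sde) => //; first exact: intg_bndM gc (Ieps o).
have [q [mq q01 Hq _]] := cond_laws.
move=> D sD.
rewrite -(expectM0 P \1_D).
apply: (@cond_exp_transfer _ _ _ P Sid Sde (eps o) id (fun=> 0) (q o)) => //.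
- exact: Ieps.
- exact: intg_cst.
- exact: measurable_cst.
- exact: mq.
- exact: q01.
- exact: Hq.
- move=> D' sD'; by rewrite expectM0; exact: eps1.
Qed.

Lemma noise_var (g : Omega -> R) c o : smeas Sde g -> (forall w, `|g w| <= c) ->
  E (fun w => g w * eps o w ^+ 2) = E (fun w => g w * v o w).
Proof.
move=> mg gc; have mgT := smeasW SdeM mg.
have Ih : intg P (fun w => eps o w ^+ 2 - v o w) by exact: intgB.
apply/eqP; rewrite -subr_eq0 /E -expectB; try exact: intg_bndM gc _.
under expect_ext do rewrite -mulrBr.
apply/eqP; apply: (@expect_mono0 _ _ _ P Sde) => //; first exact: intg_bndM gc Ih.
have [q [mq q01 Hq _]] := cond_laws.
move=> D sD; rewrite expect_indicB//; last exact: gen_measurable sD.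
apply/eqP; rewrite subr_eq0; apply/eqP.
apply: (@cond_exp_transfer _ _ _ P Sid Sde (eps o) (fun x => x ^+ 2) (v o) (q o)) => //.
- exact: Ieps2.
- exact: mq.
- exact: q01.
- exact: Hq.
- exact: eps2.
Qed.

(** Both noise variables are unbounded, so the factors are introduced one at a
    time.  For an indicator in place of eps', conditional independence allows
    one to replace it by its conditional law, after which eps has mean zero;
    then [expect_mono0_fun] passes from indicators of eps' to eps' itself. *)
Lemma noise_cov (g : Omega -> R) c o o' : o != o' ->
  smeas Sde g -> (forall w, `|g w| <= c) ->
  E (fun w => g w * (eps o w * eps o' w)) = 0.
Proof.
move=> oo' mg gc; have mgT := smeasW SdeM mg.
have Iee : intg P (fun w => eps o w * eps o' w) by exact: intg_sqrM.
apply: (@expect_mono0 _ _ _ P Sde) => //; first exact: intg_bndM gc Iee.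
have [q [mq q01 Hq Hqq]] := cond_laws.
have SidM : Sid `<=` measurable by move=> B /Sidde; exact: gen_measurable.
have mqT k A : measurable A -> measurable_fun setT (q k A).
  by move=> mA; exact: smeasW SidM (mq k A mA).
have mqde k A : measurable A -> smeas Sde (q k A).
  by move=> mA; exact: smeas_sub Sidde (mq k A mA).
move=> D sD; have mD := gen_measurable SdeM sD.
have smD : smeas Sde (\1_D : Omega -> R).
  exact: (@measurable_indic _ (g_sigma_algebraType Sde) R setT D sD).
have in01 (A : set R) x : `|\1_A x : R| <= 1.
  by rewrite indicE; case: (_ \in _); rewrite ?normr1 ?normr0.
have inO (A : set Omega) x : `|\1_A x : R| <= 1.
  by rewrite indicE; case: (_ \in _); rewrite ?normr1 ?normr0.
have qn1 k A w : measurable A -> `|q k A w| <= 1.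
  by move=> mA; have /andP[? ?] := q01 k A mA w; rewrite ger0_norm.
have mi k (A : set R) : measurable A -> measurable_fun setT (fun w => \1_A (eps k w) : R).
  by move=> mA; apply: (@measurableT_comp _ _ _ _ _ _ (\1_A : R -> R)).
have mIeps1 (A' : set R) : measurable A' -> measurable_fun setT (fun w => \1_D w * \1_A' (eps o' w) : R).
  by move=> mA'; apply: measurable_funM => //; exact: mi.
have mIq1 (A' : set R) : measurable A' -> measurable_fun setT (fun w => \1_D w * q o' A' w).
  by move=> mA'; apply: measurable_funM => //; exact: mqT.
have bM a b : `|a| <= 1 -> `|b| <= 1 -> `|a * b : R| <= 1.
  by move=> a1 b1; rewrite normrM; have := normr_ge0 a; have := normr_ge0 b; nra.
have step1 A' : measurable A' -> E (fun w => \1_A' (eps o' w) * (\1_D w * eps o w)) = 0.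
  move=> mA'.
  pose h w := \1_D w * \1_A' (eps o' w) - \1_D w * q o' A' w.
  have Ih : intg P h.
    by apply: intgB; apply: (@intg_bnd _ _ _ _ _ 1); [exact: mIeps1|move=> w; exact: bM|exact: mIq1|move=> w; apply: bM => //; exact: qn1].
  have h2 w : `|h w| <= 2.
    apply: le_trans (ler_normB _ _) _; rewrite -[2]/(1 + 1); apply: lerD; apply: bM => //; exact: qn1.
  have mh : measurable_fun setT h by exact: intg_meas Ih.
  have Ihe : intg P (fun w => h w * eps o w) by exact: intg_bndM mh h2 (Ieps o).
  have E0 : E (fun w => eps o w * h w) = 0.
    apply: expect_mono0_fun => //.
      by under eq_fun do rewrite mulrC.
    move=> A mA.
    transitivity (E (fun w => \1_D w * (\1_A (eps o w) * \1_A' (eps o' w))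
      - (\1_D w * q o' A' w) * \1_A (eps o w))).
      by apply: expect_ext => w; rewrite /h; ring.
    have IA : intg P (fun w => \1_A (eps o w)).
      by apply: (@intg_bnd _ _ _ _ _ 1); [exact: mi|].
    rewrite /E expectB; last 2 first.
    - apply: (@intg_bnd _ _ _ _ _ 1).
        by apply: measurable_funM => //; apply: measurable_funM; exact: mi.
      by move=> w; apply: (bM _ _) => //; exact: bM.
    - apply: (@intg_bndM _ _ _ _ _ _ 1) => //; first exact: mIq1.
      by move=> w; apply: bM => //; exact: qn1.
    rewrite -/E Hqq// [X in _ - X](_ : _ = E (fun w => (\1_D w * q o' A' w) * q o A w)).
      apply/eqP; rewrite subr_eq0; apply/eqP; apply: expect_ext => w; ring.
    apply/eqP; rewrite -subr_eq0 /E -expectB; last 2 first.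
    - apply: (@intg_bndM _ _ _ _ _ _ 1) => //; first exact: mIq1.
      by move=> w; apply: bM => //; exact: qn1.
    - apply: (@intg_bnd _ _ _ _ _ 1).
        by apply: measurable_funM; [exact: mIq1|exact: mqT].
      by move=> w; apply: (bM _ _); [apply: bM => //|]; exact: qn1.
    under expect_ext do rewrite -mulrBr.
    have Idq : intg P (fun w => \1_A (eps o w) - q o A w).
      apply: intgB => //; apply: (@intg_bnd _ _ _ _ _ 1); first exact: mqT.
      by move=> w; exact: qn1.
    apply/eqP; apply: (@expect_mono0 _ _ _ P Sde) => //.
    - by apply: measurable_funM => //; exact: mqde.
    - apply: (@intg_bndM _ _ _ _ _ _ 1) => //; first exact: mIq1.
      by move=> w; apply: bM => //; exact: qn1.
    - move=> D' sD'; rewrite expect_indicB//; last 2 first.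
      + exact: gen_measurable sD'.
      + apply: (@intg_bnd _ _ _ _ _ 1); first exact: mqT.
        by move=> w; exact: qn1.
      by rewrite -/E Hq ?subrr.
  have IDA : intg P (fun w => \1_A' (eps o' w) * (\1_D w * eps o w)).
    by apply: (@intg_bndM _ _ _ _ _ _ 1) => //; [exact: mi|exact: intg_indicM].
  have IDq : intg P (fun w => (\1_D w * q o' A' w) * eps o w).
    apply: (@intg_bndM _ _ _ _ _ _ 1) => //; first exact: mIq1.
    by move=> w; apply: bM => //; exact: qn1.
  have : E (fun w => \1_A' (eps o' w) * (\1_D w * eps o w)) - E (fun w => (\1_D w * q o' A' w) * eps o w) = 0.
    rewrite -[RHS]E0 /E -expectB//; apply: expect_ext => w; rewrite /h; ring.
  have mDq : smeas Sde (fun w => \1_D w * q o' A' w).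
    by apply: measurable_funM; [exact: smD|exact: mqde].
  rewrite (@noise_mean _ 1 o mDq) ?subr0// => w.
  by apply: bM => //; exact: qn1.
transitivity (E (fun w => eps o' w * (\1_D w * eps o w))).
  by apply: expect_ext => w /=; ring.
apply: expect_mono0_fun => //; first exact: intg_indicM.
have -> : (fun w => eps o' w * (\1_D w * eps o w)) = (fun w => \1_D w * (eps o w * eps o' w)).
  by apply/funext => w; ring.
exact: intg_indicM.
Qed.

End Noise.

(** * Independence *)

Section Independence.
Context {R : realType} {d : measure_display} {Omega : measurableType d}.
Variable P : probability Omega R.
Let E := expect P.

(** Apply [expect_mono0] twice: to g, tested against an event of the first
    sigma-algebra, and then to f, tested against g - E g. *)
Lemma indep_expectM (S1 S2 : set (set Omega)) (f g : Omega -> R) (c1 c2 : R) :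
  S1 `<=` measurable -> S2 `<=` measurable ->
  (forall A B, <<s S1 >> A -> <<s S2 >> B -> P (A `&` B) = (P A * P B)%E) ->
  smeas S1 f -> (forall w, `|f w| <= c1) -> smeas S2 g -> (forall w, `|g w| <= c2) ->
  E (fun w => f w * g w) = E f * E g.
Proof.
move=> S1M S2M ind mf f1 mg g1.
have mfT := smeasW S1M mf; have mgT := smeasW S2M mg.
have If := intg_bnd P mfT f1; have Ig := intg_bnd P mgT g1.
have Icst c : intg P (fun=> c) by exact: intg_cst.
have stepA A : <<s S1 >> A -> E (fun w => g w * \1_A w) = E g * fine (P A).
  move=> sA; have mA := gen_measurable S1M sA.
  have IA : intg P \1_A by exact: integrable_indic.
  have : E (fun w => g w * (\1_A w - fine (P A))) = 0.
    apply: (@expect_mono0 _ _ _ P S2) => //.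
    - exact: intgB.
    - by apply: intg_bndM g1 _ => //; exact: intgB.
    move=> B sB; have mB := gen_measurable S2M sB.
    rewrite expect_indicB// expectZr ?expect_indic//; last exact: integrable_indic.
    rewrite [X in X - _](_ : _ = expect P \1_(B `&` A)); last first.
      by apply: expect_ext => w; rewrite indicI.
    rewrite expect_indic//; last exact: measurableI.
    by rewrite setIC ind// fineM 1?mulrC ?subrr//; exact: fin_num_measure.
  rewrite /E (expectMB mgT g1)// expectZr// => /eqP.
  by rewrite subr_eq0 => /eqP.
have : E (fun w => f w * (g w - E g)) = 0.
  apply: (@expect_mono0 _ _ _ P S1) => //.
  - exact: intgB.
  - by apply: intg_bndM f1 _ => //; exact: intgB.
  move=> A sA; have mA := gen_measurable S1M sA.
  rewrite expect_indicB// expectZr; last exact: integrable_indic.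
  rewrite [X in X - _](_ : _ = E (fun w => g w * \1_A w)); last first.
    by apply: expect_ext => w; rewrite mulrC.
  by rewrite stepA// expect_indic// mulrC subrr.
rewrite /E (expectMB mfT f1)// expectZr// => /eqP.
by rewrite subr_eq0 => /eqP.
Qed.

Lemma indep_pair (J : finType) (F : J -> set (set Omega)) i j A B :
  indep_sigma P F -> (forall k, F k setT) -> (forall k, F k `<=` measurable) ->
  i != j -> F i A -> F j B ->
  P (A `&` B) = (P A * P B)%E.
Proof.
move=> ind FT FM ij FA FB.
have ji : j == i = false by rewrite eq_sym (negPf ij).
pose D k := if k == i then A else if k == j then B else setT.
have := ind D; have -> : \bigcap_(k in [set: J]) D k = A `&` B.
  apply/seteqP; split=> w.
    by move=> h; have := h i I; have := h j I; rewrite /D !eqxx ji.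
  by move=> [Aw Bw] k _; rewrite /D; case: ifP => // _; case: ifP.
rewrite (bigD1 i)//= (bigD1 j) ?ji//= big1 => [|k /andP[/negPf ki /negPf kj]].
  rewrite /D !eqxx ji mulr1 EFinM !fineK; last 2 first.
  - by apply: fin_num_measure; exact: FM FB.
  - by apply: fin_num_measure; exact: FM FA.
  by apply=> k; case: eqP => [->//|_]; case: eqP => [->|].
by rewrite /D ki kj probability_setT.
Qed.

(** The finite measures B |-> P (A `&` B) and B |-> P A * P B agree on the
    intersections of one event per index, which form a pi-system generating
    the sigma-algebra of all these indices. *)
Lemma indep_option (J : finType) (F : option J -> set (set Omega)) A B :
  indep_sigma P F -> (forall k, sigma_algebra setT (F k)) ->
  (forall k, F k `<=` measurable) ->
  F None A ->
  <<s [set D | exists k : J, F (Some k) D] >> B ->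
  P (A `&` B) = (P A * P B)%E.
Proof.
move=> ind FS FM FA sB; have mA := FM _ _ FA.
have FT k : F k setT.
  by have [F0 FC _] := FS k; rewrite -[setT](setD0 setT); exact: FC.
have FI k C D : F k C -> F k D -> F k (C `&` D).
  by move=> FC FD; rewrite -(sigma_algebra_id (FS k)); apply: (@measurableI _ (g_sigma_algebraType (F k))); exact: sub_sigma_algebra.
pose G := [set C | exists2 D : J -> set Omega, (forall j, F (Some j) (D j)) &
  C = \bigcap_(j in [set: J]) D j].
have GM : G `<=` measurable.
  move=> _ [D FD ->]; apply: fin_bigcap_measurable => // j _; exact: FM (FD j).
have GT : G setT by exists (fun=> setT) => //; rewrite bigcapT.
have GI : setI_closed G.
  move=> _ _ [D FD ->] [D' FD' ->]; exists (fun j => D j `&` D' j).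
    by move=> j; exact: FI.
  by rewrite bigcapI.
have finA : P A \is a fin_num by exact: fin_num_measure.
pose r := NngNum (fine_ge0 (measure_ge0 P A)).
have rE : (r%:num%:E = P A)%E by exact: fineK.
have : mrestr P mA B = mscale r P B.
  apply: (@g_sigma_algebra_measure_unique _ _ _ G GM (fun=> setT)) => //.
  - by rewrite bigcup_const.
  - move=> _ [D FD ->]; pose C := \bigcap_(j in [set: J]) D j.
    change (P (C `&` A) = (r%:num%:E * P C)%E); rewrite rE setIC /C {C}.
    have i1 := ind (fun k => if k is Some j then D j else A).
    have i2 := ind (fun k => if k is Some j then D j else setT).
    have e1 : \bigcap_(k in [set: option J]) (if k is Some j then D j else A) =
        A `&` \bigcap_(j in [set: J]) D j.
      apply/seteqP; split=> w.
        by move=> h; split; [exact: (h None I)|move=> j _; exact: (h (Some j) I)].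
      by move=> [Aw Dw] [j|] _ //; exact: Dw.
    have e2 : \bigcap_(k in [set: option J]) (if k is Some j then D j else setT) =
        \bigcap_(j in [set: J]) D j.
      apply/seteqP; split=> w; first by move=> h j _; exact: (h (Some j) I).
      by move=> Dw [j|] _ //; exact: Dw.
    rewrite -e1 -e2 i1 ?i2; last 2 first.
    + by move=> [j|].
    + by move=> [j|].
    rewrite (bigD1 None)//= EFinM fineK// [in RHS](bigD1 None)//= probability_setT mul1r.
    by congr (_ * (_)%:E)%E; apply: eq_bigr => -[].
  - move=> k; change (P (setT `&` A) < +oo)%E; rewrite setTI.
    by rewrite (le_lt_trans (probability_le1 P mA)) ?ltry.
  - move: sB; apply: smallest_sub; first exact: smallest_sigma_algebra.
    move=> D [k FD]; apply: sub_sigma_algebra; exists (fun j => if j == k then D else setT).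
      by move=> j; case: eqP => [->|].
    apply/seteqP; split=> w; first by move=> Dw j _ /=; case: ifP.
    by move=> /(_ k I); rewrite /= eqxx.
by move=> h; have : (P (B `&` A) = r%:num%:E * P B)%E := h; rewrite rE setIC.
Qed.

(** Only the diagonal terms of the expanded square survive. *)
Lemma var_sum_le (J : finType) (f : J -> Omega -> R) (c : R) :
  (forall j, measurable_fun setT (f j)) -> (forall j w, `|f j w| <= c) ->
  (forall i j, i != j -> E (fun w => f i w * f j w) = E (f i) * E (f j)) ->
  E (fun w => (\sum_j (f j w - E (f j))) ^+ 2) <= \sum_j E (fun w => f j w ^+ 2).
Proof.
move=> mf fc ind.
have If j : intg P (f j) by exact: intg_bnd (mf j) (fc j).
have Iff i j : intg P (fun w => f i w * f j w).
  exact: intg_bndM (mf i) (fc i) (If j).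
pose X j w := f j w - E (f j).
have IXX i j : intg P (fun w => X i w * X j w).
  have -> : (fun w => X i w * X j w) = (fun w => f i w * f j w + (- E (f j)) * f i w
      + ((- E (f i)) * f j w + E (f i) * E (f j))).
    by apply/funext => w; rewrite /X; ring.
  by apply: intgD; [apply: intgD => //; exact: intgZ|apply: intgD; [exact: intgZ|exact: intg_cst]].
have EXX i j : E (fun w => X i w * X j w) = E (fun w => f i w * f j w) - E (f i) * E (f j).
  pose k w := E (f j) * f i w + (E (f i) * f j w + - (E (f i) * E (f j))).
  have I2 : intg P (fun w => E (f i) * f j w + - (E (f i) * E (f j))).
    by apply: intgD; [exact: intgZ|exact: intg_cst].
  have Ik : intg P k by apply: intgD => //; exact: intgZ.
  transitivity (E (fun w => f i w * f j w - k w)).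
    by apply: expect_ext => w; rewrite /X /k; ring.
  rewrite /E expectB//; congr (_ - _).
  rewrite /k expectD//; last exact: intgZ.
  rewrite expectD; [|exact: intgZ|exact: intg_cst].
  rewrite !expectZ// expect_cst -/E; ring.
have -> : E (fun w => (\sum_j X j w) ^+ 2) = \sum_i \sum_j E (fun w => X i w * X j w).
  transitivity (E (fun w => \sum_i \sum_j X i w * X j w)).
    apply: expect_ext => w; rewrite expr2 mulr_suml; apply: eq_bigr => i _.
    by rewrite mulr_sumr.
  rewrite [E _]expect_sum; last by move=> i _; apply: intg_sum.
  by apply: eq_bigr => i _; rewrite expect_sum.
apply: ler_sum => i _; rewrite (bigD1 i)//= big1 ?addr0; last first.
  by move=> j ji; rewrite EXX ind ?subrr// eq_sym.
rewrite EXX lerBlDr; apply: (@le_trans _ _ (E (fun w => f i w ^+ 2))).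
  by under [leRHS]expect_ext do rewrite expr2.
by rewrite lerDl -expr2 sqr_ge0.
Qed.

End Independence.

(** * Quadratic forms and the Loewner order *)

Section Quadratic.
Context {R : realType}.
Implicit Types m : nat.

Definition dot m (x y : 'cV[R]_m) : R := \sum_i x i 0 * y i 0.
Definition sqn m (x : 'cV[R]_m) : R := dot x x.

Lemma dotE m (x y : 'cV[R]_m) : dot x y = (x^T *m y) 0 0.
Proof. by rewrite !mxE; apply: eq_bigr => i _; rewrite mxE. Qed.

Lemma quadE m (A : 'M[R]_m) x : quad A x = dot x (A *m x).
Proof. by rewrite /quad dotE mulmxA. Qed.

Lemma dotC m (x y : 'cV[R]_m) : dot x y = dot y x.
Proof. by apply: eq_bigr => i _; rewrite mulrC. Qed.

Lemma dotDr m (x y z : 'cV[R]_m) : dot x (y + z) = dot x y + dot x z.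
Proof. by rewrite -big_split; apply: eq_bigr => i _; rewrite !mxE mulrDr. Qed.

Lemma dotZr m a (x y : 'cV[R]_m) : dot x (a *: y) = a * dot x y.
Proof. by rewrite mulr_sumr; apply: eq_bigr => i _; rewrite !mxE mulrCA. Qed.

Lemma dot_sumr m (I : finType) (x : 'cV[R]_m) (F : I -> 'cV[R]_m) :
  dot x (\sum_i F i) = \sum_i dot x (F i).
Proof.
rewrite /dot exchange_big/=; apply: eq_bigr => j _.
by rewrite summxE mulr_sumr.
Qed.

Lemma dotDl m (x y z : 'cV[R]_m) : dot (y + z) x = dot y x + dot z x.
Proof. by rewrite !(dotC _ x) dotDr. Qed.

Lemma dotZl m a (x y : 'cV[R]_m) : dot (a *: y) x = a * dot y x.
Proof. by rewrite !(dotC _ x) dotZr. Qed.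

Lemma dotMr m k (A : 'M[R]_(m, k)) x y : dot x (A *m y) = dot (A^T *m x) y.
Proof. by rewrite !dotE trmx_mul trmxK mulmxA. Qed.

Lemma sqn_sum m (x : 'cV[R]_m) : sqn x = \sum_i x i 0 ^+ 2.
Proof. by apply: eq_bigr => i _; rewrite expr2. Qed.

Lemma sqn_ge0 m (x : 'cV[R]_m) : 0 <= sqn x.
Proof. by rewrite sqn_sum sumr_ge0// => i _; rewrite sqr_ge0. Qed.

Lemma norm2E m (x : 'cV[R]_m) : norm2 x = Num.sqrt (sqn x).
Proof. by rewrite sqn_sum. Qed.

Lemma sqn_eq0 m (x : 'cV[R]_m) : sqn x = 0 -> x = 0.
Proof.
rewrite sqn_sum => /eqP; rewrite psumr_eq0; last by move=> i _; rewrite sqr_ge0.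
move=> /allP x0; apply/colP => i; rewrite mxE; apply/eqP.
by have := x0 i (mem_index_enum _); rewrite sqrf_eq0.
Qed.

(** Lagrange's identity. *)
Lemma cauchy_schwarz (I : finType) (a b : I -> R) :
  (\sum_i a i * b i) ^+ 2 <= (\sum_i a i ^+ 2) * (\sum_i b i ^+ 2).
Proof.
have : 0 <= \sum_i \sum_j (a i * b j - a j * b i) ^+ 2.
  by apply: sumr_ge0 => i _; apply: sumr_ge0 => j _; rewrite sqr_ge0.
have -> : \sum_i \sum_j (a i * b j - a j * b i) ^+ 2 =
  \sum_i \sum_j (a i ^+ 2 * b j ^+ 2) + \sum_i \sum_j (b i ^+ 2 * a j ^+ 2)
  - 2 * \sum_i \sum_j ((a i * b i) * (a j * b j)).
  rewrite mulr_sumr -sumrN -!big_split/=; apply: eq_bigr => i _.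
  rewrite mulr_sumr -sumrN -!big_split/=; apply: eq_bigr => j _.
  ring.
under eq_bigr do rewrite -mulr_sumr.
rewrite -mulr_suml.
under [X in _ + X - _]eq_bigr do rewrite -mulr_sumr.
rewrite -mulr_suml.
under [X in _ - 2 * X]eq_bigr do rewrite -mulr_sumr.
rewrite -mulr_suml expr2; lra.
Qed.

Lemma dot_le m (x y : 'cV[R]_m) : dot x y ^+ 2 <= sqn x * sqn y.
Proof. by rewrite !sqn_sum; exact: cauchy_schwarz. Qed.

Lemma quadD m (A B : 'M[R]_m) x : quad (A + B) x = quad A x + quad B x.
Proof. by rewrite !quadE mulmxDl dotDr. Qed.

Lemma quadZ m a (A : 'M[R]_m) x : quad (a *: A) x = a * quad A x.
Proof. by rewrite !quadE -scalemxAl dotZr. Qed.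

Lemma quadB m (A B : 'M[R]_m) x : quad (A - B) x = quad A x - quad B x.
Proof. by rewrite quadD -scaleN1r quadZ mulN1r. Qed.

Lemma quad_scalar m (a : R) (x : 'cV[R]_m) : quad a%:M x = a * sqn x.
Proof. by rewrite quadE mul_scalar_mx dotZr. Qed.

Lemma quad_sum m (A : 'M[R]_m) x : quad A x = \sum_i \sum_j x i 0 * x j 0 * A i j.
Proof.
rewrite quadE; apply: eq_bigr => i _; rewrite mxE mulr_sumr.
by apply: eq_bigr => j _; rewrite -mulrA [A i j * _]mulrC mulrA.
Qed.

Lemma loewner_quad m (A B : 'M[R]_m) x : loewner_le A B -> quad A x <= quad B x.
Proof. by move=> [_ /(_ x)]; rewrite quadB subr_ge0. Qed.

Lemma posdef_unit m (A : 'M[R]_m) : (forall x, x != 0 -> 0 < quad A x) -> A \in unitmx.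
Proof.
move=> A0; rewrite unitmxE unitfE; apply/negP => /eqP d0.
have /det0P[v v0 vA] : \det A^T == 0 by rewrite det_tr d0.
have vT0 : v^T != 0 by apply: contra v0 => /eqP h; rewrite -[v]trmxK h trmx0.
have := A0 _ vT0; rewrite quadE -[A *m _]trmxK trmx_mul trmxK vA trmx0.
by rewrite /dot big1 ?ltxx// => i _; rewrite !mxE mulr0.
Qed.

Lemma invmx_sym m (A : 'M[R]_m) : A^T = A -> (invmx A)^T = invmx A.
Proof. by move=> AT; rewrite trmx_inv AT. Qed.

(** Completing the square: the form of A^-1 is the convex conjugate of the form
    of A. *)
Lemma quad_dual m (A : 'M[R]_m) x y : A^T = A -> A \in unitmx ->
  (forall z, 0 <= quad A z) -> 2 * dot x y - quad A y <= quad (invmx A) x.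
Proof.
move=> AT Au A0; have := A0 (invmx A *m x - y).
set z := invmx A *m x.
have Az : A *m z = x by rewrite mulmxA mulmxV// mul1mx.
rewrite -scaleN1r quadE mulmxDr -scalemxAr Az dotDl !dotDr dotZr !dotZl dotZr -quadE.
have -> : dot z (A *m y) = dot x y by rewrite dotMr AT Az.
have -> : dot z x = quad (invmx A) x by rewrite quadE dotC.
rewrite (dotC y x); lra.
Qed.

(** Inversion reverses the Loewner order, as conjugation of convex functions
    does: the supremum for B is attained at y = B^-1 x. *)
Lemma quad_inv_le m (A B : 'M[R]_m) x :
  A^T = A -> B^T = B -> A \in unitmx -> B \in unitmx ->
  (forall z, 0 <= quad A z) -> (forall z, quad A z <= quad B z) ->
  quad (invmx B) x <= quad (invmx A) x.
Proof.
move=> AT BT Au Bu A0 AB.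
have := quad_dual x (invmx B *m x) AT Au A0.
apply: le_trans; have := AB (invmx B *m x).
rewrite [quad B _]quadE mulmxA mulmxV// mul1mx [quad (invmx B) _]quadE (dotC _ x).
lra.
Qed.

Lemma quad_le_norm1 m (A : 'M[R]_m) x :
  quad A x <= (\sum_i \sum_j `|A i j|) * sqn x.
Proof.
rewrite quad_sum mulr_suml; apply: ler_sum => i _.
rewrite mulr_suml; apply: ler_sum => j _.
have xle k : x k 0 ^+ 2 <= sqn x.
  by rewrite sqn_sum (bigD1 k)//= lerDl sumr_ge0// => *; rewrite sqr_ge0.
apply: le_trans (ler_norm _) _; rewrite normrM mulrC ler_wpM2l//.
apply: (@le_trans _ _ ((x i 0 ^+ 2 + x j 0 ^+ 2) / 2)); last first.
  by have := xle i; have := xle j; lra.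
rewrite normrM -(real_normK (num_real (x i 0))) -(real_normK (num_real (x j 0))).
have := sqr_ge0 (`|x i 0| - `|x j 0|); nra.
Qed.

Lemma quad_sqr_le m (A : 'M[R]_m) x :
  quad A x ^+ 2 <= (\sum_i \sum_j A i j ^+ 2) * sqn x ^+ 2.
Proof.
have -> : quad A x = \sum_(k : 'I_m * 'I_m) A k.1 k.2 * (x k.1 0 * x k.2 0).
  rewrite quad_sum pair_big/=; apply: eq_bigr => k _; ring.
apply: le_trans (cauchy_schwarz _ _) _.
rewrite pair_big/= le_eqVlt; apply/orP; left; apply/eqP; congr (_ * _).
rewrite expr2 {1}sqn_sum mulr_suml -(pair_big xpredT xpredT (fun i j => (x i 0 * x j 0) ^+ 2))/=.
apply: eq_bigr => i _; rewrite sqn_sum mulr_sumr; apply: eq_bigr => j _; ring.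
Qed.

Lemma sqn_mul_le m k (A : 'M[R]_(m, k)) x :
  sqn (A *m x) <= (\sum_i \sum_j A i j ^+ 2) * sqn x.
Proof.
rewrite sqn_sum mulr_suml; apply: ler_sum => i _.
by rewrite mxE sqn_sum; exact: cauchy_schwarz.
Qed.

Lemma opnorm2_quad m (A : 'M[R]_m) x c :
  opnorm2 A <= c -> 0 <= c -> sqn x = 1 -> quad A x <= c.
Proof.
move=> Ac c0 x1.
have nx : norm2 x <= 1 by rewrite norm2E x1 sqrtr1.
have : norm2 (A *m x) <= c.
  apply: le_trans Ac; apply: ub_le_sup; last by exists x.
  exists (Num.sqrt (\sum_i \sum_j A i j ^+ 2)) => _ [y /= y1 <-].
  rewrite norm2E ler_wsqrtr//.
  apply: le_trans (sqn_mul_le _ _) _.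
  rewrite ler_piMr//.
    by apply: sumr_ge0 => i _; apply: sumr_ge0 => j _; rewrite sqr_ge0.
  move: y1; rewrite norm2E -{1}sqrtr1 ler_psqrt ?nnegrE ?sqn_ge0//.
rewrite norm2E => nAx; have Ax2 : sqn (A *m x) <= c ^+ 2.
  by rewrite -(sqr_sqrtr (sqn_ge0 _)) lerXn2r// nnegrE sqrtr_ge0.
have := dot_le x (A *m x); rewrite -quadE x1 mul1r => q2.
have [//|qc] := leP (quad A x) c.
by have := le_trans q2 Ax2; nra.
Qed.

Lemma sqn_delta m (i : 'I_m) : sqn (delta_mx i 0 : 'cV[R]_m) = 1.
Proof.
rewrite sqn_sum (bigD1 i)//= big1 ?addr0 => [|j ji]; rewrite mxE ?eqxx ?expr1n//.
by rewrite (negPf ji) expr0n.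
Qed.

Lemma quad_delta m (A : 'M[R]_m) i : quad A (delta_mx i 0) = A i i.
Proof.
rewrite quad_sum (bigD1 i)//= (bigD1 i)//= !mxE !eqxx !mul1r !big1 ?addr0//.
  by move=> j ji; apply: big1 => k _; rewrite !mxE (negPf ji) !mul0r.
by move=> j ji; rewrite !mxE (negPf ji) mulr0 mul0r.
Qed.

End Quadratic.

(** * Taylor remainder of a Hoelder function *)

Section Taylor.
Context {R : realType}.

Lemma is_derive1_derivable (g : R -> R) (x : R) :
  derivable g x 1 -> is_derive x 1 g (derive1n 1 g x).
Proof. by move=> dg; apply: DeriveDef => //; rewrite derive1n1 derive1E. Qed.

Definition taylor_poly (l : nat) (g : R -> R) (u0 : R) : {poly R} :=
  \sum_(a < l.+1) (derive1n a g u0 / a`!%:R) *: ('X - u0%:P) ^+ a.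

Lemma taylor_polyE l g u0 u :
  (taylor_poly l g u0).[u] = \sum_(a < l.+1) derive1n a g u0 * (u - u0) ^+ a / a`!%:R.
Proof.
rewrite horner_sum; apply: eq_bigr => a _.
by rewrite hornerZ horner_exp !hornerE mulrAC.
Qed.

Lemma deriv_taylor_poly l g u0 :
  deriv (taylor_poly l.+1 g u0) = taylor_poly l (derive1n 1 g) u0.
Proof.
rewrite /taylor_poly big_ord_recl expr0 derivD derivZ derivC scaler0 add0r.
rewrite (raddf_sum (@deriv R)) /=; apply: eq_bigr => a _.
rewrite derivZ deriv_exp derivXsubC mul1r -scalerMnr scalerMnl [bump _ _]add1n add0n -derive1nS derive1Sn /=.
congr (_ *: _); rewrite factS natrM -mulr_natr; field.
by rewrite nat1r !pnatr_eq0 -lt0n fact_gt0.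
Qed.

(** By induction on l: the derivative of the remainder is the remainder of the
    derivative, and the mean value theorem contributes one factor |u - u0|. *)
Lemma taylor_le (l : nat) (L b u0 : R) (g : R -> R) : 0 <= b -> 0 <= L ->
  (forall j, (j < l)%N -> forall u, derivable (derive1n j g) u 1) ->
  (forall u, `|derive1n l g u - derive1n l g u0| <= L * `|u - u0| `^ b) ->
  forall u, `|g u - (taylor_poly l g u0).[u]| <= L * `|u - u0| `^ b * `|u - u0| ^+ l.
Proof.
move=> b0 L0; elim: l g => [|l IH] g dg Hg u.
  by rewrite taylor_polyE big_ord1 expr0 !mulr1 divr1; exact: Hg.
pose r (x : R) : R := g x - (taylor_poly l.+1 g u0).[x].
pose r' (x : R) : R := derive1n 1 g x - (taylor_poly l (derive1n 1 g) u0).[x].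
have dr (x : R) : is_derive x 1 r (r' x).
  have dgx := is_derive1_derivable (dg 0%N isT x).
  have dp : is_derive x 1 (horner (taylor_poly l.+1 g u0)) (taylor_poly l (derive1n 1 g) u0).[x].
    by rewrite -deriv_taylor_poly; exact: is_derive_poly.
  exact: (is_deriveB dgx dp).
have r'le x : `|r' x| <= L * `|x - u0| `^ b * `|x - u0| ^+ l.
  apply: IH => [j jl v|v].
    by rewrite derive1n1 -derive1Sn; exact: dg.
  by rewrite derive1n1 -!derive1Sn; exact: Hg.
have cr A : {within A, continuous r}.
  apply: continuous_subspaceT => x; have dx := dr x.
  exact/differentiable_continuous/derivable1_diffP/(@ex_derive _ _ _ x 1 r _ dx).
have r0 : r u0 = 0.
  rewrite /r taylor_polyE big_ord_recl big1 ?addr0 => [|a _].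
    by rewrite expr0 mulr1 divr1 subrr.
  by rewrite subrr expr0n /= mulr0 mul0r.
have mono x : `|x - u0| <= `|u - u0| ->
    `|r' x| <= L * `|u - u0| `^ b * `|u - u0| ^+ l.
  move=> xu; apply: le_trans (r'le x) _.
  apply: ler_pM; rewrite ?mulr_ge0 ?powR_ge0 ?exprn_ge0//.
    by rewrite ler_wpM2l// ge0_ler_powR ?nnegrE.
  by rewrite lerXn2r ?nnegrE.
suff [c cu rc] : exists2 c, `|c - u0| <= `|u - u0| & r u = r' c * (u - u0).
  rewrite -/(r u) rc normrM exprSr mulrA ler_wpM2r//; exact: mono.
have [uu|uu] := leP u0 u.
  have [c /[!in_itv]/= /andP[c1 c2] rE] := MVT_segment uu (fun x _ => dr x) (cr _).
  exists c; first by rewrite !ger0_norm ?subr_ge0// lerB.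
  by rewrite -rE r0 subr0.
have [c /[!in_itv]/= /andP[c1 c2] rE] := MVT_segment (ltW uu) (fun x _ => dr x) (cr _).
exists c; first by rewrite !ler0_norm ?subr_le0 ?(ltW uu)// lerN2 lerB.
by rewrite -[u - u0]opprB mulrN -rE r0 sub0r opprK.
Qed.

Lemma hoelder_taylor (beta L u0 : R) (g : R -> R) : 0 < beta -> 0 <= L ->
  hoelder beta L g ->
  forall u, `|g u - (taylor_poly (Num.truncn beta) g u0).[u]| <= L * `|u - u0| `^ beta.
Proof.
move=> b0 L0 [dg Hg] u.
have /andP[lb _] := truncn_itv (ltW b0).
have := @taylor_le _ L (beta - (Num.truncn beta)%:R) u0 g _ L0 dg (fun v => Hg v u0) u.
rewrite subr_ge0 => /(_ lb) /le_trans; apply.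
rewrite -mulrA ler_wpM2l// -powR_mulrn//.
have [->|uu] := eqVneq (u - u0) 0.
  rewrite normr0 [0 `^ beta]powR0 ?gt_eqF//.
  have [l0|l0] := eqVneq (Num.truncn beta) 0%N.
    by rewrite l0 subr0 powR0 ?gt_eqF// mul0r.
  by rewrite [0 `^ (Num.truncn beta)%:R]powR0 ?mulr0// pnatr_eq0.
by rewrite -powRD ?subrK// normr_eq0 uu implybT.
Qed.

End Taylor.

(** * Algebra of the local polynomial estimator *)

Section DVCM.
Context {R : realType} {K p : nat}.
Variables (n : 'I_K.+1 -> nat) (l : nat) (h u0 : R) (u : 'I_K.+1 -> R).
Variable X : forall k, 'M[R]_(n k, p).

Definition near_id (k : 'I_K.+1) : bool := `|u k - u0| <= h.

Definition window_count : R := \sum_k (n k)%:R * (near_id k)%:R.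

Definition wgt (k : 'I_K.+1) : R := (near_id k)%:R / window_count.

(** The matrix H that maps the responses to the estimate. *)
Definition dvcm_mx : 'M[R]_(p, \sum_k n k) :=
  Amx l *m invmx (gram l h u0 u X) *m (Zmx l h u0 u X)^T *m Wmx n h u0 u.

Definition dvcm_blk k : 'M[R]_(p, n k) := submxrow dvcm_mx k.

Hypothesis h0 : 0 < h.

Lemma boxcar_near k : boxcar (scaled_id h u0 u k) = 2^-1 * (near_id k)%:R.
Proof.
rewrite /boxcar /scaled_id /near_id normrM normfV (gtr0_norm h0).
by rewrite ler_pdivrMr// mul1r.
Qed.

Lemma SsumE : Ssum n h u0 u = 2^-1 * window_count.
Proof.
rewrite /Ssum /window_count mulr_sumr; apply: eq_bigr => k _.
by rewrite sumr_const card_ord boxcar_near -[LHS]mulr_natl mulrCA.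
Qed.

Lemma WmxE : Wmx n h u0 u = \mxdiag_(k < K.+1) (wgt k)%:M.
Proof.
apply/eq_mxdiagP => k; congr (_%:M); rewrite SsumE boxcar_near /wgt invfM invrK.
by rewrite mulrACA mulfV ?mul1r 1?mulrC// pnatr_eq0.
Qed.

(** A boxcar weight is 0 or 1/N; this is what makes H H^T explicit. *)
Lemma wgt_sqr k : wgt k * wgt k = window_count^-1 * wgt k.
Proof. by rewrite /wgt; case: (near_id k); rewrite ?mul1r// !mul0r !mulr0. Qed.

Lemma wgt_ge0 k : 0 <= wgt k.
Proof. by rewrite /wgt divr_ge0// sumr_ge0// => i _; rewrite mulr_ge0. Qed.

Lemma WmxT : (Wmx n h u0 u)^T = Wmx n h u0 u.
Proof.
by rewrite WmxE tr_mxdiag; apply/eq_mxdiagP => k; rewrite tr_scalar_mx.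
Qed.

Lemma Wmx_mul (m : nat) (C : forall k, 'M[R]_(n k, m)) :
  Wmx n h u0 u *m \mxcol_k C k = \mxcol_k (wgt k *: C k).
Proof.
rewrite WmxE mul_mxdiag_mxcol; apply: eq_mxcol => k.
by rewrite mul_scalar_mx.
Qed.

Lemma mxcol_scale (m : nat) a (C : forall k, 'M[R]_(n k, m)) :
  \mxcol_k (a *: C k) = a *: \mxcol_k C k.
Proof.
rewrite -mul_mx_scalar mxcol_mul; apply: eq_mxcol => k.
by rewrite mul_mx_scalar.
Qed.

Definition Zrow k : 'M[R]_(n k, \sum_(a < l.+1) p) :=
  \mxrow_(a < l.+1) ((scaled_id h u0 u k ^+ a / a`!%:R) *: X k).

Lemma ZmxE : Zmx l h u0 u X = \mxcol_k Zrow k.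
Proof. exact: mxblockEv. Qed.

Lemma Wmx_sqrZ : Wmx n h u0 u *m (Wmx n h u0 u *m Zmx l h u0 u X) =
  window_count^-1 *: (Wmx n h u0 u *m Zmx l h u0 u X).
Proof.
rewrite ZmxE !Wmx_mul -mxcol_scale; apply: eq_mxcol => k.
by rewrite !scalerA wgt_sqr.
Qed.

Lemma gram_sym : (gram l h u0 u X)^T = gram l h u0 u X.
Proof. by rewrite /gram !trmx_mul trmxK WmxT mulmxA. Qed.

Lemma quad_gram v : quad (gram l h u0 u X) v = \sum_k wgt k * sqn (Zrow k *m v).
Proof.
have -> : gram l h u0 u X = \sum_k wgt k *: ((Zrow k)^T *m Zrow k).
  rewrite /gram -mulmxA ZmxE Wmx_mul tr_mxcol mul_mxrow_mxcol.
  by apply: eq_bigr => k _; rewrite -scalemxAr.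
rewrite quadE mulmx_suml.
rewrite dot_sumr.
apply: eq_bigr => k _; rewrite -scalemxAl dotZr; congr (_ * _).
by rewrite -mulmxA dotMr trmxK.
Qed.

Lemma gram_ge0 v : 0 <= quad (gram l h u0 u X) v.
Proof.
by rewrite quad_gram sumr_ge0// => k _; rewrite mulr_ge0 ?wgt_ge0 ?sqn_ge0.
Qed.

Lemma AmxT : (@Amx R p l)^T = \mxcol_(a < l.+1) ((a == ord0)%:R)%:M.
Proof. by rewrite /Amx tr_mxrow; apply/eq_mxcol => a; rewrite tr_scalar_mx. Qed.

Lemma Amx_mul (m : nat) (C : 'I_l.+1 -> 'M[R]_(p, m)) :
  Amx l *m \mxcol_a C a = C ord0.
Proof.
rewrite /Amx mul_mxrow_mxcol (bigD1 ord0)//= mul1mx big1 ?addr0// => a /negPf ->.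
by rewrite mul_scalar_mx scale0r.
Qed.

Lemma AmxAT : Amx l *m (@Amx R p l)^T = 1%:M.
Proof. by rewrite AmxT Amx_mul eqxx. Qed.

Lemma Zrow_AmxT k : Zrow k *m (@Amx R p l)^T = X k.
Proof.
rewrite AmxT /Zrow mul_mxrow_mxcol (bigD1 ord0)//= big1 ?addr0 => [|a /negPf ->].
  by rewrite expr0 divr1 scale1r mulmx1.
by rewrite mul_mx_scalar scale0r.
Qed.

Lemma dvcm_mxE : dvcm_mx =
  \mxrow_k (wgt k *: (Zrow k *m invmx (gram l h u0 u X) *m (Amx l)^T))^T.
Proof.
rewrite -tr_mxcol -Wmx_mul; apply: trmx_inj; rewrite trmxK /dvcm_mx !trmx_mul trmxK WmxT.
rewrite trmx_inv gram_sym; congr (_ *m _).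
by rewrite mulmxA -mxcol_mul -mxcol_mul ZmxE.
Qed.

Lemma dvcm_blk_far k : near_id k = false -> dvcm_blk k = 0.
Proof.
by move=> nk; rewrite /dvcm_blk dvcm_mxE mxrowK /wgt nk mul0r scale0r trmx0.
Qed.

Lemma dvcm_blkE (m : nat) (C : forall k, 'M[R]_(n k, m)) :
  dvcm_mx *m \mxcol_k C k = \sum_k dvcm_blk k *m C k.
Proof. by rewrite -{1}(submxrowK dvcm_mx) mul_mxrow_mxcol. Qed.

Hypothesis Gu : gram l h u0 u X \in unitmx.

(** H H^T = A G^-1 (Z^T W W Z) G^-1 A^T, and the middle factor is G / N. *)
Lemma dvcm_mxT : dvcm_mx *m dvcm_mx^T =
  window_count^-1 *: (Amx l *m invmx (gram l h u0 u X) *m (Amx l)^T).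
Proof.
have -> : dvcm_mx^T = Wmx n h u0 u *m Zmx l h u0 u X *m (invmx (gram l h u0 u X) *m (Amx l)^T).
  by rewrite /dvcm_mx !trmx_mul trmxK WmxT trmx_inv gram_sym !mulmxA.
rewrite /dvcm_mx -!mulmxA (mulmxA (Wmx n h u0 u) (Zmx _ _ _ _ _)).
rewrite (mulmxA (Wmx n h u0 u) (Wmx n h u0 u *m _)) Wmx_sqrZ.
rewrite -!scalemxAl -!scalemxAr; congr (_ *: _).
rewrite (mulmxA (Zmx _ _ _ _ _)^T) (mulmxA _ (Wmx _ _ _ _)) -/(gram l h u0 u X).
by rewrite (mulmxA (invmx _) (gram _ _ _ _ _)) mulVmx// mul1mx.
Qed.

Lemma dvcm_blk_sqr j lambda0 : 0 < lambda0 -> 0 < window_count ->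
  opnorm2 (Amx l *m invmx (gram l h u0 u X) *m (Amx l)^T) <= lambda0^-1 ->
  \sum_k \sum_i dvcm_blk k j i ^+ 2 <= (window_count * lambda0)^-1.
Proof.
move=> l0 N0 op.
have -> : \sum_k \sum_i dvcm_blk k j i ^+ 2 = (dvcm_mx *m dvcm_mx^T) j j.
  rewrite -[X in X^T](submxrowK dvcm_mx) tr_mxrow dvcm_blkE summxE.
  by apply: eq_bigr => k _; rewrite [RHS]mxE; apply: eq_bigr => i _; rewrite [_^T _ _]mxE expr2.
rewrite dvcm_mxT mxE invfM ler_wpM2l ?invr_ge0 ?(ltW N0)//.
rewrite -quad_delta; apply: (opnorm2_quad op); last exact: sqn_delta.
by rewrite invr_ge0 ltW.
Qed.

(** By [quad_dual] an upper bound on a diagonal block of G^-1 is a lower bound on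
    the same block of G; the block of degree 0 is the weighted Gram matrix of
    the covariates alone. *)
Lemma gram_lower t lambda0 : 0 < lambda0 ->
  opnorm2 (Amx l *m invmx (gram l h u0 u X) *m (Amx l)^T) <= lambda0^-1 ->
  sqn t = 1 -> lambda0 <= \sum_k wgt k * sqn (X k *m t).
Proof.
move=> l0 op t1; set G := gram l h u0 u X in op *.
have GT : G^T = G := gram_sym.
pose x := (Amx l)^T *m t.
have -> : \sum_k wgt k * sqn (X k *m t) = quad G x.
  by rewrite quad_gram; apply: eq_bigr => k _; rewrite mulmxA Zrow_AmxT.
have qS : quad (invmx G) x <= lambda0^-1.
  apply: le_trans (opnorm2_quad op _ t1); last by rewrite invr_ge0 ltW.
  by rewrite !quadE {1}/x -dotMr !mulmxA.
have GVT : (invmx G)^T = invmx G by exact: invmx_sym.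
have GVu : invmx G \in unitmx by rewrite unitmx_inv.
have GV0 z : 0 <= quad (invmx G) z.
  have -> : quad (invmx G) z = quad G (invmx G *m z) by rewrite !quadE mulKVmx// dotC.
  exact: gram_ge0.
have := @quad_dual _ _ (invmx G) x (lambda0 *: x) GVT GVu GV0.
rewrite invmxK dotZr quadE -scalemxAr dotZr dotZl -quadE.
have -> : dot x x = 1 by rewrite /x dotMr trmxK mulmxA AmxAT mul1mx.
apply: le_trans; rewrite mulr1.
have : lambda0 * (lambda0 * quad (invmx G) x) <= lambda0.
  by rewrite -[leRHS]mulr1 ler_pM2l// -(mulfV (lt0r_neq0 l0)) ler_pM2l.
lra.
Qed.

(** Z maps the scaled Taylor coefficients at u0 to the Taylor polynomials at the
    identifiers, and H Z = A recovers the value at u0: only the remainders and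
    the noise are left. *)
Lemma dvcm_err (theta : 'I_p -> R -> R) (e : forall k, 'cV[R]_(n k)) :
  let th v := \col_j theta j v in
  let T v := \col_j (taylor_poly l (theta j) u0).[v] in
  dvcm l h u0 u X (fun k => X k *m th (u k) + e k) - th u0 =
  \sum_k dvcm_blk k *m (X k *m (th (u k) - T (u k)) + e k).
Proof.
move=> th T.
pose b0 := \mxcol_(a < l.+1) (h ^+ a *: \col_(j < p) derive1n a (theta j) u0).
have Ab : Amx l *m b0 = th u0.
  by rewrite /b0 Amx_mul expr0 scale1r; apply/colP => j; rewrite !mxE.
have Zb : Zmx l h u0 u X *m b0 = \mxcol_k (X k *m T (u k)).
  rewrite ZmxE mxcol_mul; apply/eq_mxcol => k; rewrite /Zrow /b0 mul_mxrow_mxcol.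
  transitivity (\sum_(a < l.+1) X k *m
      ((scaled_id h u0 u k ^+ a / a`!%:R * h ^+ a) *: \col_(j < p) derive1n a (theta j) u0)).
    by apply: eq_bigr => a _; rewrite -scalemxAl -!scalemxAr scalerA.
  rewrite -mulmx_sumr; congr (_ *m _); apply/colP => j.
  rewrite summxE [RHS]mxE taylor_polyE; apply: eq_bigr => a _; rewrite !mxE.
  have -> : u k - u0 = scaled_id h u0 u k * h by rewrite /scaled_id mulfVK// gt_eqF.
  by move: (scaled_id _ _ _ _) => s; rewrite exprMn; ring.
have HZ : dvcm_mx *m Zmx l h u0 u X = Amx l.
  rewrite /dvcm_mx -!mulmxA (mulmxA _ (Wmx _ _ _ _)) -/(gram l h u0 u X).
  by rewrite mulVmx// mulmx1.
rewrite /dvcm -/dvcm_mx -Ab -HZ -mulmxA Zb -mulmxBr -mxcolB dvcm_blkE.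
apply: eq_bigr => k _; congr (_ *m _).
by rewrite mulmxBr addrAC.
Qed.

End DVCM.

(** * Order statistics of the distances and the bandwidth *)

Section Order.
Context {R : realType}.

Lemma med3E (a b c : R) : b <= c -> med3 a b c = Num.max b (Num.min a c).
Proof.
move=> bc; rewrite /med3 /sort /=.
case: (leP a b) => [ab|ba]; case: (leP a c) => [ac|ca] //=; rewrite ?bc ?ac ?(leNgt a c) ?ca /=.
- by rewrite max_l.
- by have := lt_le_trans ca (le_trans ab bc); rewrite ltxx.
- by rewrite max_r// ltW.
- by rewrite max_r.
Qed.

Context {K : nat}.
Hypothesis K0 : (0 < K)%N.
Variables (u0 : R) (u : 'I_K.+1 -> R).

Let dist k := `|u (lift ord0 k) - u0|.
Let s := [seq dist k | k <- enum 'I_K].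

Let size_s : size s = K. Proof. by rewrite size_map size_enum_ord. Qed.

Let sorted_s : sorted <=%R (sort <=%R s). Proof. exact: sort_le_sorted. Qed.

Lemma dist_ord_mem j : (0 < j <= K)%N -> exists k : 'I_K, dist_ord u0 u j = dist k.
Proof.
move=> /andP[j0 jK].
have : dist_ord u0 u j \in s.
  rewrite -(mem_sort <=%R) /dist_ord mem_nth// size_sort size_map size_enum_ord.
  by rewrite prednK.
by move=> /mapP[k _ ->]; exists k.
Qed.

Lemma dist_ord_first k : dist_ord u0 u 1 <= dist k.
Proof.
have ks : dist k \in sort <=%R s by rewrite mem_sort map_f// mem_enum.
rewrite -(nth_index 0 ks); apply: (le_sorted_leq_nth 0 sorted_s) => //.
  by rewrite inE size_sort size_s.
by rewrite inE index_mem.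
Qed.

Lemma dist_ord_last k : dist k <= dist_ord u0 u K.
Proof.
have ks : dist k \in sort <=%R s by rewrite mem_sort map_f// mem_enum.
rewrite -(nth_index 0 ks); apply: (le_sorted_leq_nth 0 sorted_s) => //.
- by rewrite inE index_mem.
- by rewrite inE size_sort size_s prednK.
by rewrite -ltnS prednK// -[leqRHS]size_s -(size_sort <=%R) index_mem.
Qed.

Lemma dist_ord_le : dist_ord u0 u 1 <= dist_ord u0 u K.
Proof.
by apply: le_trans (dist_ord_first (Ordinal K0)) (dist_ord_last _).
Qed.

Lemma dist_ord_firstE : dist_ord u0 u 1 = \big[Num.min/dist (Ordinal K0)]_k dist k.
Proof.
apply/le_anti/andP; split.
  by apply/bigmin_geP; split=> *; exact: dist_ord_first.
have [|k ->] := @dist_ord_mem 1; first by rewrite K0.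
exact: bigmin_le.
Qed.

Lemma dist_ord_lastE : dist_ord u0 u K = \big[Num.max/dist (Ordinal K0)]_k dist k.
Proof.
apply/le_anti/andP; split; last first.
  by apply/bigmax_leP; split=> *; exact: dist_ord_last.
have [|k ->] := @dist_ord_mem K; first by rewrite K0 leqnn.
exact: le_bigmax.
Qed.

Variable n : 'I_K.+1 -> nat.
Variables beta e0 gamma : R.
Let hs := e0 * ((ntot n)%:R / gamma) `^ (- (2 * beta + 1)^-1).

Lemma bandwidthE : bandwidth n beta e0 gamma u0 u =
  Num.max (dist_ord u0 u 1) (Num.min hs (dist_ord u0 u K)).
Proof. by apply: med3E; exact: dist_ord_le. Qed.

Lemma bandwidth_ge_first : dist_ord u0 u 1 <= bandwidth n beta e0 gamma u0 u.
Proof. by rewrite bandwidthE le_max lexx. Qed.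

Lemma bandwidth_le_last : bandwidth n beta e0 gamma u0 u <= dist_ord u0 u K.
Proof. by rewrite bandwidthE ge_max dist_ord_le ge_min lexx orbT. Qed.

Lemma bandwidth_le_max : bandwidth n beta e0 gamma u0 u <= Num.max hs (dist_ord u0 u 1).
Proof.
by rewrite bandwidthE ge_max le_max lexx orbT/= le_max ge_min lexx.
Qed.

(** Either the window contains all identifiers, or it is at least as wide as the
    theoretical bandwidth. *)
Lemma bandwidth_dich : dist_ord u0 u K = bandwidth n beta e0 gamma u0 u \/
  (hs <= bandwidth n beta e0 gamma u0 u /\ hs <= dist_ord u0 u K).
Proof.
rewrite bandwidthE; have dK := dist_ord_le.
case: (leP hs (dist_ord u0 u K)) => h.
  by right; rewrite le_max lexx orbT.
by left; rewrite max_r.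
Qed.

End Order.

Section OrderMeasurable.
Context {R : realType} {d : measure_display} {T : measurableType d}.

Lemma measurable_bigmin (I : Type) (s : seq I) (x : T -> R) (f : I -> T -> R) :
  measurable_fun setT x -> (forall i, measurable_fun setT (f i)) ->
  measurable_fun setT (fun w => \big[Num.min/x w]_(i <- s) f i w).
Proof.
move=> mx mf; elim: s => [|i s IH]; first by under eq_fun do rewrite big_nil.
by under eq_fun do rewrite big_cons; exact: measurable_minr.
Qed.

Lemma measurable_bigmax (I : Type) (s : seq I) (x : T -> R) (f : I -> T -> R) :
  measurable_fun setT x -> (forall i, measurable_fun setT (f i)) ->
  measurable_fun setT (fun w => \big[Num.max/x w]_(i <- s) f i w).
Proof.
move=> mx mf; elim: s => [|i s IH]; first by under eq_fun do rewrite big_nil.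
by under eq_fun do rewrite big_cons; exact: measurable_maxr.
Qed.

Variables (K : nat) (u0 : R) (U : 'I_K.+1 -> T -> R).
Hypothesis K0 : (0 < K)%N.
Hypothesis mU : forall k, measurable_fun setT (U k).

Lemma measurable_dist k : measurable_fun setT (fun w => `|U k w - u0|).
Proof.
by apply: measurableT_comp => //; apply: measurable_funB => //; exact: measurable_cst.
Qed.

Lemma measurable_dist_first :
  measurable_fun setT (fun w => dist_ord u0 (fun k => U k w) 1).
Proof.
under eq_fun do rewrite (dist_ord_firstE K0).
by apply: measurable_bigmin => *; exact: measurable_dist.
Qed.

Lemma measurable_dist_last :
  measurable_fun setT (fun w => dist_ord u0 (fun k => U k w) K).
Proof.
under eq_fun do rewrite (dist_ord_lastE K0).
by apply: measurable_bigmax => *; exact: measurable_dist.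
Qed.

Lemma measurable_bandwidth (n : 'I_K.+1 -> nat) beta e0 gamma :
  measurable_fun setT (fun w => bandwidth n beta e0 gamma u0 (fun k => U k w)).
Proof.
under eq_fun do rewrite (bandwidthE K0).
apply: measurable_maxr; first exact: measurable_dist_first.
by apply: measurable_minr; [exact: measurable_cst|exact: measurable_dist_last].
Qed.

End OrderMeasurable.

(** * Measurability of matrix expressions *)

Section MatrixMeasurable.
Context {R : realType} {d : measure_display} {T : measurableType d}.

(** x^-1 = x (x^2)^-1 reduces inversion to a power function on [0, +oo[. *)
Lemma measurable_invr (f : T -> R) :
  measurable_fun setT f -> measurable_fun setT (fun w => (f w)^-1).
Proof.
move=> mf.
have -> : (fun w => (f w)^-1) = (fun w => f w * (f w ^+ 2) `^ (-1)).
  apply/funext => w; rewrite powR_inv1 ?sqr_ge0//.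
  have [->|f0] := eqVneq (f w) 0; first by rewrite invr0 mul0r.
  by rewrite expr2 invfM mulVKf.
apply: measurable_funM => //.
apply: (@measurableT_comp _ _ _ _ _ _ (@powR R ^~ (-1))); first exact: measurable_powR.
exact: measurable_funX.
Qed.

Lemma measurable_le_bool (f g : T -> R) :
  measurable_fun setT f -> measurable_fun setT g ->
  measurable_fun setT (fun w => (f w <= g w)%R%:R : R).
Proof.
move=> mf mg; apply: (@measurableT_comp _ _ _ _ _ _ (fun b : bool => b%:R : R)) => //.
exact: measurable_fun_ler.
Qed.

Definition mxmeas m n (F : T -> 'M[R]_(m, n)) : Prop :=
  forall i j, measurable_fun setT (fun w => F w i j).

Lemma mxmeas_cst m n (A : 'M[R]_(m, n)) : mxmeas (fun=> A).
Proof. by move=> i j; exact: measurable_cst. Qed.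

Lemma mxmeasM m n k (F : T -> 'M[R]_(m, n)) (G : T -> 'M[R]_(n, k)) :
  mxmeas F -> mxmeas G -> mxmeas (fun w => F w *m G w).
Proof.
move=> mF mG i j; under eq_fun do rewrite mxE.
by apply: measurable_sum => a; apply: measurable_funM; [exact: mF|exact: mG].
Qed.

Lemma mxmeasD m n (F G : T -> 'M[R]_(m, n)) :
  mxmeas F -> mxmeas G -> mxmeas (fun w => F w + G w).
Proof.
move=> mF mG i j; under eq_fun do rewrite mxE.
by apply: measurable_funD; [exact: mF|exact: mG].
Qed.

Lemma mxmeasZ m n (a : T -> R) (F : T -> 'M[R]_(m, n)) :
  measurable_fun setT a -> mxmeas F -> mxmeas (fun w => a w *: F w).
Proof.
move=> ma mF i j; under eq_fun do rewrite mxE.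
by apply: measurable_funM => //; exact: mF.
Qed.

Lemma mxmeasT m n (F : T -> 'M[R]_(m, n)) : mxmeas F -> mxmeas (fun w => (F w)^T).
Proof. by move=> mF i j; under eq_fun do rewrite mxE; exact: mF. Qed.

Lemma mxmeas_scalar n (a : T -> R) :
  measurable_fun setT a -> mxmeas (fun w => (a w)%:M : 'M[R]_n).
Proof.
move=> ma i j; under eq_fun do rewrite mxE.
case: (i == j); first by under eq_fun do rewrite mulr1n.
by under eq_fun do rewrite mulr0n; exact: measurable_cst.
Qed.

Lemma measurable_det n (F : T -> 'M[R]_n) :
  mxmeas F -> measurable_fun setT (fun w => \det (F w)).
Proof.
move=> mF; apply: measurable_sum => s; apply: measurable_funM.
  exact: measurable_cst.
by apply: measurable_prod => i _; exact: mF.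
Qed.

Lemma mxmeas_adj n (F : T -> 'M[R]_n) : mxmeas F -> mxmeas (fun w => \adj (F w)).
Proof.
move=> mF i j; under eq_fun do rewrite mxE.
apply: measurable_funM; first exact: measurable_cst.
by apply: measurable_det => a b; under eq_fun do rewrite !mxE; exact: mF.
Qed.

Lemma mxmeas_inv n (F : T -> 'M[R]_n) : mxmeas F -> mxmeas (fun w => invmx (F w)).
Proof.
move=> mF i j.
have -> : (fun w => invmx (F w) i j) = (fun w =>
    if 0 < `|\det (F w)| then (\det (F w))^-1 * \adj (F w) i j else F w i j).
  apply/funext => w; rewrite /invmx unitmxE unitfE normr_gt0.
  by case: ifP => // _; rewrite mxE.
apply: measurable_fun_ifT.
- apply: measurable_fun_ltr; first exact: measurable_cst.
  by apply: measurableT_comp => //; exact: measurable_det.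
- apply: measurable_funM; first exact/measurable_invr/measurable_det.
  exact: mxmeas_adj.
- exact: mF.
Qed.

Lemma mxmeas_block m n (p_ : 'I_m -> nat) (q_ : 'I_n -> nat)
    (B : T -> forall i j, 'M[R]_(p_ i, q_ j)) :
  (forall i j, mxmeas (fun w => B w i j)) ->
  mxmeas (fun w => \mxblock_(i, j) B w i j).
Proof. by move=> mB i j; under eq_fun do rewrite mxE; exact: mB. Qed.

Lemma mxmeas_col m n (p_ : 'I_m -> nat) (B : T -> forall i, 'M[R]_(p_ i, n)) :
  (forall i, mxmeas (fun w => B w i)) ->
  mxmeas (fun w => \mxcol_i B w i).
Proof. by move=> mB i j; under eq_fun do rewrite mxE; exact: mB. Qed.

Lemma mxmeas_diag m (p_ : 'I_m -> nat) (B : T -> forall i, 'M[R]_(p_ i)) :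
  (forall i, mxmeas (fun w => B w i)) ->
  mxmeas (fun w => \mxdiag_i B w i).
Proof.
move=> mB; apply: mxmeas_block => i j a b.
case: (eqVneq i j) => [ij|_]; last first.
  by under eq_fun do rewrite mxE; exact: measurable_cst.
by subst j; under eq_fun do rewrite conform_mx_id; exact: mB.
Qed.

Lemma measurable_quad n (F : T -> 'M[R]_n) (v : T -> 'cV[R]_n) :
  mxmeas F -> mxmeas v -> measurable_fun setT (fun w => quad (F w) (v w)).
Proof.
move=> mF mv; apply: mxmeasM => //; apply: mxmeasM => //; exact: mxmeasT.
Qed.

Section Dvcm.
Variables (K p : nat) (n : 'I_K.+1 -> nat) (l : nat) (u0 : R).
Variables (h : T -> R) (U : 'I_K.+1 -> T -> R) (X : T -> forall k, 'M[R]_(n k, p)).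
Hypothesis mh : measurable_fun setT h.
Hypothesis mU : forall k, measurable_fun setT (U k).
Hypothesis mX : forall k, mxmeas (fun w => X w k).

Let u w k := U k w.

Lemma measurable_scaled k : measurable_fun setT (fun w => scaled_id (h w) u0 (u w) k).
Proof.
apply: measurable_funM; last exact: measurable_invr.
by apply: measurable_funB; [exact: mU|exact: measurable_cst].
Qed.

Lemma measurable_boxcar k :
  measurable_fun setT (fun w => boxcar (scaled_id (h w) u0 (u w) k)).
Proof.
apply: measurable_funM; first exact: measurable_cst.
apply: measurable_le_bool; last exact: measurable_cst.
by apply: measurableT_comp => //; exact: measurable_scaled.
Qed.

Lemma measurable_Ssum : measurable_fun setT (fun w => Ssum n (h w) u0 (u w)).
Proof.
by apply: measurable_sum => k; apply: measurable_sum => i; exact: measurable_boxcar.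
Qed.

Lemma mxmeas_Wmx : mxmeas (fun w => Wmx n (h w) u0 (u w)).
Proof.
apply: mxmeas_diag => k; apply: mxmeas_scalar; apply: measurable_funM.
  exact/measurable_invr/measurable_Ssum.
exact: measurable_boxcar.
Qed.

Lemma mxmeas_Zmx : mxmeas (fun w => Zmx l (h w) u0 (u w) (X w)).
Proof.
apply: (@mxmeas_block _ _ _ _ (fun w (k : 'I_K.+1) (a : 'I_l.+1) =>
  (scaled_id (h w) u0 (u w) k ^+ a / a`!%:R) *: X w k)) => k a.
apply: mxmeasZ; last exact: mX.
apply: measurable_funM; last exact: measurable_cst.
by apply: measurable_funX; exact: measurable_scaled.
Qed.

Lemma mxmeas_gram : mxmeas (fun w => gram l (h w) u0 (u w) (X w)).
Proof.
apply: mxmeasM; last exact: mxmeas_Zmx.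
by apply: mxmeasM; [exact/mxmeasT/mxmeas_Zmx|exact: mxmeas_Wmx].
Qed.

Lemma mxmeas_dvcm_mx : mxmeas (fun w => dvcm_mx l (h w) u0 (u w) (X w)).
Proof.
apply: mxmeasM; last exact: mxmeas_Wmx.
apply: mxmeasM; last exact/mxmeasT/mxmeas_Zmx.
apply: mxmeasM; first exact: mxmeas_cst.
exact/mxmeas_inv/mxmeas_gram.
Qed.

Lemma mxmeas_dvcm_blk k : mxmeas (fun w => dvcm_blk l (h w) u0 (u w) (X w) k).
Proof. by move=> i j; under eq_fun do rewrite mxE; exact: mxmeas_dvcm_mx. Qed.

Lemma mxmeas_dvcm (y : T -> forall k, 'cV[R]_(n k)) :
  (forall k, mxmeas (fun w => y w k)) ->
  mxmeas (fun w => dvcm l (h w) u0 (u w) (X w) (y w)).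
Proof.
by move=> my; apply: mxmeasM; [exact: mxmeas_dvcm_mx|exact: mxmeas_col].
Qed.

End Dvcm.
End MatrixMeasurable.

(** * Identifiers near the target *)

Section Scaling.
Context {R : realType}.
Local Notation lambda := (@lebesgue_measure R).

Lemma measurable_affine (a g : R) : measurable_fun setT (fun x : R => (x - a) / g).
Proof.
apply: measurable_funM; last exact: measurable_cst.
by apply: measurable_funB; [exact: measurable_id|exact: measurable_cst].
Qed.

Lemma lebesgue_affine (a g : R) (A : set R) : 0 < g -> measurable A ->
  lambda ((fun x => (x - a) / g) @^-1` A) = (g%:E * lambda A)%E.
Proof.
pose psi (x : R) := (x - a) / g.
move=> g0 mA; have gi0 : 0 <= g^-1 by rewrite invr_ge0 ltW.
have mT : @measurable_fun _ _ (measurableTypeR R) (measurableTypeR R) setT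
  (fun x : R => (x - a) / g) := @measurable_affine a g.
pose m0 : {measure set (measurableTypeR R) -> \bar R} :=
  measure_function_pushforward__canonical__measure_function_Measure lambda mT.
pose mu : {measure set (measurableTypeR R) -> \bar R} := mscale (NngNum gi0) m0.
have -> : lambda A = mu A.
  apply: lebesgue_measure_unique => // _ [[x y] /= xy <-].
  change (lambda `]x, y] = (g^-1)%:E * lambda (psi @^-1` `]x, y]%classic))%E.
  have -> : psi @^-1` `]x, y] = `](x * g + a), (y * g + a)]%classic.
    apply/seteqP; split=> z /=; rewrite !in_itv/= ltr_pdivlMr// ler_pdivrMr//.
      by rewrite ltrBrDr lerBlDr.
    by rewrite ltrBrDr lerBlDr.
  rewrite !lebesgue_measure_itv/= !lte_fin ltrD2r ltr_pM2r//.
  case: ifP => _; last by rewrite mule0.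
  by rewrite -!EFinB -EFinM; congr EFin; field; rewrite gt_eqF.
change (lambda (psi @^-1` A) = g%:E * ((g^-1)%:E * lambda (psi @^-1` A)))%E.
by rewrite muleA -EFinM divff ?gt_eqF// mul1e.
Qed.

End Scaling.

Section Identifiers.
Context {R : realType} {K : nat}.
Context {d : measure_display} {Omega : measurableType d}.
Variables (P : probability Omega R) (U : 'I_K.+1 -> Omega -> R).
Variables (u0 gamma ustar : R) (f : R -> R) (B : set R) (a0' a0 : R).
Hypothesis mU : forall k, measurable_fun setT (U k).
Hypothesis gamma0 : 0 < gamma.
Hypothesis a0'0 : 0 < a0'.
Hypothesis Hf : base_density f B a0' a0.
Hypothesis HU : identifiers P U u0 gamma ustar f.
Local Notation lambda := (@lebesgue_measure R).

Definition id_support : set R := (fun x => (x - ustar) / gamma) @^-1` B.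

Let mf : measurable_fun setT f. Proof. by case: Hf. Qed.

Let mB : measurable B. Proof. by case: Hf => cB _ _ _; exact: compact_measurable. Qed.

Lemma measurable_id_support : measurable id_support.
Proof. by rewrite -[id_support]setTI; exact: measurable_affine. Qed.

Let dens x := gamma^-1 * f ((x - ustar) / gamma).

Let mdens : measurable_fun setT dens.
Proof.
apply: measurable_funM; first exact: measurable_cst.
by apply: measurableT_comp => //; exact: measurable_affine.
Qed.

Let dens_ge0 x : 0 <= dens x.
Proof.
rewrite mulr_ge0 ?invr_ge0 ?(ltW gamma0)//.
case: Hf => _ _ f0 fB; have [Bx|/f0 ->//] := pselect (B ((x - ustar) / gamma)).
by have /andP[h _] := fB _ Bx; exact: le_trans (ltW a0'0) h.
Qed.

Lemma prob_id (k : 'I_K) A : measurable A ->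
  P (U (lift ord0 k) @^-1` A) = (\int[lambda]_(x in A) (dens x)%:E)%E.
Proof. by case: HU => _ _; exact. Qed.

Lemma prob_id_pt (k : 'I_K) x : P (U (lift ord0 k) @^-1` [set x]) = 0.
Proof. by rewrite prob_id// integral_set1. Qed.

Lemma prob_id_supp (k : 'I_K) : P (U (lift ord0 k) @^-1` (~` id_support)) = 0.
Proof.
rewrite prob_id; last by apply: measurableC; exact: measurable_id_support.
apply: integral0_eq => x /= nx; rewrite /dens; case: Hf => _ _ -> //.
by rewrite mulr0.
Qed.

Lemma prob_id_lower (k : 'I_K) A : measurable A ->
  ((gamma^-1 * a0')%:E * lambda (A `&` id_support) <= P (U (lift ord0 k) @^-1` A))%E.
Proof.
move=> mA; have mAS : measurable (A `&` id_support) by apply: measurableI => //; exact: measurable_id_support.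
have mdE D : measurable_fun D (fun x => (dens x)%:E).
  by apply: measurable_funTS; apply: (measurable_EFinP setT dens).2.
rewrite prob_id//; apply: (@le_trans _ _ (\int[lambda]_(x in A `&` id_support) (dens x)%:E)%E); last first.
  apply: (@ge0_subset_integral _ _ R lambda _ _ mAS mA (fun x => (dens x)%:E) (mdE A)).
  - by move=> x _; rewrite lee_fin.
  - exact: subIsetl.
have mu0 : 0 <= gamma^-1 * a0' by rewrite mulr_ge0 ?invr_ge0 ?ltW.
rewrite -(@integral_cst _ _ _ lambda _ mAS (gamma^-1 * a0')%:E).
apply: (@ge0_le_integral _ _ R lambda _ mAS (cst (gamma^-1 * a0')%:E) (fun x => (dens x)%:E)) => //.
- exact: mdE.
- by move=> x [_ Sx]; rewrite lee_fin ler_wpM2l ?invr_ge0 ?(ltW gamma0)//;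
    case: Hf => _ _ _ /(_ _ Sx)/andP[].
Qed.

End Identifiers.

Section Near.
Context {R : realType} {K : nat}.
Context {d : measure_display} {Omega : measurableType d}.
Variables (P : probability Omega R) (U : 'I_K.+1 -> Omega -> R).
Variables (u0 gamma ustar : R) (f : R -> R) (B : set R) (a0' a0 : R).
Hypothesis K0 : (0 < K)%N.
Hypothesis mU : forall k, measurable_fun setT (U k).
Hypothesis gamma0 : 0 < gamma.
Hypothesis a0'0 : 0 < a0'.
Hypothesis Hf : base_density f B a0' a0.
Hypothesis HU : identifiers P U u0 gamma ustar f.
Variables (c Db bu : R).
Hypothesis c0 : 0 < c.
Hypothesis Hc : forall b t, B b -> 0 < t <= 1 ->
  ((c * t)%:E <= lebesgue_measure (B `&` `[(b - t)%R, (b + t)%R]))%E.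
Hypothesis Db1 : 1 <= Db.
Hypothesis HDb : forall b b', B b -> B b' -> `|b - b'| <= Db.
Hypothesis Bbu : B bu.
Hypothesis u0E : u0 = ustar + gamma * bu.

Definition near_event (k : 'I_K) (s : R) : set Omega :=
  [set w | `|U (lift ord0 k) w - u0| <= s].

(** An identifier falls within gamma t of u0 with probability at least kap t.  The
    division by Db, a bound on the diameter of B, extends the lower bound
    a0' c t from t <= 1 to t <= Db. *)
Definition kap : R := a0' * c / Db.

Let Db0 : 0 < Db. Proof. exact: lt_le_trans ltr01 Db1. Qed.

Lemma kap_gt0 : 0 < kap.
Proof. by rewrite /kap divr_gt0// mulr_gt0. Qed.

Lemma near_eventE k s : near_event k s = U (lift ord0 k) @^-1` `[u0 - s, u0 + s]%classic.
Proof.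
by apply/seteqP; split=> w; rewrite /near_event /= in_itv/= ler_distl.
Qed.

Lemma measurable_near_event k s : measurable (near_event k s).
Proof. by rewrite near_eventE -[X in measurable X]setTI; exact: mU. Qed.

Lemma near_event_lower k t : 0 < t <= Db -> kap * t <= fine (P (near_event k (gamma * t))).
Proof.
move=> /andP[t0 tD].
have small s : 0 < s <= 1 -> a0' * c * s <= fine (P (near_event k (gamma * s))).
  move=> s01; rewrite -lee_fin fineK; last by apply: fin_num_measure; exact: measurable_near_event.
  rewrite near_eventE; apply: le_trans (prob_id_lower gamma0 a0'0 Hf HU k _) => //.
  have -> : `[(u0 - gamma * s), (u0 + gamma * s)]%classic `&` id_support gamma ustar B =
      (fun x => (x - ustar) / gamma) @^-1` (B `&` `[bu - s, bu + s]%classic).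
    rewrite setIC /id_support preimage_setI; congr (_ `&` _); apply/seteqP; split=> x /=;
      rewrite !in_itv/= ler_pdivlMr// ler_pdivrMr// u0E => /andP[? ?]; apply/andP; lra.
  rewrite lebesgue_affine//; last first.
    by apply: measurableI => //; case: Hf => cB _ _ _; exact: compact_measurable.
  have gg : gamma^-1 * a0' * gamma = a0' by field; rewrite gt_eqF.
  rewrite muleA -EFinM gg -mulrA EFinM.
  by rewrite lee_pmul2l ?lte_fin//; exact: Hc.
have [t1|t1] := leP t 1.
  apply: le_trans (small t _); last by rewrite t0.
  rewrite ler_wpM2r ?(ltW t0)// /kap ler_pdivrMr// ler_peMr// mulr_ge0 ?ltW//.
apply: (@le_trans _ _ (fine (P (near_event k (gamma * 1))))).
  apply: le_trans (small 1 _); last by rewrite ltr01 lexx.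
  by rewrite mulr1 /kap mulrAC ler_pdivrMr// ler_pM2l// mulr_gt0.
rewrite fine_le ?fin_num_measure//; try exact: measurable_near_event.
apply: le_measure; [exact/mem_set/measurable_near_event|exact/mem_set/measurable_near_event|].
by move=> w /=; rewrite /near_event/= => /le_trans; apply; rewrite ler_pM2l// ltW.
Qed.

Lemma near_supp_ae : {ae P, forall w, forall k, id_support gamma ustar B (U (lift ord0 k) w)}.
Proof.
apply: filter_forall => k; exists (U (lift ord0 k) @^-1` (~` id_support gamma ustar B)); split => //.
- rewrite -[X in measurable X]setTI; apply: mU => //; apply: measurableC.
  exact: (measurable_id_support _ _ Hf).
- exact: (prob_id_supp Hf HU).
Qed.

Lemma dist_le_ae : {ae P, forall w, forall k, `|U (lift ord0 k) w - u0| <= gamma * Db}.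
Proof.
apply: filterS near_supp_ae => w Sw k; have := HDb (Sw k) Bbu.
set x := U _ w; move=> h.
have -> : x - u0 = gamma * ((x - ustar) / gamma - bu).
  by rewrite u0E; field; rewrite gt_eqF.
by rewrite normrM (gtr0_norm gamma0) ler_pM2l.
Qed.

Lemma dist_gt0_ae : {ae P, forall w, forall k, 0 < `|U (lift ord0 k) w - u0|}.
Proof.
apply: filter_forall => k; exists (U (lift ord0 k) @^-1` [set u0]); split.
- by rewrite -[X in measurable X]setTI; exact: mU.
- exact: (prob_id_pt HU).
- move=> w /= /negP; rewrite normr_gt0 subr_eq0 negbK => /eqP; exact.
Qed.

Let Fid (k : 'I_K) : set (set Omega) := sigma_gen (fun _ : unit => U (lift ord0 k)).

Let Fid_pre k A : measurable A -> Fid k (U (lift ord0 k) @^-1` A).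
Proof. by move=> mA; apply: sub_sigma_algebra; exists tt, A. Qed.

Let FidM k : Fid k `<=` measurable.
Proof.
move=> D; apply: gen_measurable => _ [_ [A [mA ->]]].
by rewrite -[X in measurable X]setTI; exact: mU.
Qed.

(** Independence and 1 - x <= exp(-x). *)
Lemma far_prob t : 0 <= t -> t <= Db ->
  fine (P [set w | forall k : 'I_K, gamma * t < `|U (lift ord0 k) w - u0|])
    <= expR (- (kap * K%:R * t)).
Proof.
move=> t0 tD.
have -> : [set w | forall k : 'I_K, gamma * t < `|U (lift ord0 k) w - u0|] =
    \bigcap_(k in [set: 'I_K]) ~` near_event k (gamma * t).
  apply/seteqP; split=> w.
    by move=> h k _ /=; rewrite /near_event/= leNgt h.
  by move=> h k; have /= := h k I; rewrite /near_event/= => /negP; rewrite -ltNge.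
case: HU => _ ind _; rewrite ind => [|k]; last first.
  rewrite near_eventE preimage_setC; apply: Fid_pre; exact: measurableC.
rewrite /=.
have -> : expR (- (kap * K%:R * t)) = \prod_(k < K) expR (- (kap * t)).
  by rewrite prodr_const card_ord -expRM_natl; congr expR; ring.
apply: ler_prod => k _; rewrite fine_ge0//=.
have mN := measurable_near_event k (gamma * t).
rewrite probability_setC// fineB ?fin_num_measure//=.
apply: le_trans (expR_ge1Dx _); rewrite lerD2l lerN2.
have [->|tn0] := eqVneq t 0; first by rewrite !mulr0 fine_ge0.
by apply: near_event_lower; rewrite lt_neqAle eq_sym tn0 t0.
Qed.

Lemma near_event_pair k k' s : k != k' ->
  P (near_event k s `&` near_event k' s) = (P (near_event k s) * P (near_event k' s))%E.
Proof.
move=> kk; case: HU => _ ind _; apply: (indep_pair ind _ FidM kk).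
- by move=> j; rewrite -(preimage_setT (U (lift ord0 j))); exact: Fid_pre.
- by rewrite near_eventE; exact: Fid_pre.
- by rewrite near_eventE; exact: Fid_pre.
Qed.

Lemma near_event_prob_eq k k' s : P (near_event k s) = P (near_event k' s).
Proof. by case: HU => _ _ H; rewrite !near_eventE !H. Qed.

Lemma near_all_prob t : 0 < t <= Db ->
  0 < fine (P (\bigcap_(k in [set: 'I_K]) near_event k (gamma * t))).
Proof.
move=> tD; case: HU => _ ind _; rewrite ind => [|k]; last first.
  by rewrite near_eventE; exact: Fid_pre.
rewrite /= prodr_gt0// => k _; apply: lt_le_trans (near_event_lower k tD).
by rewrite mulr_gt0 ?kap_gt0//; case/andP: tD.
Qed.

End Near.

(** * Nearest distance and number of neighbours *)

Section Series.
Context {R : realType}.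

Lemma sum_inv_sqr_le (M : nat) : \sum_(m < M) (m.+1%:R ^+ 2)^-1 <= 2 :> R.
Proof.
case: M => [|M]; first by rewrite big_ord0.
suff : \sum_(m < M.+1) (m.+1%:R ^+ 2)^-1 <= 2 - M.+1%:R^-1 :> R.
  by move/le_trans; apply; rewrite gerBl invr_ge0.
elim: M => [|M IH]; first by rewrite big_ord1 expr1n invr1; lra.
rewrite big_ord_recr/=.
have a0 : 0 < M.+1%:R :> R by rewrite ltr0n.
have -> : M.+2%:R = M.+1%:R + 1 :> R by rewrite -natr1.
set a := M.+1%:R in a0 IH *.
have : ((a + 1) ^+ 2)^-1 <= a^-1 - (a + 1)^-1.
  have -> : a^-1 - (a + 1)^-1 = (a * (a + 1))^-1 by field; rewrite !gt_eqF//; lra.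
  by rewrite lef_pV2 ?posrE//; nra.
by move=> h; apply: le_trans (lerD IH h) _; rewrite addrA subrK.
Qed.

(** The term of degree truncn b + 3 of the exponential series bounds
    (m + 1)^(b + 2) exp(-kap (m + 1)) uniformly in m. *)
Definition poly_exp_const (kap b : R) : R :=
  (Num.truncn b).+3`!%:R / kap ^+ (Num.truncn b).+3.

Definition dist_const (kap b : R) : R := 2 * expR (kap * 2) * poly_exp_const kap b.

Lemma poly_exp_le (kap b : R) (m : nat) : 0 < kap -> 0 <= b ->
  m.+1%:R `^ b * expR (- (kap * m.+1%:R)) <= poly_exp_const kap b * (m.+1%:R ^+ 2)^-1.
Proof.
move=> k0 b0; rewrite /poly_exp_const; set r := (Num.truncn b).+3.
have m0 : 0 < m.+1%:R :> R by rewrite ltr0n.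
have br : b <= (Num.truncn b).+1%:R by have /andP[_ /ltW] := truncn_itv b0.
have e1 : (kap * m.+1%:R) ^+ r / r`!%:R <= expR (kap * m.+1%:R).
  apply: le_trans (expR_ge1Dxn (Num.truncn b).+2 _); last by rewrite mulr_ge0 ?ltW.
  by rewrite lerDr.
have p1 : m.+1%:R `^ b <= m.+1%:R ^+ (Num.truncn b).+1.
  by rewrite -(powR_mulrn _ (ltW m0)); apply: (ler_powR _ br); rewrite ler1n.
rewrite expRN; rewrite ler_pdivrMr ?expR_gt0//.
apply: le_trans p1 _.
apply: (@le_trans _ _ (r`!%:R / kap ^+ r * (m.+1%:R ^+ 2)^-1 * ((kap * m.+1%:R) ^+ r / r`!%:R))).
  rewrite le_eqVlt; apply/orP; left; apply/eqP.
  have er : m.+1%:R ^+ r = m.+1%:R ^+ (Num.truncn b).+1 * m.+1%:R ^+ 2 :> R.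
    by rewrite -exprD addn2.
  rewrite exprMn er; have kr : kap ^+ r != 0 by rewrite expf_neq0// gt_eqF.
  have fr : r`!%:R != 0 :> R by rewrite pnatr_eq0 -lt0n fact_gt0.
  by field; rewrite fr kr nat1r pnatr_eq0.
by rewrite ler_wpM2l// mulr_ge0 ?divr_ge0 ?invr_ge0 ?exprn_ge0 ?ltW.
Qed.

End Series.

Section Moments.
Context {R : realType} {K : nat}.
Context {d : measure_display} {Omega : measurableType d}.
Variables (P : probability Omega R) (U : 'I_K.+1 -> Omega -> R).
Variables (u0 gamma kap Db : R).
Hypothesis K0 : (0 < K)%N.
Hypothesis mU : forall k, measurable_fun setT (U k).
Hypothesis gamma0 : 0 < gamma.
Hypothesis kap0 : 0 < kap.
Hypothesis Db1 : 1 <= Db.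
Hypothesis near_lower : forall k t, 0 < t <= Db ->
  kap * t <= fine (P (near_event U u0 k (gamma * t))).
Hypothesis far_le : forall t, 0 <= t -> t <= Db ->
  fine (P [set w | forall k : 'I_K, gamma * t < `|U (lift ord0 k) w - u0|])
    <= expR (- (kap * K%:R * t)).
Hypothesis near_pair : forall k k' s, k != k' ->
  P (near_event U u0 k s `&` near_event U u0 k' s) = (P (near_event U u0 k s) * P (near_event U u0 k' s))%E.
Hypothesis near_eq : forall k k' s, P (near_event U u0 k s) = P (near_event U u0 k' s).
Hypothesis dist_le : {ae P, forall w, forall k : 'I_K, `|U (lift ord0 k) w - u0| <= gamma * Db}.
Let E := expect P.

Let d1 w := dist_ord u0 (fun k => U k w) 1.

Let K0R : 0 < K%:R :> R. Proof. by rewrite ltr0n. Qed.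

(** In units of gamma / K the nearest distance has an exponential tail,
    uniformly in K and gamma.  The factor exp(2 kap) pays for the shift from m - 1
    to m + 1: one unit turns the weak inequality into a strict one, the other
    one prepares the sum in [first_moment]. *)
Lemma first_ge_prob (m : nat) : m%:R <= K%:R * Db ->
  E (fun w => (m%:R <= d1 w * (K%:R / gamma))%R%:R) <= expR (kap * 2) * expR (- (kap * m.+1%:R)).
Proof.
move=> mD.
have md : measurable_fun setT d1 by apply: measurable_dist_first.
have mb : measurable_fun setT (fun w => (m%:R <= d1 w * (K%:R / gamma))%R).
  by apply: measurable_fun_ler; [exact: measurable_cst|apply: measurable_funM => //; exact: measurable_cst].
have Ib (g : Omega -> bool) : measurable_fun setT g -> intg P (fun w => (g w)%:R).
  move=> mg; apply: (@intg_bnd _ _ _ P _ 1).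
    exact: (@measurableT_comp _ _ _ _ _ _ (fun b : bool => b%:R : R)).
  by move=> w; case: (g w); rewrite ?normr1 ?normr0.
case: m mD mb => [|m] mD mb.
  rewrite -expRD -[X in _ <= expR X]/(kap * 2 - kap * 1%:R).
  apply: (@le_trans _ _ 1).
    rewrite -[leRHS](expect_cst P); apply: expect_le; first exact: Ib.
      exact: intg_cst.
    by move=> w; rewrite lern1 leq_b1.
  apply: le_trans (expR_ge1Dx _); have := kap0; lra.
pose F := [set w | forall k : 'I_K, gamma * (m%:R / K%:R) < `|U (lift ord0 k) w - u0|].
have mF : measurable F.
  have -> : F = \bigcap_(k in [set: 'I_K]) ~` near_event U u0 k (gamma * (m%:R / K%:R)).
    apply/seteqP; split=> w.
      by move=> h k _ /=; rewrite /near_event/= leNgt h.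
    by move=> h k; have /= := h k I; rewrite /near_event/= => /negP; rewrite -ltNge.
  apply: fin_bigcap_measurable => // k _; apply: measurableC; exact: measurable_near_event.
apply: (@le_trans _ _ (expect P \1_F)).
  apply: expect_le; [exact: Ib|exact: integrable_indic|] => w.
  case: (leP m.+1%:R (d1 w * (K%:R / gamma))) => [mx|_]; last by rewrite ler0n.
  rewrite indicE mem_set// => k; apply: (lt_le_trans _ (dist_ord_first K0 u0 (fun k => U k w) k)).
  have : m%:R < d1 w * (K%:R / gamma) by apply: (lt_le_trans _ mx); rewrite ltr_nat.
  have gK : 0 < gamma / K%:R by rewrite divr_gt0.
  rewrite -(ltr_pM2r gK) -/(d1 w) => h; move: h.
  have -> : d1 w * (K%:R / gamma) * (gamma / K%:R) = d1 w by field; rewrite !gt_eqF.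
  by rewrite mulrCA.
rewrite expect_indic//.
apply: le_trans (@far_le (m%:R / K%:R) _ _) _.
- by rewrite divr_ge0.
- by rewrite ler_pdivrMr// mulrC; apply: (le_trans _ mD); rewrite ler_nat.
rewrite -expRD ler_expR.
have -> : kap * K%:R * (m%:R / K%:R) = kap * m%:R by field; rewrite gt_eqF.
rewrite -![_.+1%:R]natr1; lra.
Qed.

Let d1_ge0 w : 0 <= d1 w.
Proof. by rewrite /d1; have [|k ->] := @dist_ord_mem _ _ u0 (fun k => U k w) 1; rewrite ?K0. Qed.

Let md1 : measurable_fun setT d1. Proof. by apply: measurable_dist_first. Qed.

Let d1_le : {ae P, forall w, d1 w <= gamma * Db}.
Proof.
apply: filterS dist_le => w H.
exact: le_trans (dist_ord_first K0 u0 (fun k => U k w) (Ordinal K0)) (H _).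
Qed.

Let Ibool (g : Omega -> bool) : measurable_fun setT g -> intg P (fun w => (g w)%:R).
Proof.
move=> mg; apply: (@intg_bnd _ _ _ P _ 1).
  exact: (@measurableT_comp _ _ _ _ _ _ (fun b : bool => b%:R : R)).
by move=> w; case: (g w); rewrite ?normr1 ?normr0.
Qed.

Lemma intg_first (b : R) : 0 < b -> intg P (fun w => d1 w `^ b).
Proof.
move=> b0; apply: (@intg_ae_bnd _ _ _ _ _ ((gamma * Db) `^ b)).
  exact: (measurableT_comp (measurable_powR b) md1).
apply: filterS d1_le => w dw; rewrite ger0_norm ?powR_ge0//.
by rewrite ge0_ler_powR ?nnegrE ?(ltW b0)// mulr_ge0 ?ltW// (lt_le_trans _ Db1).
Qed.

(** Sum over the unit layers of x = d1 K / gamma: on m <= x < m + 1, x^b is at most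
    (m + 1)^b, and [first_ge_prob] bounds the probability of the layer. *)
Lemma first_moment (b : R) : 0 < b ->
  E (fun w => d1 w `^ b) <= dist_const kap b * (gamma / K%:R) `^ b.
Proof.
move=> b0; have Db0 : 0 < Db by exact: lt_le_trans ltr01 Db1.
pose M := (Num.truncn (K%:R * Db)).+1.
pose x w := d1 w * (K%:R / gamma).
have x0 w : 0 <= x w by rewrite mulr_ge0// divr_ge0// ltW.
have mx : measurable_fun setT x by apply: measurable_funM => //; exact: measurable_cst.
have gK : 0 < gamma / K%:R by rewrite divr_gt0.
have dx w : d1 w = x w * (gamma / K%:R) by rewrite /x; field; rewrite !gt_eqF.
have mlt (m : 'I_M) : m%:R <= K%:R * Db.
  have /andP[h _] := truncn_itv (ltW (mulr_gt0 K0R Db0)).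
  by apply: le_trans h; rewrite ler_nat -ltnS.
have mbm (m : nat) : measurable_fun setT (fun w => (m%:R <= x w)%R).
  by apply: measurable_fun_ler => //; exact: measurable_cst.
have Im (m : nat) : intg P (fun w => m.+1%:R `^ b * (m%:R <= x w)%R%:R).
  by apply: intgZ; exact: Ibool.
have dom : {ae P, forall w, d1 w `^ b <=
    (gamma / K%:R) `^ b * \sum_(m < M) m.+1%:R `^ b * (m%:R <= x w)%R%:R}.
  apply: filterS d1_le => w dw.
  rewrite dx powRM ?(ltW gK)// mulrC ler_wpM2l ?powR_ge0//.
  have xK : x w <= K%:R * Db.
    rewrite /x mulrA ler_pdivrMr// [d1 w * _]mulrC -mulrA ler_pM2l//.
    by rewrite [Db * _]mulrC.
  have /andP[m1 m2] := truncn_itv (x0 w).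
  have mM : (Num.truncn (x w) < M)%N by rewrite ltnS le_truncn.
  rewrite (bigD1 (Ordinal mM))//= m1 mulr1 -[leLHS]addr0; apply: lerD.
    by rewrite ge0_ler_powR ?nnegrE ?(ltW b0)// ltW.
  by apply: sumr_ge0 => i _; rewrite mulr_ge0 ?powR_ge0.
apply: (@le_trans _ _ (E (fun w => (gamma / K%:R) `^ b * \sum_(m < M) m.+1%:R `^ b * (m%:R <= x w)%R%:R))).
  apply: expect_ae_le => //; first exact: intg_first.
  by apply: intgZ; apply: intg_sum => m _; exact: Im.
rewrite /E expectZ; last by apply: intg_sum => m _; exact: Im.
rewrite mulrC ler_wpM2r ?powR_ge0//.
rewrite expect_sum; last by move=> m _; exact: Im.
apply: (@le_trans _ _ (\sum_(m < M) expR (kap * 2) * poly_exp_const kap b * (m.+1%:R ^+ 2)^-1)).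
  apply: ler_sum => m _; rewrite expectZ; last exact: Ibool.
  apply: (@le_trans _ _ (m.+1%:R `^ b * (expR (kap * 2) * expR (- (kap * m.+1%:R))))).
    by rewrite ler_wpM2l ?powR_ge0//; exact: first_ge_prob.
  rewrite mulrCA -mulrA ler_wpM2l ?expR_ge0//; exact: poly_exp_le (ltW b0).
rewrite -mulr_sumr.
have -> : dist_const kap b = expR (kap * 2) * poly_exp_const kap b * 2 by rewrite /dist_const; ring.
rewrite ler_wpM2l ?sum_inv_sqr_le//.
by rewrite mulr_ge0 ?expR_ge0 ?divr_ge0 ?exprn_ge0 ?ltW.
Qed.

Definition near_count (s : R) (w : Omega) : R := \sum_(k < K) (`|U (lift ord0 k) w - u0| <= s)%R%:R.

Let mnear (k : 'I_K) s : measurable_fun setT (fun w => (`|U (lift ord0 k) w - u0| <= s)%R).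
Proof.
apply: measurable_fun_ler; last exact: measurable_cst.
exact: measurable_dist.
Qed.

(** With a the mean of the count N, whose variance is at most a: if N >= a/2 the
    inverse is at most 2/a, and otherwise 1 <= 4 (N - a)^2 / a^2. *)
Lemma near_count_inv (t : R) : 0 < t <= Db ->
  intg P (fun w => (Num.max 1 (near_count (gamma * t) w))^-1) /\
  E (fun w => (Num.max 1 (near_count (gamma * t) w))^-1) <= 6 / (K%:R * kap * t).
Proof.
move=> tD; have /andP[t0 _] := tD; set s := gamma * t.
pose g (k : 'I_K) w : R := (`|U (lift ord0 k) w - u0| <= s)%R%:R.
have gE k : g k = \1_(near_event U u0 k s).
  apply/funext => w; rewrite /g indicE; case: (boolP (_ <= _)) => h.
    by rewrite mem_set.
  by rewrite memNset// => h'; move/negP: h; apply.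
have Eg k : E (g k) = fine (P (near_event U u0 k s)).
  by rewrite gE [E _]expect_indic//; exact: measurable_near_event.
have mg k : measurable_fun setT (g k).
  by apply: (@measurableT_comp _ _ _ _ _ _ (fun b : bool => b%:R : R)) => //; exact: mnear.
have g1 k w : `|g k w| <= 1 by rewrite /g; case: (_ <= s); rewrite ?normr1 ?normr0.
have Ig k : intg P (g k) by exact: intg_bnd (mg k) (g1 k).
pose q := E (g (Ordinal K0)).
have Eq k : E (g k) = q by rewrite /q !Eg (near_eq k (Ordinal K0)).
have qk : kap * t <= q by rewrite /q Eg; exact: near_lower.
have q0 : 0 < q by apply: lt_le_trans qk; rewrite mulr_gt0.
pose a := K%:R * q; have a0 : 0 < a by rewrite mulr_gt0.
have Ncnt w : near_count s w = \sum_k g k w by [].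
have mN : measurable_fun setT (near_count s) by apply: measurable_sum => k; exact: mg.
have N0 w : 0 <= near_count s w by apply: sumr_ge0 => k _; rewrite ler0n.
have Imax : intg P (fun w => (Num.max 1 (near_count s w))^-1).
  apply: (@intg_bnd _ _ _ P _ 1).
    by apply: measurable_invr; apply: measurable_maxr => //; exact: measurable_cst.
  move=> w; have m1 : 1 <= Num.max 1 (near_count s w) by rewrite le_max lexx.
  rewrite ger0_norm ?invr_ge0 ?(le_trans ler01)//.
  by rewrite invf_le1// (lt_le_trans ltr01).
have Nq w : near_count s w - a = \sum_k (g k w - E (g k)).
  rewrite Ncnt big_split/= sumrN; congr (_ - _).
  by under eq_bigr do rewrite Eq; rewrite sumr_const card_ord -mulr_natl.
have Isq : intg P (fun w => (near_count s w - a) ^+ 2).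
  apply: (@intg_bnd _ _ _ P _ ((K%:R + a) ^+ 2)).
    by apply: measurable_funX; apply: measurable_funB => //; exact: measurable_cst.
  move=> w; rewrite normrX lerXn2r ?nnegrE ?addr_ge0 ?(ltW a0)//.
  apply: le_trans (ler_normB _ _) _; rewrite (gtr0_norm a0) lerD2r ger0_norm//.
  have -> : K%:R = \sum_(k < K) (1 : R) by rewrite sumr_const card_ord.
  by apply: ler_sum => k _; apply: le_trans (ler_norm _) (g1 k w).
have Var : E (fun w => (near_count s w - a) ^+ 2) <= a.
  under [leLHS]expect_ext do rewrite Nq.
  apply: le_trans (@var_sum_le _ _ _ P _ g 1 mg g1 _) _.
    move=> k k' kk; rewrite -[expect P (g k)]/(E (g k)) -[expect P (g k')]/(E (g k')) !Eg -fineM ?fin_num_measure//; try exact: measurable_near_event.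
    rewrite -near_pair//.
    rewrite -expect_indic; last by apply: measurableI; exact: measurable_near_event.
    by apply: expect_ext => w; rewrite indicI !gE.
  rewrite /a -[K in K%:R * _]card_ord mulr_natl -sumr_const; apply: ler_sum => k _.
  rewrite -(Eq k); apply: expect_le => //.
    have -> : (fun w => g k w ^+ 2) = (fun w => g k w * g k w).
      by apply/funext => w; rewrite expr2.
    exact: intg_bndM (mg k) (g1 k) (Ig k).
  by move=> w; rewrite /g; case: (_ <= s); rewrite ?expr1n ?expr0n.
split => //.
have pt w : (Num.max 1 (near_count s w))^-1 <= 2 / a + 4 / a ^+ 2 * (near_count s w - a) ^+ 2.
  have m1 : 1 <= Num.max 1 (near_count s w) by rewrite le_max lexx.
  have [Na|Na] := leP (a / 2) (near_count s w).
    apply: (@le_trans _ _ (2 / a)); last by rewrite lerDl mulr_ge0 ?sqr_ge0// divr_ge0// sqr_ge0.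
    rewrite -[2 / a]invf_div lef_pV2 ?posrE ?divr_gt0//; last exact: lt_le_trans m1.
    by rewrite le_max Na orbT.
  apply: (@le_trans _ _ 1); first by rewrite invf_le1// (lt_le_trans ltr01).
  apply: (@le_trans _ _ (4 / a ^+ 2 * (near_count s w - a) ^+ 2)); last by rewrite lerDr divr_ge0// ltW.
  rewrite mulrAC ler_pdivlMr ?exprn_gt0// mul1r; have := N0 w; nra.
apply: (@le_trans _ _ (6 / a)).
  apply: (@le_trans _ _ (E (fun w => 2 / a + 4 / a ^+ 2 * (near_count s w - a) ^+ 2))).
    apply: expect_le => //; apply: intgD; [exact: intg_cst|exact: intgZ].
  rewrite /E expectD; [|exact: intg_cst|exact: intgZ].
  rewrite expect_cst expectZ//.
  have -> : 6 / a = 2 / a + 4 / a ^+ 2 * a by field; rewrite gt_eqF.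
  by rewrite lerD2l ler_wpM2l// divr_ge0// sqr_ge0.
rewrite ler_pM2l// lef_pV2 ?posrE// ?mulr_gt0// /a -mulrA ler_pM2l//.
Qed.

End Moments.

(** * Orders of the bandwidth and of the window count *)

Section Rates.
Context {R : realType} {K : nat}.
Context {d : measure_display} {Omega : measurableType d}.
Variables (P : probability Omega R) (U : 'I_K.+1 -> Omega -> R).
Variables (u0 gamma kap Db : R).
Hypothesis K0 : (0 < K)%N.
Hypothesis mU : forall k, measurable_fun setT (U k).
Hypothesis U00 : forall w, U ord0 w = u0.
Hypothesis gamma0 : 0 < gamma.
Hypothesis kap0 : 0 < kap.
Hypothesis Db1 : 1 <= Db.
Hypothesis near_lower : forall k t, 0 < t <= Db ->
  kap * t <= fine (P (near_event U u0 k (gamma * t))).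
Hypothesis far_le : forall t, 0 <= t -> t <= Db ->
  fine (P [set w | forall k : 'I_K, gamma * t < `|U (lift ord0 k) w - u0|])
    <= expR (- (kap * K%:R * t)).
Hypothesis near_pair : forall k k' s, k != k' ->
  P (near_event U u0 k s `&` near_event U u0 k' s) = (P (near_event U u0 k s) * P (near_event U u0 k' s))%E.
Hypothesis near_eq : forall k k' s, P (near_event U u0 k s) = P (near_event U u0 k' s).
Hypothesis dist_le : {ae P, forall w, forall k : 'I_K, `|U (lift ord0 k) w - u0| <= gamma * Db}.
Variables (n : 'I_K.+1 -> nat) (beta e0 b0' b0 : R).
Hypothesis n00 : (0 < n ord0)%N.
Hypothesis beta0 : 0 < beta.
Hypothesis e00 : 0 < e0.
Hypothesis b0'0 : 0 < b0'.
Hypothesis bal : balanced n b0' b0.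
Let E := expect P.

Definition rate : R :=
  Num.max ((K%:R / gamma) `^ (- (2 * beta)))
    (Num.max (((ntot n)%:R / gamma) `^ (- (2 * beta / (2 * beta + 1))))
       (ntot n)%:R^-1).

Let hw w := bandwidth n beta e0 gamma u0 (ids U w).
Let Nw w := window_count n (hw w) u0 (ids U w).
Let hs := e0 * ((ntot n)%:R / gamma) `^ (- (2 * beta + 1)^-1).
Let d1 w := dist_ord u0 (ids U w) 1.

Let K0R : 0 < K%:R :> R. Proof. by rewrite ltr0n. Qed.
Let Db0 : 0 < Db. Proof. exact: lt_le_trans ltr01 Db1. Qed.

Lemma ntot_gt0 : 0 < (ntot n)%:R :> R.
Proof. by rewrite ltr0n /ntot big_ord_recl addn_gt0 n00. Qed.

Let ng0 : 0 < (ntot n)%:R / gamma. Proof. by rewrite divr_gt0// ntot_gt0. Qed.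

Lemma hs_gt0 : 0 < hs.
Proof. by rewrite mulr_gt0// powR_gt0. Qed.

Lemma first_ge0 w : 0 <= d1 w.
Proof. by rewrite /d1; have [|k ->] := @dist_ord_mem _ _ u0 (ids U w) 1; rewrite ?K0. Qed.

Lemma bandwidth_ge0 w : 0 <= hw w.
Proof. exact: le_trans (first_ge0 w) (bandwidth_ge_first K0 _ _ _ _ _ _). Qed.

Lemma measurable_hw : measurable_fun setT hw.
Proof. exact: measurable_bandwidth. Qed.

Lemma window_count_ge1 w : 1 <= Nw w.
Proof.
rewrite /Nw /window_count (bigD1 ord0)//= /near_id /ids U00 subrr normr0 bandwidth_ge0 mulr1.
apply: (@le_trans _ _ (n ord0)%:R); first by rewrite ler1n.
by rewrite lerDl; apply: sumr_ge0 => k _; rewrite mulr_ge0.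
Qed.

Lemma measurable_Nw : measurable_fun setT Nw.
Proof.
apply: measurable_sum => k; apply: measurable_funM; first exact: measurable_cst.
apply: measurable_le_bool; last exact: measurable_hw.
exact: measurable_dist.
Qed.

Lemma bandwidth_le_ae : {ae P, forall w, hw w <= gamma * Db}.
Proof.
apply: filterS dist_le => w H.
apply: le_trans (bandwidth_le_last K0 _ _ _ _ _ _) _.
by have [|k ->] := @dist_ord_mem _ _ u0 (ids U w) K; rewrite ?K0 ?leqnn//; exact: H.
Qed.

Lemma rate_ge0 : 0 <= rate.
Proof. by rewrite le_max powR_ge0. Qed.

Lemma intg_bandwidth b : 0 < b -> intg P (fun w => hw w `^ b).
Proof.
move=> b_0; apply: (@intg_ae_bnd _ _ _ _ _ ((gamma * Db) `^ b)).
  exact: (measurableT_comp (measurable_powR b) measurable_hw).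
apply: filterS bandwidth_le_ae => w dw; rewrite ger0_norm ?powR_ge0//.
by rewrite ge0_ler_powR ?nnegrE ?(ltW b_0)// ?bandwidth_ge0// mulr_ge0 ?ltW.
Qed.

(** h is at most the larger of the theoretical bandwidth and the nearest
    distance; each contributes one term of the rate. *)
Lemma bandwidth_moment :
  E (fun w => hw w `^ (2 * beta)) <= (e0 `^ (2 * beta) + dist_const kap (2 * beta)) * rate.
Proof.
have b2 : 0 < 2 * beta by rewrite mulr_gt0.
have b21 : 2 * beta + 1 != 0 by rewrite gt_eqF// addr_gt0.
have I1 := intg_first K0 mU gamma0 Db1 dist_le b2.
apply: (@le_trans _ _ (E (fun w => hs `^ (2 * beta) + d1 w `^ (2 * beta)))).
  apply: expect_le; [exact: intg_bandwidth|by apply: intgD => //; exact: intg_cst|].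
  move=> w; have := bandwidth_le_max K0 u0 (ids U w) n beta e0 gamma.
  rewrite -/(hw w) -/hs -/(d1 w) => hm.
  have : hw w `^ (2 * beta) <= Num.max hs (d1 w) `^ (2 * beta).
    rewrite ge0_ler_powR ?nnegrE ?(ltW b2) ?bandwidth_ge0//.
    by rewrite le_max (ltW hs_gt0).
  by move/le_trans; apply; rewrite maxEle; case: ifP => _; rewrite ?lerDl ?lerDr powR_ge0.
rewrite /E expectD//; last exact: intg_cst.
rewrite expect_cst [leRHS]mulrDl; apply: lerD.
  rewrite /hs powRM ?(ltW e00) ?powR_ge0// ler_wpM2l ?powR_ge0//.
  rewrite -powRrM [X in _ `^ X](_ : _ = - (2 * beta / (2 * beta + 1))); last by field.
  by rewrite le_max le_max lexx orbT.
have := first_moment K0 mU gamma0 kap0 Db1 far_le dist_le b2.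
move/le_trans; apply.
rewrite ler_wpM2l//.
  by rewrite /dist_const /poly_exp_const !mulr_ge0 ?expR_ge0 ?invr_ge0 ?exprn_ge0 ?ltW.
have -> : gamma / K%:R = (K%:R / gamma) `^ (-1).
  by rewrite powR_inv1 ?invf_div// divr_ge0// ltW.
by rewrite -powRrM mulN1r /rate le_max lexx.
Qed.

Lemma intg_inv_count : intg P (fun w => (Nw w)^-1).
Proof.
apply: (@intg_bnd _ _ _ P _ 1); first exact/measurable_invr/measurable_Nw.
move=> w; have N1 := window_count_ge1 w; rewrite ger0_norm ?invr_ge0 ?(le_trans ler01)//.
by rewrite invf_le1// (lt_le_trans ltr01).
Qed.

(** By [bandwidth_dich], either N = n, or the window contains the nearest source and
    all the sources within the theoretical bandwidth, each of them with at least
    b0' nbar observations. *)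
Lemma inv_count_moment :
  E (fun w => (Nw w)^-1) <= (1 + 12 / (b0' * kap * e0)) * rate.
Proof.
have b21 : 0 < 2 * beta + 1 by rewrite addr_gt0// mulr_gt0.
have n0 := ntot_gt0.
have K1 : 0 < K.+1%:R :> R by rewrite ltr0n.
have nb0 : 0 < nbar n :> R by rewrite divr_gt0.
pose t := hs / gamma; have t0 : 0 < t by rewrite divr_gt0// hs_gt0.
have hst : hs = gamma * t by rewrite /t mulrCA mulfV ?mulr1// gt_eqF.
pose G := K.+1%:R / (b0' * (ntot n)%:R).
have G0 : 0 < G by rewrite divr_gt0// mulr_gt0.
have rn : (ntot n)%:R^-1 <= rate by rewrite !le_max lexx !orbT.
have nk k : b0' * nbar n <= (n (lift ord0 k))%:R.
  by have [/(_ k) /andP[+ _] _] := bal; rewrite ler_pdivlMr.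
have dich : {ae P, forall w, (Nw w)^-1 <= (ntot n)%:R^-1 \/
    (t <= Db /\ (Nw w)^-1 <= G * (Num.max 1 (near_count U u0 hs w))^-1)}.
  apply: filterS dist_le => w H.
  have [hK|[h1 h2]] := bandwidth_dich K0 u0 (ids U w) n beta e0 gamma.
    left; rewrite le_eqVlt; apply/orP; left; apply/eqP; congr (_^-1).
    rewrite /Nw /window_count /ntot natr_sum; apply: eq_bigr => k _.
    rewrite [near_id _ _ _ _](_ : _ = true) ?mulr1// /near_id.
    have [j ->|->] := unliftP ord0 k.
      by rewrite /hw -hK; exact: (dist_ord_last K0 u0 (ids U w)).
    by rewrite /ids U00 subrr normr0 bandwidth_ge0.
  right; rewrite -/hs in h1 h2; split.
    rewrite /t ler_pdivrMr// mulrC; apply: le_trans h2 _.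
    by have [|k ->] := @dist_ord_mem _ _ u0 (ids U w) K; rewrite ?K0 ?leqnn//; exact: H.
  have Nge : b0' * nbar n * Num.max 1 (near_count U u0 hs w) <= Nw w.
    apply: (@le_trans _ _ (b0' * nbar n * near_count U u0 (hw w) w)).
      apply: ler_wpM2l; first by rewrite mulr_ge0 ?ltW.
      rewrite ge_max; apply/andP; split; last first.
        apply: ler_sum => k _; case: (leP _ hs) => [h|_]; last by rewrite ler0n.
        by rewrite (le_trans h h1).
      have [|k dk] := @dist_ord_mem _ _ u0 (ids U w) 1; first by rewrite K0.
      rewrite /near_count (bigD1 k)//= -[X in X <= _]addr0; apply: lerD; last by rewrite sumr_ge0.
      suff -> : (`|U (lift ord0 k) w - u0| <= hw w) = true by [].
      by rewrite -[X in X <= _]dk; exact: (bandwidth_ge_first K0 u0 (ids U w) n beta e0 gamma).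
    rewrite /Nw /window_count big_ord_recl -[leLHS]add0r; apply: lerD; first by rewrite mulr_ge0.
    rewrite /near_count mulr_sumr; apply: ler_sum => k _.
    by rewrite ler_wpM2r.
  have m1 : 0 < Num.max 1 (near_count U u0 hs w) by rewrite lt_max ltr01.
  have -> : G * (Num.max 1 (near_count U u0 hs w))^-1 = (b0' * nbar n * Num.max 1 (near_count U u0 hs w))^-1.
    by rewrite /G /nbar; field; rewrite !gt_eqF.
  by rewrite lef_pV2 ?posrE ?mulr_gt0// (lt_le_trans ltr01 (window_count_ge1 w)).
have [tD|tD] := leP t Db; last first.
  apply: (@le_trans _ _ (ntot n)%:R^-1).
    rewrite -[leRHS](expect_cst P); apply: expect_ae_le; [exact: intg_inv_count|exact: intg_cst|].
    by apply: filterS dich => w [//|[]]; rewrite leNgt tD.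
  apply: le_trans rn _; rewrite mulrDl mul1r lerDl mulr_ge0 ?rate_ge0// divr_ge0// ltW//.
  by rewrite !mulr_gt0.
have [|Ic Ec] := near_count_inv K0 mU kap0 near_lower near_pair near_eq (t := t).
  by rewrite t0 tD.
apply: (@le_trans _ _ (E (fun w => (ntot n)%:R^-1 + G * (Num.max 1 (near_count U u0 hs w))^-1))).
  apply: expect_ae_le; [exact: intg_inv_count| |].
    by apply: intgD; [exact: intg_cst|apply: intgZ; rewrite hst].
  apply: filterS dich => w [h|[_ h]]; apply: le_trans h _.
    by rewrite lerDl mulr_ge0 ?(ltW G0)// invr_ge0 le_max ler01.
  by rewrite lerDr invr_ge0 ltW.
rewrite /E expectD; [|exact: intg_cst|by apply: intgZ; rewrite hst].
rewrite expect_cst expectZ; last by rewrite hst.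
rewrite mulrDl mul1r; apply: lerD => //.
rewrite hst; apply: (@le_trans _ _ (G * (6 / (K%:R * kap * t)))).
  by rewrite ler_wpM2l ?(ltW G0).
apply: (@le_trans _ _ (12 / (b0' * kap) * ((ntot n)%:R * t)^-1)).
  have -> : G * (6 / (K%:R * kap * t)) = K.+1%:R / K%:R * (6 / (b0' * kap) * ((ntot n)%:R * t)^-1).
    by rewrite /G; field; rewrite !gt_eqF.
  have -> : 12 / (b0' * kap) * ((ntot n)%:R * t)^-1 = 2 * (6 / (b0' * kap) * ((ntot n)%:R * t)^-1).
    by field; rewrite !gt_eqF.
  apply: ler_wpM2r.
    by apply: divr_ge0; [apply: divr_ge0 => //; apply: mulr_ge0|apply: mulr_ge0]; exact: ltW.
  by rewrite ler_pdivrMr// -natrM ler_nat mul2n -addnn -addn1 leq_add2l.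
have -> : 12 / (b0' * kap * e0) * rate = 12 / (b0' * kap) * (e0^-1 * rate).
  by field; rewrite !gt_eqF.
apply: ler_wpM2l; first by apply: divr_ge0 => //; apply: mulr_ge0; exact: ltW.
have -> : ((ntot n)%:R * t)^-1 = e0^-1 * ((ntot n)%:R / gamma) `^ (- (2 * beta / (2 * beta + 1))).
  have -> : - (2 * beta / (2 * beta + 1)) = (2 * beta + 1)^-1 - 1.
    by field; rewrite gt_eqF.
  rewrite powRD; last by rewrite (gt_eqF ng0) implybT.
  rewrite powR_inv1 ?(ltW ng0)// /t /hs powRN.
  have p0 : 0 < ((ntot n)%:R / gamma) `^ (2 * beta + 1)^-1 by rewrite powR_gt0.
  by field; rewrite !gt_eqF.
by apply: ler_wpM2l; [rewrite invr_ge0 ltW|rewrite /rate !le_max lexx orbT].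
Qed.

End Rates.

(** * Conditional expectations and Hoelder continuity *)

Section Misc.
Context {R : realType}.

Lemma within_continuous_at (A : set R) (g : R -> R) (x e : R) :
  {within A, continuous g} -> A x -> 0 < e ->
  exists2 dl : R, 0 < dl & forall y, A y -> `|y - x| < dl -> `|g y - g x| < e.
Proof.
move=> /subspace_continuousP cg Ax e0.
have /cvgrPdist_lt /(_ e e0) := cg x Ax.
rewrite near_withinE => /nbhs_ballP[dl /= dl0 H]; exists dl => // y Ay yx.
by rewrite distrC; apply: H => //; rewrite /ball/= distrC.
Qed.

Lemma derive1n_cst (j : nat) (a : R) :
  derive1n j (fun=> a : R) = fun=> (if j is 0%N then a else 0).
Proof.
case: j => // j; elim: j => [|j IH]; first by apply/funext => x; rewrite derive1n1 derive1_cst.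
by rewrite derive1nS IH; apply/funext => x; rewrite derive1_cst.
Qed.

Lemma hoelder_cst (beta L a : R) : 0 <= L -> hoelder beta L (fun=> a).
Proof.
move=> L0; split=> [j _ u|u v]; rewrite derive1n_cst; first exact: derivable_cst.
by rewrite subrr normr0 mulr_ge0// powR_ge0.
Qed.

End Misc.

Section CondExp.
Context {R : realType} {d : measure_display} {Omega : measurableType d}.
Variable P : probability Omega R.

Lemma cond_exp_weight (S : set (set Omega)) (Z V g : Omega -> R) c :
  S `<=` measurable -> is_cond_exp P <<s S >> Z V ->
  smeas S g -> (forall w, `|g w| <= c) ->
  [/\ intg P Z, intg P V & expect P (fun w => g w * Z w) = expect P (fun w => g w * V w)].
Proof.
move=> SM [IZ IV _ H] mg gc; split => //.
have mgT := smeasW SM mg.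
apply/eqP; rewrite -subr_eq0 -(expectMB mgT gc)//.
apply/eqP; apply: (@expect_mono0 _ _ _ P S) => //.
- exact: intgB.
- by apply: intg_bndM gc _ => //; exact: intgB.
move=> D sD; rewrite expect_indicB//; last exact: gen_measurable sD.
have := H D sD => /(congr1 fine); rewrite -/(Rintegral P D Z) -/(Rintegral P D V).
by rewrite !expect_in => ->; rewrite subrr.
Qed.

Lemma cond_exp_set (S : set (set Omega)) (Z V : Omega -> R) D :
  is_cond_exp P <<s S >> Z V -> <<s S >> D ->
  expect P (fun w => \1_D w * Z w) = expect P (fun w => \1_D w * V w).
Proof.
move=> [_ _ _ H] sD; have := H D sD => /(congr1 fine).
by rewrite -/(Rintegral P D Z) -/(Rintegral P D V) !expect_in.
Qed.

Lemma cond_exp_mean (S : set (set Omega)) (Z V : Omega -> R) :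
  is_cond_exp P <<s S >> Z V -> expect P Z = expect P V.
Proof.
move=> H; have sT : <<s S >> setT.
  exact: (@measurableT _ (g_sigma_algebraType S)).
have e (g : Omega -> R) : expect P (fun w => \1_setT w * g w) = expect P g.
  by apply: expect_ext => w; rewrite indicT mul1r.
by have := cond_exp_set H sT; rewrite !e.
Qed.

End CondExp.

(** The generators in the definition of [sigma_gen], in the form required by
    [smeas]. *)
Definition genset (R : realType) (d : measure_display) (Omega : measurableType d)
    (J : Type) (Z : J -> Omega -> R) : set (set Omega) :=
  [set D | exists j B, measurable B /\ D = Z j @^-1` B].

Section GenSet.
Context {R : realType} {d : measure_display} {Omega : measurableType d}.
Variables (J : Type) (Z : J -> Omega -> R).

Lemma genset_smeas j : smeas (genset Z) (Z j).
Proof. by apply: smeas_gen => B mB; exists j, B. Qed.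

Lemma genset_meas : (forall j, measurable_fun setT (Z j)) -> genset Z `<=` measurable.
Proof. by move=> mZ _ [j [B [mB ->]]]; rewrite -[X in measurable X]setTI; exact: mZ. Qed.

End GenSet.

(** * Second moments of the target covariates *)

Section Arith.
Context {R : realType}.
Implicit Types a b c : R.

Lemma amgm a b : b * (2 * a) <= a ^+ 2 + b ^+ 2.
Proof. by have := sqr_ge0 (a - b); nra. Qed.

Lemma eighth_le a b c : c * a <= c * (8 * b) -> 8^-1 * (c * a) <= c * b.
Proof. by lra. Qed.

Lemma half_le a b : a <= a / 2 + b -> a / 2 <= b.
Proof. by lra. Qed.

Lemma lower_final a b c (x : R) : a / 2 <= x -> x <= 32 * b + c -> c <= a / 4 -> a / 128 <= b.
Proof. by lra. Qed.

End Arith.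

Section FourthMoment.
Context {R : realType} {p K : nat}.
Variables (beta L lambda0 e0 u0 gamma Db : R) (Ucal : set R).
Variables (m4 : ('I_p -> R -> R) -> R -> R).
Variable n : 'I_K.+1 -> nat.
Context {d : measure_display} {Omega : measurableType d}.
Variables (P : probability Omega R) (U : 'I_K.+1 -> Omega -> R).
Variables (X : obs n -> Omega -> 'rV[R]_p) (eps : obs n -> Omega -> R).
Hypothesis L0 : 0 <= L.
Hypothesis lam0 : 0 < lambda0.
Hypothesis K0 : (0 < K)%N.
Hypothesis n00 : (0 < n ord0)%N.
Hypothesis gamma0 : 0 < gamma.
Hypothesis Db1 : 1 <= Db.
Hypothesis Uu0 : Ucal u0.
Hypothesis m4c : forall theta, hoelder_class beta L theta -> {within Ucal, continuous (m4 theta)}.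
Hypothesis mdata : measurable_data U X eps.
Hypothesis U00 : forall w, U ord0 w = u0.
Hypothesis near_all : forall t, 0 < t <= Db ->
  0 < fine (P (\bigcap_(k in [set: 'I_K]) near_event U u0 k (gamma * t))).
Hypothesis U_supp : {ae P, forall w, forall k : 'I_K, Ucal (U (lift ord0 k) w)}.
Hypothesis dist_gt0 : {ae P, forall w, forall k : 'I_K, 0 < `|U (lift ord0 k) w - u0|}.
Hypothesis Xbnd : bounded_covariates P X.
Hypothesis fm : forall theta, hoelder_class beta L theta ->
  fourth_moment P U X eps theta (m4 theta).
Hypothesis design : design_cond P U X beta e0 gamma u0 lambda0.
Let E := expect P.

Definition covproj (t : 'cV[R]_p) (o : obs n) (w : Omega) : R := (X o w *m t) 0 0.

Let thc (t : 'cV[R]_p) (r : R) : 'I_p -> R -> R := fun j _ => r * t j 0.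

Lemma thc_class t r : hoelder_class beta L (thc t r).
Proof. by move=> j; exact: hoelder_cst. Qed.

Lemma Yobs_thc t r o w : Yobs U X eps (thc t r) o w = r * covproj t o w + eps o w.
Proof.
rewrite /Yobs /covproj; congr (_ + _).
have -> : \col_j thc t r j (U (dom o) w) = r *: t by apply/colP => j; rewrite !mxE.
by rewrite -scalemxAr mxE.
Qed.

Lemma measurable_covproj t o : measurable_fun setT (covproj t o).
Proof.
apply: mxmeasM; last exact: mxmeas_cst.
by move=> i j; rewrite (ord1 i); case: mdata => _ + _; apply.
Qed.

Lemma covproj_le1 t o : sqn t = 1 -> {ae P, forall w, covproj t o w ^+ 2 <= 1}.
Proof.
move=> t1; apply: filterS (Xbnd o) => w; rewrite norm2E => X1.
have -> : covproj t o w = dot (X o w)^T t by rewrite dotE trmxK.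
apply: le_trans (dot_le _ _) _; rewrite t1 mulr1.
by move: X1; rewrite -{1}sqrtr1 ler_psqrt// nnegrE ?sqn_ge0.
Qed.

Let ids_gens := genset U.
Let ids_gensM : ids_gens `<=` measurable. Proof. by apply: genset_meas; case: mdata. Qed.

Let hw w := bandwidth n beta e0 gamma u0 (ids U w).

Let mUid k : measurable_fun [set: g_sigma_algebraType ids_gens] (U k).
Proof. exact: genset_smeas. Qed.

Lemma wgt_smeas k : smeas ids_gens (fun w => wgt n (hw w) u0 (ids U w) k).
Proof.
have mh : measurable_fun [set: g_sigma_algebraType ids_gens] hw by exact: measurable_bandwidth.
have mn j : measurable_fun [set: g_sigma_algebraType ids_gens]
    (fun w => (near_id (hw w) u0 (ids U w) j)%:R : R).
  by apply: measurable_le_bool => //; exact: measurable_dist.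
apply: measurable_funM => //; apply: measurable_invr.
by apply: measurable_sum => j; apply: measurable_funM => //; exact: measurable_cst.
Qed.

Let Nw1 w : 1 <= window_count n (hw w) u0 (ids U w).
Proof. exact: window_count_ge1. Qed.

Lemma wgt_01 w k : 0 <= wgt n (hw w) u0 (ids U w) k <= 1.
Proof.
rewrite wgt_ge0/= /wgt; have N0 := lt_le_trans ltr01 (Nw1 w).
by rewrite ler_pdivrMr// mul1r; apply: le_trans (Nw1 w); rewrite lern1 leq_b1.
Qed.

Lemma wgt_sum w : \sum_k (n k)%:R * wgt n (hw w) u0 (ids U w) k = 1.
Proof.
rewrite /wgt; under eq_bigr do rewrite mulrA.
by rewrite -mulr_suml mulfV// gt_eqF// (lt_le_trans ltr01 (Nw1 w)).
Qed.

Lemma bandwidth_gt0 : {ae P, forall w, 0 < hw w}.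
Proof.
apply: filterS dist_gt0 => w H.
apply: lt_le_trans (bandwidth_ge_first K0 _ _ _ _ _ _).
by have [|k ->] := @dist_ord_mem _ _ u0 (ids U w) 1; rewrite ?K0//; exact: H.
Qed.

Lemma lower_wgt t : sqn t = 1 -> {ae P, forall w,
  lambda0 <= \sum_k \sum_(i < n k) wgt n (hw w) u0 (ids U w) k * covproj t (obs1 i) w ^+ 2}.
Proof.
move=> t1; apply: filterS2 bandwidth_gt0 design => w h0 [Gu op].
apply: le_trans (gram_lower h0 Gu lam0 op t1) _.
apply: ler_sum => k _; rewrite -mulr_sumr ler_wpM2l ?wgt_ge0// sqn_sum.
apply: ler_sum => i _; rewrite le_eqVlt; apply/orP; left; apply/eqP; congr (_ ^+ 2).
by rewrite /covproj !mxE; apply: eq_bigr => j _; rewrite mxE.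
Qed.

Let Z t r o w := `|Yobs U X eps (thc t r) o w| ^+ 4.

Lemma fourth_weight t r o (g : Omega -> R) c : smeas ids_gens g -> (forall w, `|g w| <= c) ->
  [/\ intg P (Z t r o), intg P (fun w => m4 (thc t r) (U (dom o) w)) &
   E (fun w => g w * Z t r o w) = E (fun w => g w * m4 (thc t r) (U (dom o) w))].
Proof.
by move=> mg gc; apply: cond_exp_weight mg gc => //; exact: (fm (thc_class t r) o).
Qed.

Lemma fourth_target t r o : dom o = ord0 -> E (Z t r o) = m4 (thc t r) u0.
Proof.
move=> o0; rewrite [LHS](cond_exp_mean (fm (thc_class t r) o)).
transitivity (E (fun=> m4 (thc t r) u0)); last exact: expect_cst.
by apply: expect_ext => w; rewrite o0 U00.
Qed.

Lemma pow4_le (a b : R) : (a - b) ^+ 4 <= 8 * (`|a| ^+ 4 + `|b| ^+ 4).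
Proof.
have -> : `|a| ^+ 4 = a ^+ 4 by rewrite -normrX ger0_norm// (exprM _ 2 2) sqr_ge0.
have -> : `|b| ^+ 4 = b ^+ 4 by rewrite -normrX ger0_norm// (exprM _ 2 2) sqr_ge0.
have h1 : (a - b) ^+ 2 <= 2 * (a ^+ 2 + b ^+ 2) by have := sqr_ge0 (a + b); nra.
have h2 : (a ^+ 2 + b ^+ 2) ^+ 2 <= 2 * (a ^+ 4 + b ^+ 4).
  by have := sqr_ge0 (a ^+ 2 - b ^+ 2); nra.
have -> : (a - b) ^+ 4 = ((a - b) ^+ 2) ^+ 2 by rewrite -exprM.
have := sqr_ge0 (a - b); have := sqr_ge0 a; have := sqr_ge0 b; nra.
Qed.

(** Let D be the event that all identifiers are within gamma s of u0.  On D, writing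
    x^2 <= lambda0 / 2 + x^4 / (2 lambda0) in [gram_lower] bounds the weighted mean
    of the (X t)^4 below by lambda0^2.  For the constant coefficients r t,
    (r X t)^4 <= 8 (Y_rt^4 + Y_0^4), and, the weights being functions of the
    identifiers, the weighted means of Y_rt^4 and Y_0^4 have conditional
    expectations at most Mr + 1 and M0 + 1, by continuity of the conditional
    fourth moments, whose values at u0 are Mr and M0.  Hence
    r^4 lambda0^2 is at most a constant times Mr + M0 + 2; and at the target
    Mr <= 8 (r^4 E (X t)^2 + M0) because |X t| <= 1. *)
Lemma target_second_moment t (i : 'I_(n ord0)) : sqn t = 1 ->
  lambda0 ^+ 2 / 128 <= E (fun w => covproj t (obs2 i) w ^+ 2).
Proof.
move=> t1; pose o2 : obs n := obs2 i.
set mu2 := E _; set M0 := m4 (thc t 0) u0.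
have M00 : 0 <= M0.
  by rewrite /M0 -(fourth_target t 0 (o := o2))//; apply: expect_ge0 => w; rewrite exprn_ge0.
(* r is so large that, after division by r^4, the noise contributes at most
   lambda0^2 / 4: this is rlam. *)
pose r := Num.max 1 ((36 * M0 + 8) * 4 / lambda0 ^+ 2).
have r1 : 1 <= r by rewrite le_max lexx.
have r0 : 0 < r by exact: lt_le_trans ltr01 r1.
have r4 : r <= r ^+ 4 by rewrite ler_eXnr.
have rlam : (36 * M0 + 8) / r ^+ 4 <= lambda0 ^+ 2 / 4.
  rewrite ler_pdivrMr ?exprn_gt0//.
  have : (36 * M0 + 8) * 4 / lambda0 ^+ 2 <= r ^+ 4.
    by apply: le_trans r4; rewrite /r le_max lexx orbT.
  by rewrite ler_pdivrMr ?exprn_gt0//; lra.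
set Mr := m4 (thc t r) u0.
have triv : smeas ids_gens (fun=> 1 : R) by exact: measurable_cst.
have triv1 (w : Omega) : `|1 : R| <= 1 by rewrite normr1.
have IZ s (o : obs n) : intg P (Z t s o) by case: (fourth_weight t s o triv triv1).
have Im s (o : obs n) : intg P (fun w => m4 (thc t s) (U (dom o) w)).
  by case: (fourth_weight t s o triv triv1).
have Z0 (o : obs n) w : Z t 0 o w = `|eps o w| ^+ 4 by rewrite /Z Yobs_thc mul0r add0r.
have Ixt o : intg P (fun w => covproj t o w ^+ 2).
  apply: (@intg_ae_bnd _ _ _ _ _ 1); first by apply: measurable_funX; exact: measurable_covproj.
  by apply: filterS (covproj_le1 o t1) => w h; rewrite ger0_norm ?sqr_ge0.
have MrLe : Mr <= 8 * (r ^+ 4 * mu2 + M0).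
  rewrite /Mr /M0 -!(fourth_target t _ (o := o2))// /mu2 /E -expectZ// -expectD//; last exact: intgZ.
  rewrite -expectZ; last by apply: intgD => //; exact: intgZ.
  apply: expect_ae_le => //; first by apply/intgZ/intgD => //; exact: intgZ.
  apply: filterS (covproj_le1 o2 t1) => w x1; rewrite Z0 /Z Yobs_thc.
  have -> : `|r * covproj t o2 w + eps o2 w| ^+ 4 = (r * covproj t o2 w - - eps o2 w) ^+ 4.
    by rewrite opprK -normrX ger0_norm// (exprM _ 2 2) sqr_ge0.
  apply: le_trans (pow4_le _ _) _; rewrite normrN ler_wpM2l// lerD2r.
  set x := covproj t o2 w in x1 *.
  have -> : `|r * x| ^+ 4 = r ^+ 4 * (x ^+ 2 * x ^+ 2).
    by rewrite -normrX ger0_norm ?(exprM _ 2 2) ?sqr_ge0//; ring.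
  apply: ler_wpM2l; first by rewrite exprn_ge0 ?ltW.
  by rewrite ler_piMr ?sqr_ge0.
have [dl dl0 Hdl] : exists2 dl, 0 < dl & forall y, Ucal y -> `|y - u0| < dl ->
    m4 (thc t r) y <= Mr + 1 /\ m4 (thc t 0) y <= M0 + 1.
  have [d1 d10 H1] := within_continuous_at (m4c (thc_class t r)) Uu0 ltr01.
  have [d2 d20 H2] := within_continuous_at (m4c (thc_class t 0)) Uu0 ltr01.
  exists (Num.min d1 d2); first by rewrite lt_min d10.
  move=> y Uy; rewrite lt_min => /andP[/(H1 _ Uy) y1 /(H2 _ Uy) y2].
  split; rewrite -lerBlDl; apply: le_trans (ler_norm _) _; exact: ltW.
pose s := Num.min 1 (dl / (2 * gamma)).
have s0 : 0 < s by rewrite lt_min ltr01 divr_gt0// mulr_gt0.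
have s1 : s <= Db by apply: le_trans Db1; rewrite ge_min lexx.
have sdl : gamma * s < dl.
  apply: (@le_lt_trans _ _ (gamma * (dl / (2 * gamma)))).
    by rewrite ler_pM2l// ge_min lexx orbT.
  have -> : gamma * (dl / (2 * gamma)) = dl / 2 by field; rewrite gt_eqF.
  by rewrite ltr_pdivrMr// ltr_pMr// ltr1n.
pose D := \bigcap_(k in [set: 'I_K]) near_event U u0 k (gamma * s).
have PD : 0 < fine (P D) by apply: near_all; rewrite s0.
have sD : <<s ids_gens >> D.
  apply: (@fin_bigcap_measurable _ (g_sigma_algebraType ids_gens)) => // k _.
  rewrite near_eventE -[X in measurable X]setTI; exact: mUid.
have mD := gen_measurable ids_gensM sD.
have smD : smeas ids_gens (\1_D : Omega -> R).
  exact: (@measurable_indic _ (g_sigma_algebraType ids_gens) R setT D sD).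
pose g k w := \1_D w * wgt n (hw w) u0 (ids U w) k.
have mg k : smeas ids_gens (g k) by apply: measurable_funM => //; exact: wgt_smeas.
have g0 k w : 0 <= g k w.
  by rewrite mulr_ge0//; case/andP: (wgt_01 w k).
have g1 k w : `|g k w| <= 1.
  rewrite ger0_norm//; have /andP[w0 w1] := wgt_01 w k.
  by rewrite /g indicE; case: (_ \in _); rewrite ?mul1r ?mul0r.
have Ig k : intg P (g k) by apply: intg_bnd (g1 k); exact: smeasW ids_gensM (mg k).
have bndm q Mq k (o : obs n) : (forall y, Ucal y -> `|y - u0| < dl -> m4 (thc t q) y <= Mq) ->
    E (fun w => g k w * Z t q o w) <= Mq * E (g k).
  move=> H; have [_ _ ->] := fourth_weight t q o (mg k) (g1 k).
  rewrite -expectZ//; apply: expect_ae_le.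
  - by apply: intg_bndM (g1 k) (Im _ _); exact: smeasW ids_gensM (mg k).
  - exact: intgZ.
  apply: filterS U_supp => w Uw; rewrite mulrC.
  have [wD|wD] := pselect (D w); last by rewrite /g indicE memNset// !mul0r !mulr0.
  rewrite ler_wpM2r//; apply: H.
    by have [j ->|->] := unliftP ord0 (dom o); [exact: Uw|rewrite U00].
  have [j ->|->] := unliftP ord0 (dom o); last by rewrite U00 subrr normr0.
  exact: le_lt_trans (wD j I) sdl.
have nE k : (n k)%:R = \sum_(j < n k) (1 : R) by rewrite sumr_const card_ord.
pose c4 := 4 / (lambda0 * r ^+ 4).
have c40 : 0 <= c4 by rewrite divr_ge0// mulr_ge0 ?exprn_ge0 ?ltW.
(* The second moments, bounded below by the design, are traded for fourth
   moments, which are controlled near u0. *)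
have pt : {ae P, forall w, \1_D w * lambda0 <= \1_D w * (lambda0 / 2) +
    c4 * \sum_k \sum_(i < n k) (g k w * Z t r (obs1 i) w + g k w * Z t 0 (obs1 i) w)}.
  apply: filterS (lower_wgt t1) => w low.
  have [wD|wD] := pselect (D w); last first.
    rewrite indicE memNset// !mul0r add0r mulr_ge0//.
    by do 2 (apply: sumr_ge0 => ? _); rewrite addr_ge0// mulr_ge0// exprn_ge0.
  have -> : \1_D w = 1 :> R by rewrite indicE mem_set.
  rewrite !mul1r; apply: le_trans low _.
  have l2 : lambda0 / 2 = \sum_k (n k)%:R * wgt n (hw w) u0 (ids U w) k * (lambda0 / 2).
    by rewrite -mulr_suml wgt_sum mul1r.
  rewrite l2 mulr_sumr -big_split/=; apply: ler_sum => k _.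
  rewrite nE !mulr_suml mulr_sumr -big_split/=.
  apply: ler_sum => j _; rewrite mul1r /g indicE mem_set// !mul1r -mulrDr.
  have /andP[w0 _] := wgt_01 w k; set ww := wgt _ _ _ _ _ in w0 *.
  rewrite [leRHS](_ : _ = ww * (lambda0 / 2 + c4 * (Z t r (obs1 j) w + Z t 0 (obs1 j) w))); last by ring.
  rewrite ler_wpM2l//; set x := covproj _ _ _.
  have h : x ^+ 4 * r ^+ 4 <= 8 * (Z t r (obs1 j) w + Z t 0 (obs1 j) w).
    rewrite /Z -exprMn; apply: le_trans (pow4_le _ _).
    by rewrite !Yobs_thc mul0r add0r addrK mulrC.
  have h2 : c4 * (x ^+ 4 * r ^+ 4) <= c4 * (8 * (Z t r (obs1 j) w + Z t 0 (obs1 j) w)).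
    by rewrite ler_wpM2l.
  have e : c4 * (x ^+ 4 * r ^+ 4) = 4 * x ^+ 4 / lambda0.
    by rewrite /c4; field; rewrite !gt_eqF// ?exprn_gt0.
  have e2 : x ^+ 2 <= lambda0 / 2 + x ^+ 4 / (2 * lambda0).
    have -> : lambda0 / 2 + x ^+ 4 / (2 * lambda0) = (lambda0 ^+ 2 + (x ^+ 2) ^+ 2) / (2 * lambda0).
      by field; rewrite gt_eqF.
    by rewrite ler_pdivlMr ?mulr_gt0//; exact: amgm.
  apply: le_trans e2 _; rewrite lerD2l.
  have -> : x ^+ 4 / (2 * lambda0) = 8^-1 * (4 * x ^+ 4 / lambda0) by field; rewrite gt_eqF.
  by rewrite -e; exact: eighth_le.
have IgZ k q (o : obs n) : intg P (fun w => g k w * Z t q o w).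
  by apply: intg_bndM (g1 k) (IZ _ _); exact: smeasW ids_gensM (mg k).
have ID : intg P \1_D by exact: integrable_indic.
have sumg : \sum_k (n k)%:R * E (g k) = fine (P D).
  rewrite -expect_indic//.
  under eq_bigr do rewrite -expectZ//; rewrite -expect_sum => [|k _]; last exact: intgZ.
  apply: expect_ext => w.
  transitivity (\1_D w * \sum_k (n k)%:R * wgt n (hw w) u0 (ids U w) k); last first.
    by rewrite wgt_sum mulr1.
  by rewrite mulr_sumr; apply: eq_bigr => k _; rewrite mulrCA.
have key : lambda0 * fine (P D) <= lambda0 / 2 * fine (P D)
    + c4 * ((Mr + 1) + (M0 + 1)) * fine (P D).
  rewrite -expect_indic// mulrC -expectZr// [X in _ <= X + _]mulrC -[X in _ <= X + _]expectZr//.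
  have Isum : intg P (fun w => c4 * \sum_k \sum_(i < n k) (g k w * Z t r (obs1 i) w + g k w * Z t 0 (obs1 i) w)).
    by apply: intgZ; apply: intg_sum => k _; apply: intg_sum => j _; exact: intgD.
  have IDc c : intg P (fun w => \1_D w * c).
    by apply: intg_indicM => //; exact: intg_cst.
  apply: le_trans (expect_ae_le _ _ pt) _; [exact: IDc|exact: intgD|].
  rewrite expectD// lerD2l expectZ; last first.
    by apply: intg_sum => k _; apply: intg_sum => j _; exact: intgD.
  rewrite -mulrA ler_wpM2l// expect_sum; last by move=> k _; apply: intg_sum => j _; exact: intgD.
  rewrite expect_indic// -sumg mulr_sumr; apply: ler_sum => k _.
  rewrite expect_sum; last by move=> j _; exact: intgD.
  rewrite mulrCA nE mulr_suml; apply: ler_sum => j _.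
  rewrite mul1r expectD// mulrDl; apply: lerD; apply: bndm => y Uy yd.
    by case: (Hdl y Uy yd).
  by case: (Hdl y Uy yd).
have key1 : lambda0 <= lambda0 / 2 + c4 * ((Mr + 1) + (M0 + 1)).
  by rewrite -(ler_pM2r PD) mulrDl.
have key2 : lambda0 ^+ 2 / 2 <= 4 / r ^+ 4 * (Mr + M0 + 2).
  have -> : 4 / r ^+ 4 * (Mr + M0 + 2) = lambda0 * (c4 * ((Mr + 1) + (M0 + 1))).
    by rewrite /c4; field; rewrite !gt_eqF// exprn_gt0.
  have -> : lambda0 ^+ 2 / 2 = lambda0 * (lambda0 / 2) by ring.
  by rewrite ler_pM2l//; exact: half_le.
have key3 : 4 / r ^+ 4 * (Mr + M0 + 2) <= 32 * mu2 + (36 * M0 + 8) / r ^+ 4.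
  have -> : 32 * mu2 + (36 * M0 + 8) / r ^+ 4 = 4 / r ^+ 4 * (8 * (r ^+ 4 * mu2 + M0) + M0 + 2).
    by field; rewrite gt_eqF// exprn_gt0.
  by rewrite ler_wpM2l ?divr_ge0 ?exprn_ge0 ?(ltW r0)// !lerD2r.
exact: lower_final key2 key3 rlam.
Qed.

End FourthMoment.

(** * Affine functions of the noise *)

Section Clamp.
Context {R : realType} {d : measure_display} {Omega : measurableType d}.
Variable P : probability Omega R.
Let E := expect P.

Definition clamp (c : R) (x : R) : R := Num.max 0 (Num.min x c).

Lemma clamp_bnd c x : 0 <= c -> 0 <= clamp c x <= c.
Proof. by move=> c0; rewrite /clamp le_max lexx/= ge_max c0 ge_min lexx orbT. Qed.

(** The bounds 0 <= E [Z | S] <= c hold almost surely only.  Testing them on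
    {c <= V} and on {V <= 0} shows that V leaves [0, c] on null sets, so clamping
    does not change its integrals. *)
Lemma expect_clamp (S : set (set Omega)) (Z V : Omega -> R) c :
  S `<=` measurable -> 0 <= c -> intg P Z -> intg P V -> smeas S V -> (forall w, 0 <= Z w) ->
  (forall D, <<s S >> D -> E (fun w => \1_D w * Z w) = E (fun w => \1_D w * V w)) ->
  (forall D, <<s S >> D -> E (fun w => \1_D w * Z w) <= c * E \1_D) ->
  forall D, <<s S >> D ->
    E (fun w => \1_D w * Z w) = E (fun w => \1_D w * clamp c (V w)).
Proof.
move=> SM c0 IZ IV mV Z0 HV Hc D sD; have mD := gen_measurable SM sD.
have mVT := smeasW SM mV.
have mcl : measurable_fun setT (fun w => clamp c (V w)).
  apply: measurable_maxr; first exact: measurable_cst.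
  by apply: measurable_minr => //; exact: measurable_cst.
have Icl : intg P (fun w => clamp c (V w)).
  by apply: (@intg_bnd _ _ _ P _ c) => // w; have /andP[? ?] := clamp_bnd (V w) c0; rewrite ger0_norm.
pose B := [set w | c <= V w]; pose B' := [set w | V w <= 0].
have sB : <<s S >> B.
  have := @measurable_fun_ler _ (g_sigma_algebraType S) R setT (cst c) V (measurable_cst _) mV measurableT [set true] I.
  by rewrite setTI.
have sB' : <<s S >> B'.
  have := @measurable_fun_ler _ (g_sigma_algebraType S) R setT V (cst 0) mV (measurable_cst _) measurableT [set true] I.
  by rewrite setTI.
have mB := gen_measurable SM sB; have mB' := gen_measurable SM sB'.
have IVc : intg P (fun w => V w - c) by apply: intgB => //; exact: intg_cst.
have E1 : E (fun w => \1_B w * (V w - c)) <= 0.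
  rewrite /E expect_indicB//; last exact: intg_cst.
  rewrite -/E -HV// subr_le0 /E expectZr; last exact: integrable_indic.
  by rewrite [leRHS]mulrC; exact: Hc.
have E2 : 0 <= E (fun w => \1_B' w * V w).
  by rewrite -HV//; apply: expect_ge0 => w; rewrite mulr_ge0.
apply/eqP; rewrite HV// eq_le; apply/andP; split.
  rewrite -subr_le0 /E -expect_indicB//; apply: le_trans E1.
  apply: expect_le; [apply: intg_indicM => //; exact: intgB|exact: intg_indicM|] => w.
  rewrite /clamp !indicE.
  have [Bw|Bw] := leP c (V w); last first.
    rewrite [w \in B]memNset ?mul0r; last by rewrite /B/= leNgt Bw.
    by case: (w \in D); rewrite ?mul0r// mul1r subr_le0 le_max lexx orbT.
  rewrite [w \in B]mem_set// mul1r max_r//.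
  by case: (w \in D); rewrite ?mul1r ?mul0r// subr_ge0.
rewrite -subr_ge0 /E -expect_indicB//; apply: (le_trans E2).
apply: expect_le; [exact: intg_indicM|apply: intg_indicM => //; exact: intgB|] => w.
rewrite /clamp !indicE.
have [Bw|Bw] := leP (V w) 0; last first.
  rewrite [w \in B']memNset ?mul0r; last by rewrite /B'/= leNgt Bw.
  by rewrite mulr_ge0// subr_ge0 ge_max (ltW Bw) ge_min lexx.
rewrite [w \in B']mem_set// mul1r min_l; last exact: le_trans Bw c0.
by rewrite max_l// subr0; case: (w \in D); rewrite ?mul1r ?mul0r.
Qed.

End Clamp.

Section NoiseMoments.
Context {R : realType} {d : measure_display} {Omega : measurableType d}.
Variable P : probability Omega R.
Let E := expect P.
Context {I : finType}.
Variables (Sde : set (set Omega)) (eps v : I -> Omega -> R) (cv : R).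
Hypothesis SdeM : Sde `<=` measurable.
Hypothesis meps : forall o, measurable_fun setT (eps o).
Hypothesis Ieps2 : forall o, intg P (fun w => eps o w ^+ 2).
Hypothesis mv : forall o, measurable_fun setT (v o).
Hypothesis v01 : forall o w, 0 <= v o w <= cv.
Hypothesis nm : forall (g : Omega -> R) (c : R) o, smeas Sde g -> (forall w, `|g w| <= c) ->
  E (fun w => g w * eps o w) = 0.
Hypothesis nv : forall (g : Omega -> R) (c : R) o, smeas Sde g -> (forall w, `|g w| <= c) ->
  E (fun w => g w * eps o w ^+ 2) = E (fun w => g w * v o w).
Hypothesis nc : forall (g : Omega -> R) (c : R) o o', o != o' -> smeas Sde g -> (forall w, `|g w| <= c) ->
  E (fun w => g w * (eps o w * eps o' w)) = 0.

(** Bounded functions of the data behind the sigma-algebra: the coefficients by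
    which the noise may be multiplied. *)
Definition badapted (g : Omega -> R) : Prop :=
  smeas Sde g /\ exists c : R, forall w, `|g w| <= c.

Lemma badaptedM f g : badapted f -> badapted g -> badapted (fun w => f w * g w).
Proof.
move=> [mf [a fa]] [mg [b gb]]; split; first exact: measurable_funM.
exists (`|a| * `|b|) => w; rewrite normrM; apply: ler_pM => //.
  exact: le_trans (fa w) (ler_norm _).
exact: le_trans (gb w) (ler_norm _).
Qed.

Lemma badaptedD f g : badapted f -> badapted g -> badapted (fun w => f w + g w).
Proof.
move=> [mf [a fa]] [mg [b gb]]; split; first exact: measurable_funD.
by exists (a + b) => w; apply: le_trans (ler_normD _ _) _; exact: lerD.
Qed.

Lemma badapted_cst c : badapted (fun=> c).
Proof. by split; [exact: measurable_cst|exists `|c|]. Qed.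

Lemma badapted_sum (J : finType) (f : J -> Omega -> R) :
  (forall j, badapted (f j)) -> badapted (fun w => \sum_j f j w).
Proof.
move=> Hf; split; first by apply: measurable_sum => j; case: (Hf j).
have Hc j : exists c : R, forall w, `|f j w| <= c by case: (Hf j).
exists (\sum_j sval (cid (Hc j))) => w; apply: le_trans (ler_norm_sum _ _ _) _.
by apply: ler_sum => j _; case: (cid (Hc j)) => c /=.
Qed.

Lemma badapted_measurable g : badapted g -> measurable_fun setT g.
Proof. by move=> [mg _]; exact: smeasW mg. Qed.

Lemma badapted_intg g : badapted g -> intg P g.
Proof. by move=> bg; case: (bg) => _ [c gc]; apply: intg_bnd gc; exact: badapted_measurable. Qed.

Lemma badapted_intgM g f : badapted g -> intg P f -> intg P (fun w => g w * f w).
Proof. by move=> bg; case: (bg) => _ [c gc]; apply: intg_bndM gc; exact: badapted_measurable. Qed.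

Let Ieps o : intg P (eps o). Proof. exact: intg_sqr1. Qed.

Let Iee o o' : intg P (fun w => eps o w * eps o' w).
Proof. exact: intg_sqrM. Qed.

Let Iv o : intg P (v o).
Proof.
by apply: (@intg_bnd _ _ _ P _ cv) => // w; have /andP[? ?] := v01 o w; rewrite ger0_norm.
Qed.

(** In expectation the terms linear in the noise and the products of distinct
    noise variables vanish, and each square becomes its conditional variance. *)
Lemma noise_bilinear (b b' : Omega -> R) (c c' : I -> Omega -> R) :
  badapted b -> badapted b' -> (forall o, badapted (c o)) -> (forall o, badapted (c' o)) ->
  let F w := (b w + \sum_o c o w * eps o w) * (b' w + \sum_o c' o w * eps o w) in
  let G w := b w * b' w + \sum_o c o w * c' o w * v o w in
  [/\ intg P F, intg P G & E F = E G].
Proof.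
move=> Bb Bb' Bc Bc' F G.
have FE : F = fun w => b w * b' w + (\sum_o (b w * c' o w + b' w * c o w) * eps o w +
    \sum_o \sum_o' (c o w * c' o' w) * (eps o w * eps o' w)).
  apply/funext => w; rewrite /F mulrDl !mulrDr -!addrA; congr (_ + _).
  rewrite addrA; congr (_ + _).
    rewrite mulr_sumr mulr_suml -big_split/=; apply: eq_bigr => o _; ring.
  rewrite mulr_suml; apply: eq_bigr => o _; rewrite mulr_sumr.
  by apply: eq_bigr => o' _; ring.
have B1 o : badapted (fun w => b w * c' o w + b' w * c o w).
  by apply: badaptedD; exact: badaptedM.
have B2 o o' : badapted (fun w => c o w * c' o' w) by exact: badaptedM.
have I0 : intg P (fun w => b w * b' w) by apply: badapted_intg; exact: badaptedM.
have I1 : intg P (fun w => \sum_o (b w * c' o w + b' w * c o w) * eps o w).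
  by apply: intg_sum => o _; exact: badapted_intgM.
have I2 o : intg P (fun w => \sum_o' (c o w * c' o' w) * (eps o w * eps o' w)).
  by apply: intg_sum => o' _; exact: badapted_intgM.
have I3 : intg P (fun w => \sum_o \sum_o' (c o w * c' o' w) * (eps o w * eps o' w)).
  by apply: intg_sum => o _.
have I4 : intg P (fun w => \sum_o c o w * c' o w * v o w).
  by apply: intg_sum => o _; exact: badapted_intgM.
split.
- by rewrite FE; apply: intgD => //; exact: intgD.
- exact: intgD.
rewrite FE /G /E expectD//; last exact: intgD.
rewrite (expectD I1 I3) [RHS]expectD//; congr (_ + _).
rewrite expect_sum; last by move=> o _; exact: badapted_intgM.
rewrite big1 ?add0r => [|o _]; last by case: (B1 o) => m1 [a a1]; exact: nm m1 a1.
rewrite expect_sum// expect_sum; last by move=> o _; exact: badapted_intgM.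
apply: eq_bigr => o _; rewrite expect_sum; last by move=> o' _; exact: badapted_intgM.
rewrite (bigD1 o)//= big1 ?addr0 => [|o' oo'].
  by case: (B2 o o) => m1 [a a1]; rewrite -[RHS](nv o m1 a1); apply: expect_ext => w; rewrite expr2.
by case: (B2 o o') => m1 [a a1]; apply: nc m1 a1; rewrite eq_sym.
Qed.

End NoiseMoments.

Section Arith.
Context {R : realType}.

Lemma sqr_le_pow4 (x : R) : x ^+ 2 <= 2^-1 * (1 + `|x| ^+ 4).
Proof.
rewrite -(real_normK (num_real x)).
by have := sqr_ge0 (`|x| ^+ 2 - 1); move: (`|x|) => y; nra.
Qed.
Lemma clamp_arith (x y c : R) : y <= c * x -> 2^-1 * (x + y) <= 2^-1 * (1 + c) * x.
Proof. by nra. Qed.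
End Arith.

Section ModelNoise.
Context {R : realType} {p K : nat}.
Variables (u0 Cm : R) (Ucal : set R) (sigma2 m : R -> R).
Variable n : 'I_K.+1 -> nat.
Context {d : measure_display} {Omega : measurableType d}.
Variables (P : probability Omega R) (U : 'I_K.+1 -> Omega -> R).
Variables (X : obs n -> Omega -> 'rV[R]_p) (eps : obs n -> Omega -> R).
Hypothesis n00 : (0 < n ord0)%N.
Hypothesis Uu0 : Ucal u0.
Hypothesis Cm0 : 0 <= Cm.
Hypothesis mCm : forall u, Ucal u -> m u <= Cm.
Hypothesis mdata : measurable_data U X eps.
Hypothesis U00 : forall w, U ord0 w = u0.
Hypothesis U_supp : {ae P, forall w, forall k : 'I_K, Ucal (U (lift ord0 k) w)}.
Hypothesis Hn : noise P U X eps sigma2.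
Hypothesis fm0 : fourth_moment P U X eps (fun _ _ => 0) m.
Let E := expect P.

Definition ids_gens := genset U.

Let Zde (c : 'I_K.+1 + obs n * 'I_p) : Omega -> R :=
  match c with inl k => U k | inr oj => fun w => X oj.1 w 0 oj.2 end.

Definition design_gens := genset Zde.

Lemma ids_gensM : ids_gens `<=` measurable. Proof. by apply: genset_meas; case: mdata. Qed.

Lemma design_gensM : design_gens `<=` measurable.
Proof. by apply: genset_meas => -[k|[c j]] /=; case: mdata => mU mX _; [exact: mU|exact: mX]. Qed.

Lemma ids_design : ids_gens `<=` <<s design_gens >>.
Proof. by move=> D [k [B [mB ->]]]; apply: sub_sigma_algebra; exists (inl k), B. Qed.

(** Bounds the conditional noise variance: eps^2 <= (1 + eps^4) / 2, and eps is the
    response for zero coefficients, so its fourth moment is at most Cm. *)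
Definition noise_bound : R := 2^-1 * (1 + Cm).

(** The conditional variance of the noise, in a version that is bounded
    everywhere, whereas sigma2 is controlled only almost surely. *)
Definition cond_var (o : obs n) (w : Omega) : R := clamp noise_bound (sigma2 (U (dom o) w)).

Lemma noise_bound_ge0 : 0 <= noise_bound. Proof. by rewrite mulr_ge0// addr_ge0. Qed.

Lemma cond_var_bnd (o : obs n) w : 0 <= cond_var o w <= noise_bound.
Proof. exact/clamp_bnd/noise_bound_ge0. Qed.

Lemma U_Ucal_ae : {ae P, forall w, forall k, Ucal (U k w)}.
Proof.
apply: filterS U_supp => w H k; case: (unliftP ord0 k) => [j ->|->]; first exact: H.
by rewrite U00.
Qed.

Lemma sigma2_smeas (o : obs n) : smeas ids_gens (fun w => sigma2 (U (dom o) w)).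
Proof.
case: Hn => _ _ /(_ o)[_ _ mV _] _ Y mY; rewrite setTI; exact: mV.
Qed.

Lemma cond_var_smeas (o : obs n) : smeas ids_gens (cond_var o).
Proof.
apply: measurable_maxr; first exact: measurable_cst.
by apply: measurable_minr; [exact: sigma2_smeas|exact: measurable_cst].
Qed.

Lemma cond_var_meas (o : obs n) : measurable_fun setT (cond_var o).
Proof. exact: smeasW ids_gensM (cond_var_smeas o). Qed.

Lemma intg_cond_var (o : obs n) : intg P (cond_var o).
Proof.
by apply: (@intg_bnd _ _ _ P _ noise_bound); [exact: cond_var_meas|move=> w; have /andP[? ?] := cond_var_bnd o w; rewrite ger0_norm].
Qed.

Lemma intg_eps2 (o : obs n) : intg P (fun w => eps o w ^+ 2).
Proof. by case: Hn => _ _ /(_ o)[]. Qed.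

Lemma meps (o : obs n) : measurable_fun setT (eps o).
Proof. by case: mdata. Qed.

Lemma eps_pow4 (o : obs n) w : `|Yobs U X eps (fun _ _ => 0) o w| ^+ 4 = `|eps o w| ^+ 4.
Proof.
rewrite /Yobs (_ : \col_j 0 = 0) ?mulmx0 ?mxE ?add0r//.
by apply/matrixP => i j; rewrite !mxE.
Qed.

Lemma eps2_le (o : obs n) D : <<s ids_gens >> D ->
  E (fun w => \1_D w * eps o w ^+ 2) <= noise_bound * E \1_D.
Proof.
move=> sD; have mD := gen_measurable ids_gensM sD.
have [IZ IV _ _] := fm0 o.
have ID : intg P (\1_D : Omega -> R) by exact: integrable_indic.
have ID4 := intg_indicM mD IZ.
have I2 : intg P (fun w => 2^-1 * (\1_D w + \1_D w * `|Yobs U X eps (fun _ _ => 0) o w| ^+ 4)).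
  by apply: intgZ; exact: intgD.
apply: (@le_trans _ _ (2^-1 * (E \1_D + E (fun w => \1_D w * `|Yobs U X eps (fun _ _ => 0) o w| ^+ 4)))).
  rewrite /E -expectD// -expectZ; last exact: intgD.
  apply: expect_le => //; first by apply: intg_indicM => //; exact: intg_eps2.
  move=> w; rewrite eps_pow4 indicE.
  by case: (w \in D); rewrite ?mul1r ?sqr_le_pow4// !mul0r addr0 mulr0.
have -> : E (fun w => \1_D w * `|Yobs U X eps (fun _ _ => 0) o w| ^+ 4) =
    E (fun w => \1_D w * m (U (dom o) w)) by exact: cond_exp_set (fm0 o) sD.
apply: clamp_arith; rewrite /E -expectZ//.
apply: expect_ae_le; [exact: intg_indicM|exact: intgZ|].
apply: filterS U_Ucal_ae => w H; rewrite mulrC ler_wpM2r//; exact: mCm (H _).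
Qed.

Let eps1 (o : obs n) D : <<s ids_gens >> D -> E (fun w => \1_D w * eps o w) = 0.
Proof.
case: Hn => _ H _ sD.
by rewrite [LHS](cond_exp_set (H o) sD) -[RHS](expectM0 P \1_D).
Qed.

Let eps2 (o : obs n) D : <<s ids_gens >> D ->
  E (fun w => \1_D w * eps o w ^+ 2) = E (fun w => \1_D w * cond_var o w).
Proof.
case: Hn => _ _ /(_ o) H.
apply: (@expect_clamp _ _ _ P ids_gens) => //.
- exact: ids_gensM.
- exact: noise_bound_ge0.
- exact: intg_eps2.
- by case: H.
- exact: sigma2_smeas.
- by move=> w; exact: sqr_ge0.
- by move=> D' sD'; exact: cond_exp_set H sD'.
- by move=> D' sD'; exact: eps2_le.
Qed.

Let Hind : noise_cond_indep P <<s design_gens >> (fun o : obs n => U (dom o)) eps.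
Proof. by case: Hn. Qed.

Let mV (o : obs n) : smeas ids_gens (U (dom o)).
Proof. exact: genset_smeas. Qed.

Lemma model_mean (g : Omega -> R) (c : R) o : smeas design_gens g -> (forall w, `|g w| <= c) ->
  E (fun w => g w * eps o w) = 0.
Proof.
exact: (@noise_mean _ _ _ P _ ids_gens design_gens (fun o : obs n => U (dom o)) eps design_gensM ids_design mV meps Hind intg_eps2 eps1).
Qed.

Lemma model_var (g : Omega -> R) (c : R) o : smeas design_gens g -> (forall w, `|g w| <= c) ->
  E (fun w => g w * eps o w ^+ 2) = E (fun w => g w * cond_var o w).
Proof.
exact: (@noise_var _ _ _ P _ ids_gens design_gens (fun o : obs n => U (dom o)) eps design_gensM ids_design mV meps Hind intg_eps2 cond_var cond_var_smeas intg_cond_var eps2).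
Qed.

Lemma model_cov (g : Omega -> R) (c : R) o o' : o != o' -> smeas design_gens g -> (forall w, `|g w| <= c) ->
  E (fun w => g w * (eps o w * eps o' w)) = 0.
Proof.
exact: (@noise_cov _ _ _ P _ ids_gens design_gens (fun o : obs n => U (dom o)) eps design_gensM ids_design mV meps Hind intg_eps2 eps1).
Qed.

Lemma sigma2_target : 0 <= sigma2 u0 <= noise_bound.
Proof.
pose o := obs2 (Ordinal n00).
have <- : E (fun w => eps o w ^+ 2) = sigma2 u0.
  case: Hn => _ _ /(_ o) H; rewrite [LHS](cond_exp_mean H) -[RHS](expect_cst P).
  by apply: expect_ext => w; rewrite /o/= U00.
have e : E (fun w => \1_setT w * eps o w ^+ 2) = E (fun w => eps o w ^+ 2).
  by apply: expect_ext => w; rewrite indicT mul1r.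
apply/andP; split; first by apply: expect_ge0 => w; exact: sqr_ge0.
rewrite -e; apply: le_trans (eps2_le _ _) _.
  exact: (@measurableT _ (g_sigma_algebraType ids_gens)).
rewrite -[leRHS]mulr1 ler_wpM2l ?noise_bound_ge0//.
rewrite /E expect_indic//.
by rewrite probability_setT.
Qed.

Lemma cond_var_target i w : cond_var (obs2 i) w = sigma2 u0.
Proof.
rewrite /cond_var/= U00 /clamp; have /andP[h1 h2] := sigma2_target.
by rewrite min_l// max_r.
Qed.

Definition model_bilinear := @noise_bilinear _ _ _ P _ design_gens eps cond_var noise_bound design_gensM meps intg_eps2 cond_var_meas cond_var_bnd model_mean model_var model_cov.

End ModelNoise.

(** * Bias and noise of the DVCM estimator *)

Section HoelderMeas.
Context {R : realType}.

Lemma hoelder_continuous (beta L : R) (g : R -> R) :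
  0 < beta -> 0 <= L -> hoelder beta L g -> continuous g.
Proof.
move=> b0 L0 [dg Hg] u.
case l0 : (Num.truncn beta) dg Hg => [|l] dg Hg; last first.
  exact/differentiable_continuous/derivable1_diffP/(dg 0%N).
apply/cvgrPdist_lt => e e0; have L1 : 0 < L + 1 by rewrite ltr_pwDr.
have d0 : 0 < (e / (L + 1)) `^ beta^-1 by apply: powR_gt0; exact: divr_gt0.
near=> v.
have uv : `|u - v| < (e / (L + 1)) `^ beta^-1 by near: v; exact: cvgr_dist_lt.
have := Hg u v; rewrite /= subr0 => /le_lt_trans; apply.
have p1 : `|u - v| `^ beta <= e / (L + 1).
  have -> : e / (L + 1) = ((e / (L + 1)) `^ beta^-1) `^ beta.
    by rewrite -powRrM mulVf ?gt_eqF// powRr1// ltW// divr_gt0.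
  by rewrite ge0_ler_powR ?nnegrE ?(ltW b0) ?(ltW d0)// ltW.
apply: (@le_lt_trans _ _ (L * (e / (L + 1)))); first by rewrite ler_wpM2l.
by rewrite mulrA ltr_pdivrMr// mulrC ltr_pM2l// ltrDl.
Unshelve. all: by end_near. Qed.

Lemma measurable_hoelder (beta L : R) (g : R -> R) :
  0 < beta -> 0 <= L -> hoelder beta L g -> measurable_fun setT g.
Proof. by move=> b0 L0 Hg; apply: continuous_measurable_fun; exact: hoelder_continuous Hg. Qed.

Lemma measurable_poly (q : {poly R}) : measurable_fun setT (horner q).
Proof. by apply: continuous_measurable_fun; exact: continuous_horner. Qed.

End HoelderMeas.

Section SumObs.
Context {R : realType} {K : nat}.
Variable n : 'I_K.+1 -> nat.
Lemma sum_obs (F : obs n -> R) :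
  \sum_o F o = \sum_k \sum_(i < n k) F (obs1 i) + \sum_i F (obs2 i).
Proof.
rewrite big_sumType/=; congr (_ + _).
by rewrite (@sig_big_dep _ _ _ _ (fun k => 'I_(n k)) xpredT (fun _ _ => true) (fun k i => F (obs1 i)))/=; apply: eq_bigr => -[k i].
Qed.
End SumObs.

Section Arith.
Context {R : realType}.

Lemma sqr_bound (x y : R) : x ^+ 2 <= y -> `|x| <= 1 + y.
Proof. by rewrite -(real_normK (num_real x)); have := normr_ge0 x; nra. Qed.
Lemma bias_arith (a N l c : R) : 1 <= N -> 0 < l -> 0 <= c ->
  a <= (N * l)^-1 * (N * c) -> a <= c / l.
Proof.
move=> N1 l0 c0 /le_trans; apply; rewrite le_eqVlt; apply/orP; left; apply/eqP.
by field; rewrite !gt_eqF// (lt_le_trans ltr01).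
Qed.
End Arith.

Section DvcmDecomp.
Context {R : realType} {p K : nat}.
Variables (beta L lambda0 e0 u0 gamma hmax : R).
Variable n : 'I_K.+1 -> nat.
Context {d : measure_display} {Omega : measurableType d}.
Variables (P : probability Omega R) (U : 'I_K.+1 -> Omega -> R).
Variables (X : obs n -> Omega -> 'rV[R]_p) (eps : obs n -> Omega -> R).
Variable theta : 'I_p -> R -> R.
Let hw w := bandwidth n beta e0 gamma u0 (ids U w).
Let Nw w := window_count n (hw w) u0 (ids U w).
Let l := Num.truncn beta.
Hypothesis beta0 : 0 < beta.
Hypothesis L0 : 0 <= L.
Hypothesis lam0 : 0 < lambda0.
Hypothesis K0 : (0 < K)%N.
Hypothesis n00 : (0 < n ord0)%N.
Hypothesis hm0 : 0 <= hmax.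
Hypothesis mdata : measurable_data U X eps.
Hypothesis U00 : forall w, U ord0 w = u0.
Hypothesis hpos : {ae P, forall w, 0 < hw w}.
Hypothesis hle : {ae P, forall w, hw w <= hmax}.
Hypothesis Xbnd : bounded_covariates P X.
Hypothesis design : design_cond P U X beta e0 gamma u0 lambda0.
Hypothesis th_class : hoelder_class beta L theta.

Let Zf (c : 'I_K.+1 + {k : 'I_K.+1 & 'I_(n k)} * 'I_p) : Omega -> R :=
  match c with inl k => U k | inr tj => fun w => X (inl tj.1) w 0 tj.2 end.

Definition fst_gens := genset Zf.

Lemma fst_gensM : fst_gens `<=` measurable.
Proof. by apply: genset_meas => -[k|[t j]] /=; case: mdata => mU mX _; [exact: mU|exact: mX]. Qed.

Lemma ids_fst : ids_gens U `<=` <<s fst_gens >>.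
Proof. by move=> D [k [B [mB ->]]]; apply: sub_sigma_algebra; exists (inl k), B. Qed.

Lemma fst_design : fst_gens `<=` <<s design_gens U X >>.
Proof.
move=> D [[k|[t j]] [B [mB ->]]]; apply: sub_sigma_algebra; first by exists (inl k), B.
by exists (inr (inl t, j)), B.
Qed.

Let U_gf k : smeas fst_gens (U k). Proof. exact: (@genset_smeas _ _ _ _ Zf (inl k)). Qed.

Let X_gf k (i : 'I_(n k)) j : smeas fst_gens (fun w => X (obs1 i) w 0 j).
Proof. exact: (@genset_smeas _ _ _ _ Zf (inr (Tagged (fun k => 'I_(n k)) i, j))). Qed.

Let Xk_gf k : @mxmeas _ _ (g_sigma_algebraType fst_gens) _ _ (fun w => Xfst X w k).
Proof. by move=> i j; under eq_fun do rewrite mxE; exact: X_gf. Qed.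

Let hw_gf : smeas fst_gens hw. Proof. exact: measurable_bandwidth. Qed.

Let Nw_gf : smeas fst_gens Nw.
Proof.
apply: measurable_sum => k; apply: measurable_funM; first exact: measurable_cst.
by apply: measurable_le_bool => //; exact: measurable_dist.
Qed.

Let hw_ge0 w : 0 <= hw w. Proof. exact: bandwidth_ge0. Qed.
Let Nw1 w : 1 <= Nw w. Proof. exact: window_count_ge1. Qed.

Let blk w k := dvcm_blk l (hw w) u0 (ids U w) (Xfst X w) k.

Let blk_gf k : @mxmeas _ _ (g_sigma_algebraType fst_gens) _ _ (fun w => blk w k).
Proof. exact: mxmeas_dvcm_blk. Qed.

Let rem k w : 'cV[R]_p := \col_j (theta j (U k w) - (taylor_poly l (theta j) u0).[U k w]).

Let rem_gf k : @mxmeas _ _ (g_sigma_algebraType fst_gens) _ _ (rem k).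
Proof.
move=> i j; under eq_fun do rewrite mxE; apply: measurable_funB.
  exact: (measurableT_comp (measurable_hoelder beta0 L0 (th_class i)) (U_gf k)).
exact: (measurableT_comp (measurable_poly _) (U_gf k)).
Qed.

Let HH j (o : obs n) w : R :=
  match o with inl t => blk w (tag t) j (tagged t) | inr _ => 0 end.

Let rr (o : obs n) w : R := (X o w *m rem (dom o) w) 0 0.

Let bb j w := \sum_o HH j o w * rr o w.

Let HH_gf j o : smeas fst_gens (HH j o).
Proof. by case: o => [t|i] /=; [exact: blk_gf|exact: measurable_cst]. Qed.

Let bb_gf j : smeas fst_gens (bb j).
Proof.
have -> : bb j = fun w => \sum_k \sum_(i < n k) HH j (obs1 i) w * rr (obs1 i) w.
  apply/funext => w; rewrite /bb sum_obs [X in _ + X]big1 ?addr0// => i _; exact: mul0r.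
apply: measurable_sum => k; apply: measurable_sum => i; apply: measurable_funM; first exact: HH_gf.
apply: mxmeasM; last exact: rem_gf.
by move=> a b; rewrite (ord1 a); exact: X_gf.
Qed.

(** Bound on the squared norm of each row of H. *)
Definition var_bound w : R := (Nw w * lambda0)^-1.

(** Bound on the squared bias given the design. *)
Definition bias_bound w : R := p%:R * L ^+ 2 * hw w `^ (2 * beta) / lambda0.

(** Of the N observations in the window, each has a squared remainder of at most
    p L^2 h^(2 beta); in Cauchy-Schwarz this N cancels the 1/N of the rows of
    H. *)
Lemma dvcm_err_decomp : {ae P, forall w, forall j,
  [/\ (theta_dvcm U X eps beta e0 gamma u0 theta w - \col_j theta j u0) j 0 =
      bb j w + \sum_o HH j o w * eps o w,
      \sum_o HH j o w ^+ 2 <= var_bound w & bb j w ^+ 2 <= bias_bound w]}.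
Proof.
have Xa : {ae P, forall w, forall o, norm2 (X o w)^T <= 1}.
  by apply: filter_forall => o; exact: Xbnd.
apply: filterS3 hpos design Xa => w h0 [Gu op] X1 j.
have sH : \sum_o HH j o w ^+ 2 <= var_bound w.
  rewrite sum_obs [X in _ + X]big1 ?addr0 => [|i _]; last by rewrite /= expr0n.
  apply: dvcm_blk_sqr => //; exact: lt_le_trans ltr01 (Nw1 w).
split => //.
  have yE : yfst U X eps theta w =
      fun k => Xfst X w k *m \col_j theta j (ids U w k) + \col_i eps (obs1 i) w.
    apply: functional_extensionality_dep => k; apply/colP => i.
    rewrite !mxE /Yobs; congr (_ + _); rewrite !mxE.
    by apply: eq_bigr => a _; rewrite !mxE.
  rewrite /theta_dvcm yE (dvcm_err h0 Gu) summxE /bb -big_split sum_obs.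
  rewrite [X in _ = _ + X]big1 ?addr0 => [|i _]; last by rewrite /= !mul0r addr0.
  apply: eq_bigr => k _; rewrite mxE; apply: eq_bigr => i _; rewrite /= -mulrDr.
  congr (_ * _); rewrite !mxE; congr (_ + _); rewrite /rr !mxE.
  by apply: eq_bigr => a _; rewrite !mxE.
apply: (@bias_arith _ _ (Nw w) lambda0) => //.
  by rewrite !mulr_ge0// ?sqr_ge0 ?powR_ge0.
(* The factor nd costs nothing, since the rows of H vanish outside the window,
   but it limits the remainders to the window. *)
pose nd (o : obs n) : R := match o with
  inl t => (near_id (hw w) u0 (ids U w) (tag t))%:R | inr _ => 0 end.
have -> : bb j w = \sum_o HH j o w * (nd o * rr o w).
  rewrite /bb; apply: eq_bigr => -[t|i] _; last by rewrite !mul0r.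
  rewrite mulrA; congr (_ * _); rewrite /HH /=.
  case nk : (near_id _ _ _ _); rewrite ?mulr1// mulr0.
  by rewrite /blk dvcm_blk_far// mxE.
apply: le_trans (cauchy_schwarz _ _) _.
apply: ler_pM => //; try by apply: sumr_ge0 => o _; exact: sqr_ge0.
rewrite sum_obs [X in _ + X]big1 ?addr0 => [|i _]; last by rewrite /= mul0r expr0n.
rewrite /Nw /window_count mulr_suml; apply: ler_sum => k _.
rewrite -[leRHS]mulrA mulr_natl -[X in _ *+ X](card_ord (n k)) -sumr_const; apply: ler_sum => i _.
rewrite /= exprMn; case nk : (near_id _ _ _ _); last by rewrite expr0n/= !mul0r.
rewrite expr1n !mul1r.
have -> : rr (obs1 i) w = dot (X (obs1 i) w)^T (rem k w) by rewrite dotE trmxK.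
apply: le_trans (dot_le _ _) _; rewrite -[leRHS]mul1r; apply: ler_pM; rewrite ?sqn_ge0//.
  by move: (X1 (obs1 i)); rewrite norm2E -{1}sqrtr1 ler_psqrt// nnegrE ?sqn_ge0.
rewrite sqn_sum; apply: (@le_trans _ _ (\sum_(a < p) L ^+ 2 * hw w `^ (2 * beta))); last first.
  by rewrite -[leRHS]mulrA [leRHS]mulr_natl sumr_const card_ord.
apply: ler_sum => a _; rewrite mxE -(real_normK (num_real (_ - _))).
have hT := hoelder_taylor u0 beta0 L0 (th_class a) (U k w).
have h2 : hw w `^ (2 * beta) = (hw w `^ beta) ^+ 2.
  by rewrite mulrC powRrM -powR_mulrn ?powR_ge0.
rewrite h2 -exprMn; apply: lerXn2r; rewrite ?nnegrE ?mulr_ge0 ?powR_ge0//.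
apply: le_trans hT _; rewrite ler_wpM2l// ge0_ler_powR ?nnegrE ?(ltW beta0)//.
Qed.

Let gd j w : R := (\sum_o HH j o w ^+ 2 <= var_bound w)%R%:R * ((bb j w ^+ 2 <= bias_bound w)%R%:R * (hw w <= hmax)%R%:R).

Let varb_gf : smeas fst_gens var_bound.
Proof. by apply: measurable_invr; apply: measurable_funM => //; exact: measurable_cst. Qed.

Let biasb_gf : smeas fst_gens bias_bound.
Proof.
apply: measurable_funM; last exact: measurable_cst.
apply: measurable_funM; first exact: measurable_cst.
exact: (measurableT_comp (measurable_powR (2 * beta)) hw_gf).
Qed.

Let gd_gf j : smeas fst_gens (gd j).
Proof.
apply: measurable_funM; [|apply: measurable_funM]; apply: measurable_le_bool => //.
- by apply: measurable_sum => o; apply: measurable_funX; exact: HH_gf.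
- by apply: measurable_funX; exact: bb_gf.
Qed.

Lemma var_bound_ge0 w : 0 <= var_bound w.
Proof. by rewrite invr_ge0 mulr_ge0// ?ltW// (lt_le_trans ltr01 (Nw1 w)). Qed.

Lemma var_bound_le w : var_bound w <= lambda0^-1.
Proof.
have N0 := lt_le_trans ltr01 (Nw1 w).
rewrite /var_bound lef_pV2 ?posrE ?mulr_gt0//.
by rewrite ler_peMl// ltW.
Qed.

Lemma bias_bound_ge0 w : 0 <= bias_bound w.
Proof. by rewrite !mulr_ge0// ?sqr_ge0 ?powR_ge0// invr_ge0 ltW. Qed.

Definition bias_max : R := p%:R * L ^+ 2 * hmax `^ (2 * beta) / lambda0.

Lemma bias_bound_le w : hw w <= hmax -> bias_bound w <= bias_max.
Proof.
move=> hh; rewrite /bias_bound /bias_max ler_wpM2r// ?invr_ge0 ?(ltW lam0)//.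
rewrite ler_wpM2l ?mulr_ge0 ?sqr_ge0// ge0_ler_powR ?nnegrE//.
by rewrite mulr_ge0// ltW.
Qed.

Lemma bias_max_ge0 : 0 <= bias_max.
Proof. by rewrite !mulr_ge0// ?sqr_ge0 ?powR_ge0// invr_ge0 ltW. Qed.

(** The bounds of [dvcm_err_decomp] hold almost surely.  Multiplying by the
    indicator of the event where they hold makes the coefficients bounded
    everywhere, hence admissible for [noise_bilinear], and changes the error on
    a null set only. *)
Lemma dvcm_decomp : exists (bt : 'I_p -> Omega -> R) (Ht : 'I_p -> obs n -> Omega -> R),
  [/\ forall j, badapted fst_gens (bt j), forall j o, badapted fst_gens (Ht j o),
      forall j i w, Ht j (obs2 i) w = 0,
      forall j w, [/\ \sum_o Ht j o w ^+ 2 <= var_bound w, bt j w ^+ 2 <= bias_bound w & bt j w ^+ 2 <= bias_max] &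
      {ae P, forall w, forall j,
        (theta_dvcm U X eps beta e0 gamma u0 theta w - \col_j theta j u0) j 0 =
          bt j w + \sum_o Ht j o w * eps o w}].
Proof.
have bnd j w : [/\ \sum_o (gd j w * HH j o w) ^+ 2 <= var_bound w,
    (gd j w * bb j w) ^+ 2 <= bias_bound w & (gd j w * bb j w) ^+ 2 <= bias_max].
  have z : \sum_(o : obs n) (0 * HH j o w) ^+ 2 = 0.
    by rewrite big1// => o _; rewrite mul0r expr0n.
  case g : [&& \sum_o HH j o w ^+ 2 <= var_bound w, bb j w ^+ 2 <= bias_bound w & hw w <= hmax].
    have -> : gd j w = 1 by rewrite /gd; case/and3P: g => -> -> ->; rewrite !mulr1.
    case/and3P: g => h1 h2 h3; rewrite !mul1r; split => //; last exact: le_trans h2 (bias_bound_le h3).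
    by under eq_bigr do rewrite mul1r.
  have -> : gd j w = 0 by rewrite /gd -!natrM !mulnb g.
  by rewrite z mul0r expr0n var_bound_ge0 bias_bound_ge0 bias_max_ge0.
exists (fun j w => gd j w * bb j w), (fun j o w => gd j w * HH j o w); split => //.
- move=> j; split; first by apply: measurable_funM; [exact: gd_gf|exact: bb_gf].
  by exists (1 + bias_max) => w; apply: sqr_bound; case: (bnd j w).
- move=> j o; split; first by apply: measurable_funM; [exact: gd_gf|exact: HH_gf].
  exists (1 + lambda0^-1) => w; apply: sqr_bound; apply: le_trans (var_bound_le w).
  case: (bnd j w) => h _ _; apply: le_trans h; rewrite (bigD1 o)//= lerDl.
  by apply: sumr_ge0 => o' _; exact: sqr_ge0.
- by move=> j i w; rewrite /= mulr0.
- apply: filterS2 dvcm_err_decomp hle => w H h3 j; have [-> h1 h2] := H j.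
  rewrite /gd h1 h2 h3 !mul1r; congr (_ + _); apply: eq_bigr => o _; by rewrite mul1r.
Qed.

Lemma var_boundE w : var_bound w = lambda0^-1 * (Nw w)^-1.
Proof. by rewrite /var_bound invfM mulrC. Qed.

End DvcmDecomp.

(** * Algebra of the transfer estimator *)

Section Inverse.
Context {R : realType} {p : nat}.
Implicit Types A M Q : 'M[R]_p.

Lemma posdef_ge0 A : posdef A -> forall x, 0 <= quad A x.
Proof.
move=> [_ A0] x; have [->|x0] := eqVneq x 0; last exact/ltW/A0.
by rewrite quadE mulmx0 /dot big1// => i _; rewrite mxE mul0r.
Qed.

Lemma quad_invmx A x : A \in unitmx -> quad (invmx A) x = quad A (invmx A *m x).
Proof.
by move=> Au; rewrite [RHS]quadE mulmxA mulmxV// mul1mx dotC -quadE.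
Qed.

(** Test the form on e_i + e_j and e_i - e_j. *)
Lemma psd_entry A i j : A^T = A -> (forall x, 0 <= quad A x) ->
  `|A i j| <= A i i + A j j.
Proof.
move=> AT A0.
have aji : A j i = A i j by rewrite -{1}AT mxE.
have e (a : R) : quad A (delta_mx i 0 + a *: delta_mx j 0) = A i i + a * (2 * A i j) + a ^+ 2 * A j j.
  rewrite quadE mulmxDr -scalemxAr dotDl !(dotDr, dotZr, dotZl).
  have d k k' : dot (delta_mx k 0) (A *m delta_mx k' 0) = A k k'.
    rewrite /dot (bigD1 k)//= big1 ?addr0 => [|k'' /negPf kk]; last by rewrite mxE kk mul0r.
    rewrite mxE eqxx mul1r mxE (bigD1 k')//= big1 ?addr0 => [|k'' /negPf kk]; last by rewrite mxE kk mulr0.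
    by rewrite mxE !eqxx mulr1.
  by rewrite !d aji; ring.
have := A0 (delta_mx i 0 + 1 *: delta_mx j 0); have := A0 (delta_mx i 0 + (-1) *: delta_mx j 0).
rewrite !e; have := A0 (delta_mx i 0); have := A0 (delta_mx j 0); rewrite !quad_delta => h1 h2 h3 h4.
by rewrite ler_norml; apply/andP; split; lra.
Qed.

Section Comparison.
Variables (M Q : 'M[R]_p) (s : R).
Hypothesis MT : M^T = M.
Hypothesis Mu : M \in unitmx.
Hypothesis M0 : forall x, 0 <= quad M x.
Hypothesis Qpd : posdef Q.
Hypothesis lower : loewner_le ((2^-1 * s) *: invmx M) Q.
Hypothesis upper : loewner_le Q ((2 * s) *: invmx M).

Let Mi0 x : 0 <= quad (invmx M) x.
Proof. by rewrite quad_invmx. Qed.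

Let Qu : Q \in unitmx. Proof. by apply: posdef_unit; case: Qpd. Qed.

Let QT : Q^T = Q. Proof. by case: Qpd. Qed.

(** The index i only excludes p = 0, where every comparison is void. *)
Lemma noise_level_gt0 (i : 'I_p) : 0 < s.
Proof.
have d0 : (delta_mx i 0 : 'cV[R]_p) != 0.
  apply/eqP => /(congr1 (@sqn R p)); rewrite sqn_delta /sqn /dot big1 => [/eqP|k _].
    by rewrite oner_eq0.
  by rewrite mxE mul0r.
have := loewner_quad (delta_mx i 0) upper; rewrite quadZ => h.
have := lt_le_trans (Qpd.2 _ d0) h => /[dup] h'; rewrite pmulr_lgt0; last first.
  rewrite lt_neqAle Mi0 andbT; apply/eqP => z; move: h'; rewrite -z mulr0; by rewrite ltxx.
by rewrite pmulr_rgt0.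
Qed.

Hypothesis s0 : 0 < s.

Let scale_sym a : (a *: invmx M)^T = a *: invmx M.
Proof. by rewrite linearZ/= invmx_sym. Qed.

Let scale_unit a : a != 0 -> a *: invmx M \in unitmx.
Proof.
move=> a0; rewrite unitmxE detZ unitrM; apply/andP; split.
  by rewrite unitrX// unitfE.
by rewrite -unitmxE unitmx_inv.
Qed.

Let scale_inv a : a != 0 -> invmx (a *: invmx M) = a^-1 *: M.
Proof.
move=> a0; apply: (can_inj (mulKmx (scale_unit a0))); rewrite mulmxV ?scale_unit//.
by rewrite -scalemxAl -scalemxAr scalerA mulfV// scale1r mulVmx.
Qed.

Lemma mse_le_inv x : quad M x <= 2 * s * quad (invmx Q) x.
Proof.
have s2 : 2 * s != 0 by rewrite gt_eqF// mulr_gt0.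
have := @quad_inv_le R _ Q ((2 * s) *: invmx M) x QT (scale_sym _) Qu (scale_unit s2)
  (posdef_ge0 Qpd) (fun z => loewner_quad z upper).
by rewrite scale_inv// quadZ -ler_pdivlMl ?invr_gt0 ?mulr_gt0// invrK.
Qed.

Lemma inv_le_mse x : quad (invmx Q) x <= 2 / s * quad M x.
Proof.
have s2 : 2^-1 * s != 0 by rewrite gt_eqF// mulr_gt0.
have A0 z : 0 <= quad ((2^-1 * s) *: invmx M) z.
  by rewrite quadZ mulr_ge0// mulr_ge0// ltW.
have := @quad_inv_le R _ ((2^-1 * s) *: invmx M) Q x (scale_sym _) QT (scale_unit s2) Qu
  A0 (fun z => loewner_quad z lower).
by rewrite scale_inv// quadZ invfM invrK.
Qed.

End Comparison.
End Inverse.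

Section TransferAlgebra.
Context {R : realType} {p n0 : nat}.
Variables (X0 : 'M[R]_(n0, p)) (Q : 'M[R]_p).
Hypothesis Qpd : posdef Q.

Definition snd_gram : 'M[R]_p := n0%:R^-1 *: (X0^T *m X0).
(** The inverse matrix in the transfer estimator; its columns are the weights of
    the coordinates of the transfer error. *)
Definition resol : 'M[R]_p := invmx (snd_gram + Q).
Definition resol_col (i : 'I_p) : 'cV[R]_p := resol *m delta_mx i 0.

Lemma quad_snd_gram x : quad snd_gram x = n0%:R^-1 * \sum_m (X0 *m x) m 0 ^+ 2.
Proof.
by rewrite /snd_gram quadZ quadE -mulmxA dotMr trmxK -/(sqn _) sqn_sum.
Qed.

Lemma snd_gram_ge0 x : 0 <= quad snd_gram x.
Proof. by rewrite quad_snd_gram mulr_ge0// sumr_ge0// => m _; exact: sqr_ge0. Qed.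

Lemma snd_gram_sym : snd_gram^T = snd_gram.
Proof. by rewrite /snd_gram linearZ/= trmx_mul trmxK. Qed.

Let QT : Q^T = Q. Proof. by case: Qpd. Qed.
Let Qu : Q \in unitmx. Proof. by apply: posdef_unit; case: Qpd. Qed.

Let GT : (snd_gram + Q)^T = snd_gram + Q.
Proof. by rewrite linearD/= snd_gram_sym QT. Qed.

Lemma snd_gramQ_unit : snd_gram + Q \in unitmx.
Proof.
apply: posdef_unit => x x0; rewrite quadD ltr_wpDl ?snd_gram_ge0//; exact: Qpd.2.
Qed.

Lemma resol_sym : resol^T = resol. Proof. exact: invmx_sym. Qed.

Lemma resol_le x : quad resol x <= quad (invmx Q) x.
Proof.
apply: quad_inv_le => //; [exact: snd_gramQ_unit|exact: posdef_ge0|].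
by move=> z; rewrite quadD lerDr snd_gram_ge0.
Qed.

Lemma resol_diag_le i : resol i i <= invmx Q i i.
Proof. by rewrite -2!quad_delta; exact: resol_le. Qed.

Lemma resol_diag i : quad (snd_gram + Q) (resol_col i) = resol i i.
Proof. by rewrite -quad_delta quad_invmx// snd_gramQ_unit. Qed.

Lemma resol_ge0 x : 0 <= quad resol x.
Proof.
by rewrite quad_invmx ?snd_gramQ_unit// quadD addr_ge0 ?snd_gram_ge0// posdef_ge0.
Qed.

(** c I <= S + Q, and inversion reverses the order. *)
Lemma resol_good (c : R) i : 0 < c -> (forall t, c * sqn t <= quad snd_gram t) -> resol i i <= c^-1.
Proof.
move=> c0 H; rewrite -quad_delta.
have cu : (c%:M : 'M[R]_p) \in unitmx.
  by rewrite unitmxE det_scalar unitrX// unitfE gt_eqF.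
have := @quad_inv_le R _ c%:M (snd_gram + Q) (delta_mx i 0) (tr_scalar_mx _ _) GT cu snd_gramQ_unit.
rewrite invmx_scalar quad_scalar sqn_delta mulr1; apply => z.
  by rewrite quad_scalar mulr_ge0 ?sqn_ge0// ltW.
by rewrite quad_scalar quadD -[leLHS]addr0 lerD// posdef_ge0.
Qed.

Lemma transfer_err (th0 th : 'cV[R]_p) (e : 'cV[R]_n0) :
  transfer X0 (X0 *m th0 + e) Q th - th0 =
  resol *m (n0%:R^-1 *: (X0^T *m e) + Q *m (th - th0)).
Proof.
apply: (can_inj (mulKmx snd_gramQ_unit)).
rewrite mulmxBr /transfer -/snd_gram /resol !mulKVmx ?snd_gramQ_unit//.
rewrite mulmxDl mulmxBr mulmxDr scalerDr /snd_gram -scalemxAl -!mulmxA opprD.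
set a := _ *: (_ *m (_ *m th0)); set b := _ *: _; set q := Q *m th.
by rewrite [a + b]addrC -!addrA; congr (_ + _); rewrite addrCA; congr (_ + _); rewrite addrA subrr add0r.
Qed.

Lemma resol_mul i (x : 'cV[R]_p) : (resol *m x) i 0 = dot (resol_col i) x.
Proof.
rewrite /resol_col dotC dotMr resol_sym dotC /dot (bigD1 i)//= big1 ?addr0.
  by rewrite [X in _ = X * _]mxE !eqxx mul1r.
by move=> j /negPf ji; rewrite mxE ji mul0r.
Qed.

Lemma transfer_err_coord i (th0 th : 'cV[R]_p) (e : 'cV[R]_n0) :
  (transfer X0 (X0 *m th0 + e) Q th - th0) i 0 =
  \sum_j (Q *m resol_col i) j 0 * (th - th0) j 0 +
  \sum_m n0%:R^-1 * (X0 *m resol_col i) m 0 * e m 0.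
Proof.
rewrite transfer_err resol_mul dotDr dotZr addrC; congr (_ + _).
  by rewrite dotMr QT.
rewrite dotMr trmxK /dot mulr_sumr; apply: eq_bigr => m _; exact: mulrA.
Qed.

End TransferAlgebra.

(** * Second moment of the transfer error *)

Section BadaptedSub.
Context {R : realType} {d : measure_display} {Omega : measurableType d}.
Lemma badapted_sub (S S' : set (set Omega)) (g : Omega -> R) :
  S `<=` <<s S' >> -> badapted S g -> badapted S' g.
Proof. by move=> SS' [mg bg]; split=> //; exact: smeas_sub SS' mg. Qed.

Lemma ae_intg (P : probability Omega R) (f g : Omega -> R) :
  intg P f -> measurable_fun setT g -> {ae P, forall w, f w = g w} -> intg P g.
Proof.
move=> If mg fg; apply/integrableP; split; first exact/measurable_EFinP.
have /integrableP[mf lf] := If; apply: le_lt_trans lf.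
apply: ae_ge0_le_integral => //.
- by apply: measurableT_comp => //; exact/measurable_EFinP.
- by apply: measurableT_comp.
by apply: filterS fg => w /= -> _.
Qed.
End BadaptedSub.

Section Arith.
Context {R : realType}.

Lemma risk_arith (s a b m : R) : 0 <= s -> 0 <= a -> m <= 2 * s * b ->
  m + s * a <= 2 * s * (a + b).
Proof. by move=> s0 a0; have := mulr_ge0 s0 a0; lra. Qed.
End Arith.

Section Risk.
Context {R : realType} {p K : nat}.
Variables (beta L e0 u0 gamma Cv sg : R).
Variable n : 'I_K.+1 -> nat.
Context {d : measure_display} {Omega : measurableType d}.
Variables (P : probability Omega R) (U : 'I_K.+1 -> Omega -> R).
Variables (X : obs n -> Omega -> 'rV[R]_p) (eps : obs n -> Omega -> R).
Variable theta : 'I_p -> R -> R.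
Variable v : obs n -> Omega -> R.
Variables (bt : 'I_p -> Omega -> R) (Ht : 'I_p -> obs n -> Omega -> R).
Let hw w := bandwidth n beta e0 gamma u0 (ids U w).
Hypothesis beta0 : 0 < beta.
Hypothesis L0 : 0 <= L.
Hypothesis K0 : (0 < K)%N.
Hypothesis mdata : measurable_data U X eps.
Hypothesis U00 : forall w, U ord0 w = u0.
Hypothesis split_ind : sample_split P U X.
Hypothesis Xbnd : bounded_covariates P X.
Hypothesis th_class : hoelder_class beta L theta.
Hypothesis v_smeas : forall o, smeas (ids_gens U) (v o).
Hypothesis v_bnd : forall o w, 0 <= v o w <= Cv.
Hypothesis v_target : forall i w, v (obs2 i) w = sg.
Hypothesis bil : forall (b b' : Omega -> R) (c c' : obs n -> Omega -> R),
  badapted (design_gens U X) b -> badapted (design_gens U X) b' ->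
  (forall o, badapted (design_gens U X) (c o)) -> (forall o, badapted (design_gens U X) (c' o)) ->
  let F w := (b w + \sum_o c o w * eps o w) * (b' w + \sum_o c' o w * eps o w) in
  let G w := b w * b' w + \sum_o c o w * c' o w * v o w in
  [/\ intg P F, intg P G & expect P F = expect P G].
Hypothesis bt_ad : forall j, badapted (fst_gens U X) (bt j).
Hypothesis Ht_ad : forall j o, badapted (fst_gens U X) (Ht j o).
Hypothesis Ht_snd : forall j i w, Ht j (obs2 i) w = 0.
Let err w := theta_dvcm U X eps beta e0 gamma u0 theta w - \col_j theta j u0.
Hypothesis err_ae : {ae P, forall w, forall j,
  err w j 0 = bt j w + \sum_o Ht j o w * eps o w}.
Let E := expect P.

Let fst_gensM : fst_gens U X `<=` measurable. Proof. exact: fst_gensM mdata. Qed.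

(** The mixed second moment of two coordinates of the DVCM error given the design. *)
Let pairvar j k w := bt j w * bt k w + \sum_o Ht j o w * Ht k o w * v o w.

Lemma v_badapted o : badapted (fst_gens U X) (v o).
Proof.
split; first by exact: smeas_sub (@ids_fst _ _ _ _ _ _ U X) (v_smeas o).
by exists Cv => w; have /andP[? ?] := v_bnd o w; rewrite ger0_norm.
Qed.

Lemma pairvar_badapted j k : badapted (fst_gens U X) (pairvar j k).
Proof.
apply: badaptedD; first exact: badaptedM.
apply: badapted_sum => o; apply: badaptedM; last exact: v_badapted.
exact: badaptedM.
Qed.

Let mU k : measurable_fun setT (U k). Proof. by case: mdata. Qed.

Lemma measurable_Yobs o : measurable_fun setT (Yobs U X eps theta o).
Proof.
apply: measurable_funD; last by case: mdata.
apply: mxmeasM; first by move=> a b; rewrite (ord1 a); case: mdata.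
move=> a b; under eq_fun do rewrite mxE.
exact: (measurableT_comp (measurable_hoelder beta0 L0 (th_class a)) (mU _)).
Qed.

Lemma mxmeas_err : mxmeas err.
Proof.
move=> i j; rewrite /err.
under eq_fun do rewrite mxE.
apply: measurable_funD; last by under eq_fun do rewrite !mxE; exact: measurable_cst.
apply: mxmeas_dvcm => //; first exact: measurable_bandwidth.
  by move=> k a b; under eq_fun do rewrite mxE; case: mdata => _ + _; exact.
by move=> k a b; under eq_fun do rewrite mxE; exact: measurable_Yobs.
Qed.

Let M := mse_dvcm P U X eps beta e0 gamma u0 theta.

Lemma mse_eq j k : M j k = E (pairvar j k).
Proof.
have Sub := @fst_design _ _ _ _ _ _ U X.
have [IF IG FG] := bil (badapted_sub Sub (bt_ad j)) (badapted_sub Sub (bt_ad k))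
  (fun o => badapted_sub Sub (Ht_ad j o)) (fun o => badapted_sub Sub (Ht_ad k o)).
rewrite /M /mse_dvcm mxE unlock -[RHS]FG.
rewrite -[LHS]/(expect P _); symmetry; apply: (expect_ae IF).
  apply: mxmeasM; first exact: mxmeas_err.
  by apply: mxmeasT; exact: mxmeas_err.
apply: filterS err_ae => w H.
by rewrite -!H !mxE big_ord1 -/(err w) !mxE.
Qed.


Let pairvar_intg j k : intg P (pairvar j k).
Proof. exact: badapted_intg (pairvar_badapted j k). Qed.

Lemma mse_sym : M^T = M.
Proof.
by apply/matrixP => j k; rewrite !mxE; congr fine; rewrite unlock; congr integral;
  apply/funext => w; rewrite !mxE; congr EFin; apply: eq_bigr => i _; rewrite !mxE mulrC.
Qed.

Lemma pairvar_quad (x : 'cV[R]_p) w :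
  \sum_j \sum_k x j 0 * x k 0 * pairvar j k w =
  (\sum_j x j 0 * bt j w) ^+ 2 + \sum_o (\sum_j x j 0 * Ht j o w) ^+ 2 * v o w.
Proof.
have sq (a : 'I_p -> R) : (\sum_j x j 0 * a j) ^+ 2 = \sum_j \sum_k x j 0 * x k 0 * (a j * a k).
  rewrite expr2 mulr_suml; apply: eq_bigr => j _; rewrite mulr_sumr.
  by apply: eq_bigr => k _; ring.
rewrite sq; under [X in _ = _ + X]eq_bigr do rewrite sq mulr_suml.
rewrite [X in _ = _ + X]exchange_big/= -big_split/=; apply: eq_bigr => j _.
under [X in _ = _ + X]eq_bigr do rewrite mulr_suml.
rewrite [X in _ = _ + X]exchange_big/= -big_split/=; apply: eq_bigr => k _.
by rewrite /pairvar mulrDr mulr_sumr; congr (_ + _); apply: eq_bigr => o _; ring.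
Qed.

Lemma mse_ge0 x : 0 <= quad M x.
Proof.
rewrite quad_sum.
have -> : \sum_j \sum_k x j 0 * x k 0 * M j k = E (fun w => \sum_j \sum_k x j 0 * x k 0 * pairvar j k w).
  have I1 j k : intg P (fun w => x j 0 * x k 0 * pairvar j k w) by exact: intgZ.
  rewrite /E expect_sum => [|j _]; last by apply: intg_sum => k _.
  apply: eq_bigr => j _; rewrite expect_sum//.
  by apply: eq_bigr => k _; rewrite mse_eq expectZ.
apply: expect_ge0 => w; rewrite pairvar_quad addr_ge0 ?sqr_ge0// sumr_ge0// => o _.
by rewrite mulr_ge0 ?sqr_ge0//; case/andP: (v_bnd o w).
Qed.

Lemma mse_diag_le j (b h : Omega -> R) : intg P b -> intg P h ->
  {ae P, forall w, bt j w ^+ 2 <= b w} -> (forall w, \sum_o Ht j o w ^+ 2 <= h w) ->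
  0 <= Cv -> M j j <= E b + Cv * E h.
Proof.
move=> Ib Ih Hb Hh Cv0; rewrite mse_eq /E -expectZ// -expectD//; last exact: intgZ.
apply: expect_ae_le => //; first by apply: intgD => //; exact: intgZ.
apply: filterS Hb => w hb; apply: lerD; first by rewrite -expr2.
apply: le_trans (ler_wpM2l Cv0 (Hh w)); rewrite mulr_sumr; apply: ler_sum => o _.
by rewrite -expr2 mulrC ler_wpM2r ?sqr_ge0//; case/andP: (v_bnd o w).
Qed.


Let n0 := n ord0.

(** Generates the sigma-algebra of all the covariates of the second half; the
    union over the observations is the form used by [indep_option]. *)
Definition snd_gens : set (set Omega) := [set D | exists k, sigma_snd X k D].

Let sndM k : sigma_snd X k `<=` measurable.
Proof.
move=> D; apply: gen_measurable; apply: genset_meas => j.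
by case: mdata => _ + _; exact.
Qed.

Lemma snd_gensM : snd_gens `<=` measurable.
Proof. by move=> D [k sD]; exact: sndM sD. Qed.

Lemma snd_design : snd_gens `<=` <<s design_gens U X >>.
Proof.
move=> D [k]; apply: smallest_sub; first exact: smallest_sigma_algebra.
by move=> _ [j [B [mB ->]]]; apply: sub_sigma_algebra; exists (inr (obs2 k, j)), B.
Qed.

Lemma X_gs m j : smeas snd_gens (fun w => X (obs2 m) w 0 j).
Proof.
apply: smeas_gen => B mB; exists m.
by apply: sub_sigma_algebra; exists j, B.
Qed.

Lemma fst_snd_indep A B : <<s fst_gens U X >> A -> <<s snd_gens >> B -> P (A `&` B) = (P A * P B)%E.
Proof.
move=> sA sB.
apply: (indep_option split_ind) => //.
- by move=> [k|]; exact: smallest_sigma_algebra.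
- move=> [k|] D; first exact: sndM.
  exact: gen_measurable fst_gensM.
Qed.

Lemma fst_snd_expectM f g : badapted (fst_gens U X) f -> badapted snd_gens g ->
  E (fun w => f w * g w) = E f * E g.
Proof.
move=> [mf [a fa]] [mg [b gb]].
exact: (indep_expectM fst_gensM snd_gensM fst_snd_indep mf fa mg gb).
Qed.

(** Almost surely the covariates of the second half, but bounded everywhere, so that
    they may enter the coefficients of the noise. *)
Definition Xclip w : 'M[R]_(n0, p) :=
  \matrix_(m, j) (X (obs2 m) w 0 j * (`|X (obs2 m) w 0 j| <= 1)%R%:R).

Lemma Xclip_le1 w m j : `|Xclip w m j| <= 1.
Proof.
by rewrite mxE; case h : (`|X (obs2 m) w 0 j| <= 1); rewrite ?mulr1// mulr0 normr0.
Qed.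

Lemma Xclip_smeas m j : smeas snd_gens (fun w => Xclip w m j).
Proof.
under eq_fun do rewrite mxE; apply: measurable_funM; first exact: X_gs.
apply: measurable_le_bool; last exact: measurable_cst.
by apply: measurableT_comp => //; exact: X_gs.
Qed.

Lemma Xclip_badapted m j : badapted snd_gens (fun w => Xclip w m j).
Proof. by split; [exact: Xclip_smeas|exists 1 => w; exact: Xclip_le1]. Qed.

Lemma Xclip_ae : {ae P, forall w, Xclip w = Xsnd X w}.
Proof.
have Xa : {ae P, forall w, forall m, norm2 (X (obs2 m) w)^T <= 1}.
  by apply: filter_forall => m; exact: Xbnd.
apply: filterS Xa => w H; apply/matrixP => m j; rewrite !mxE.
suff -> : `|X (obs2 m) w 0 j| <= 1 by rewrite mulr1.
apply: le_trans (H m); rewrite norm2E -sqrtr_sqr ler_sqrt ?sqn_ge0//.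
rewrite sqn_sum (bigD1 j)//= mxE lerDl; apply: sumr_ge0 => k _; exact: sqr_ge0.
Qed.

Variable Q : 'M[R]_p.
Hypothesis Qpd : posdef Q.
Let s := sg / n0%:R.

Let Rs w := resol (Xclip w) Q.
Let r i w := resol_col (Xclip w) Q i.

Let Xt_mx : @mxmeas _ _ (g_sigma_algebraType snd_gens) _ _ Xclip.
Proof. by move=> m j; exact: Xclip_smeas. Qed.

Lemma resol_badapted i j : badapted snd_gens (fun w => Rs w i j).
Proof.
split.
  apply: mxmeas_inv; apply: mxmeasD; last exact: mxmeas_cst.
  apply: mxmeasZ; first exact: measurable_cst.
  by apply: mxmeasM => //; exact: mxmeasT.
exists (invmx Q i i + invmx Q j j) => w.
apply: le_trans (psd_entry _ _ (resol_sym _ Qpd) (resol_ge0 _ Qpd)) _.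
have h k : resol (Xclip w) Q k k <= invmx Q k k by rewrite -2!quad_delta; exact: resol_le.
exact: lerD.
Qed.

Lemma resol_colE i k w : r i w k 0 = Rs w k i.
Proof.
rewrite /r /resol_col mxE (bigD1 i)//= big1 ?addr0 => [|j /negPf ji].
  by rewrite mxE !eqxx mulr1.
by rewrite mxE ji mulr0.
Qed.

Lemma col_badapted i k : badapted snd_gens (fun w => r i w k 0).
Proof. by under eq_fun do rewrite resol_colE; exact: resol_badapted. Qed.

Let q i w j := (Q *m r i w) j 0.
Let c i w m := n0%:R^-1 * (Xclip w *m r i w) m 0.

Lemma q_badapted i j : badapted snd_gens (fun w => q i w j).
Proof.
under eq_fun do rewrite /q mxE; apply: badapted_sum => k; apply: badaptedM.
  exact: badapted_cst.
exact: col_badapted.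
Qed.

Lemma c_badapted i m : badapted snd_gens (fun w => c i w m).
Proof.
apply: badaptedM; first exact: badapted_cst.
under eq_fun do rewrite mxE; apply: badapted_sum => k; apply: badaptedM.
  exact: Xclip_badapted.
exact: col_badapted.
Qed.

(** Bias and noise coefficients of coordinate i of the transfer error. *)
Let Bt i w := \sum_j q i w j * bt j w.
Let Ct i (o : obs n) w := match o with
  inl t => \sum_j q i w j * Ht j (inl t) w | inr m => c i w m end.

Let gfd := @fst_design _ _ _ _ _ _ U X.

Lemma Bt_badapted i : badapted (design_gens U X) (Bt i).
Proof.
apply: badapted_sum => j; apply: badaptedM.
  exact: badapted_sub snd_design (q_badapted i j).
exact: badapted_sub gfd (bt_ad j).
Qed.

Lemma Ct_badapted i o : badapted (design_gens U X) (Ct i o).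
Proof.
case: o => [t|m] /=; last exact: badapted_sub snd_design (c_badapted i m).
apply: badapted_sum => j; apply: badaptedM.
  exact: badapted_sub snd_design (q_badapted i j).
exact: badapted_sub gfd (Ht_ad j _).
Qed.

Let errT w := theta_tl U X eps beta e0 gamma u0 Q theta w - \col_j theta j u0.

Lemma mxmeas_errT : mxmeas errT.
Proof.
have mX : mxmeas (Xsnd X).
  by move=> a b; under eq_fun do rewrite mxE; case: mdata => _ + _; exact.
apply: mxmeasD; last first.
  by move=> a b; under eq_fun do rewrite !mxE; exact: measurable_cst.
apply: mxmeasM.
  apply: mxmeas_inv; apply: mxmeasD; last exact: mxmeas_cst.
  apply: mxmeasZ; first exact: measurable_cst.
  by apply: mxmeasM => //; exact: mxmeasT.
apply: mxmeasD.
  apply: mxmeasZ; first exact: measurable_cst.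
  apply: mxmeasM; first exact: mxmeasT.
  by move=> a b; under eq_fun do rewrite mxE; exact: measurable_Yobs.
apply: mxmeasM; first exact: mxmeas_cst.
have -> : theta_dvcm U X eps beta e0 gamma u0 theta = fun w => err w + \col_j theta j u0.
  by apply/funext => w; rewrite /err subrK.
by apply: mxmeasD; [exact: mxmeas_err|exact: mxmeas_cst].
Qed.

Lemma errT_ae : {ae P, forall w, forall i,
  errT w i 0 = Bt i w + \sum_o Ct i o w * eps o w}.
Proof.
apply: filterS2 Xclip_ae err_ae => w HX He i.
rewrite /errT /theta_tl.
have -> : ysnd U X eps theta w = Xsnd X w *m \col_j theta j u0 + \col_m eps (obs2 m) w.
  apply/colP => m; rewrite !mxE /Yobs; congr (_ + _); rewrite !mxE.
  by apply: eq_bigr => a _; rewrite !mxE /= U00.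
rewrite -HX transfer_err_coord// -/(err w) [in RHS]sum_obs addrA; congr (_ + _); last first.
  by apply: eq_bigr => m _; rewrite mxE.
rewrite /Bt; under eq_bigr do rewrite He mulrDr.
rewrite big_split/=; congr (_ + _).
transitivity (\sum_j \sum_k \sum_(a < n k) q i w j * (Ht j (obs1 a) w * eps (obs1 a) w)).
  apply: eq_bigr => j _; rewrite sum_obs [X in _ + X]big1 ?addr0 => [|m _].
    by rewrite mulr_sumr; apply: eq_bigr => k _; rewrite mulr_sumr.
  by rewrite Ht_snd mul0r.
rewrite exchange_big; apply: eq_bigr => k _; rewrite exchange_big; apply: eq_bigr => a _.
by rewrite mulr_suml; apply: eq_bigr => j _; rewrite mulrA.
Qed.

Hypothesis s0 : 0 < s.
Hypothesis M_le : forall x, quad M x <= 2 * s * quad (invmx Q) x.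
Hypothesis le_M : forall x, quad (invmx Q) x <= 2 / s * quad M x.

(** The first half enters through the DVCM error applied to Q R e_i, the second
    half through its own noise, of variance sg. *)
Lemma transfer_secondE i w : Bt i w * Bt i w + \sum_o Ct i o w * Ct i o w * v o w =
  \sum_j \sum_k q i w j * q i w k * pairvar j k w + s * quad (snd_gram (Xclip w)) (r i w).
Proof.
rewrite pairvar_quad sum_obs [in RHS]sum_obs -expr2 -!addrA; congr (_ + (_ + _)).
rewrite [X in X + _]big1 ?add0r => [|m _]; last first.
  by rewrite big1 ?expr0n ?mul0r// => j _; rewrite Ht_snd mulr0.
rewrite quad_snd_gram /s mulrA mulr_sumr; apply: eq_bigr => m _.
by rewrite v_target /= /c; ring.
Qed.

Lemma quad_snd_gram_badapted i : badapted snd_gens (fun w => quad (snd_gram (Xclip w)) (r i w)).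
Proof.
under eq_fun do rewrite quad_snd_gram.
apply: badaptedM; first exact: badapted_cst.
apply: badapted_sum => m; under eq_fun do rewrite expr2 mxE.
by apply: badaptedM; apply: badapted_sum => k; apply: badaptedM;
  [exact: Xclip_badapted|exact: col_badapted|exact: Xclip_badapted|exact: col_badapted].
Qed.

(** The coefficients q depend on the second half and the second moments of the
    DVCM error on the first half, so independence yields E [(Q R e_i)^T M (Q R e_i)].
    Since M <= 2 s Q^-1, this is at most 2 s E [(R e_i)^T Q (R e_i)]; with the noise
    term s (R e_i)^T S (R e_i) it adds up to at most 2 s R_ii, because
    R (S + Q) R = R. *)
Lemma transfer_moment i :
  intg P (fun w => errT w i 0 ^+ 2) /\
  E (fun w => errT w i 0 ^+ 2) <= 2 * s * E (fun w => Rs w i i).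
Proof.
have [IF IG FG] := bil (Bt_badapted i) (Bt_badapted i) (Ct_badapted i) (Ct_badapted i).
set F := (fun w => _ * _) in IF FG.
have mT : measurable_fun setT (fun w => errT w i 0 ^+ 2).
  by apply: measurable_funX; exact: mxmeas_errT.
have FT : {ae P, forall w, F w = errT w i 0 ^+ 2}.
  by apply: filterS errT_ae => w H; rewrite H expr2.
have IT : intg P (fun w => errT w i 0 ^+ 2) by exact: ae_intg IF mT FT.
split => //.
rewrite /E -(expect_ae IF mT FT) FG.
have Iq j k : intg P (fun w => q i w j * q i w k).
  by apply: (badapted_intg P snd_gensM); apply: badaptedM; exact: q_badapted.
have IqG j k : intg P (fun w => q i w j * q i w k * pairvar j k w).
  apply: (badapted_intg P (@design_gensM _ _ _ _ _ _ _ _ _ mdata)); apply: badaptedM.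
    by apply: (badapted_sub snd_design); apply: badaptedM; exact: q_badapted.
  exact: badapted_sub gfd (pairvar_badapted j k).
have Igr := badapted_intg P snd_gensM (quad_snd_gram_badapted i).
have IR := badapted_intg P snd_gensM (resol_badapted i i).
rewrite (expect_ext _ (transfer_secondE i)) expectD; last 2 first.
- by apply: intg_sum => j _; apply: intg_sum => k _.
- exact: intgZ.
have -> : expect P (fun w => \sum_j \sum_k q i w j * q i w k * pairvar j k w) =
    expect P (fun w => quad M (Q *m r i w)).
  transitivity (expect P (fun w => \sum_j \sum_k q i w j * q i w k * M j k)); last first.
    by apply: expect_ext => w; rewrite quad_sum.
  rewrite !expect_sum => [|j _|j _]; last 2 first.
  - by apply: intg_sum => k _; under eq_fun do rewrite mulrC; exact: intgZ.
  - by apply: intg_sum => k _.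
  apply: eq_bigr => j _; rewrite !expect_sum => [|k _|k _]; last 2 first.
  - by under eq_fun do rewrite mulrC; exact: intgZ.
  - by [].
  apply: eq_bigr => k _; rewrite mse_eq expectZr// -/E.
  transitivity (E (fun w => pairvar j k w * (q i w j * q i w k))).
    by apply: expect_ext => w; rewrite mulrC.
  rewrite fst_snd_expectM 1?mulrC//; first exact: pairvar_badapted.
  by apply: badaptedM; exact: q_badapted.
have IM : intg P (fun w => quad M (Q *m r i w)).
  under eq_fun do rewrite quad_sum.
  by apply: intg_sum => j _; apply: intg_sum => k _; under eq_fun do rewrite mulrC; apply: intgZ; exact: Iq.
rewrite -expectD//; last exact: intgZ.
rewrite -expectZ//; apply: expect_le; [by apply: intgD => //; exact: intgZ|exact: intgZ|].
move=> w; rewrite /Rs -(resol_diag _ Qpd) quadD -/(r i w).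
have h := M_le (Q *m r i w).
have Qu : Q \in unitmx by apply: posdef_unit; case: Qpd.
move: h; rewrite quad_invmx// mulKmx// => h.
exact: (risk_arith (ltW s0) (snd_gram_ge0 _ _) h).
Qed.

Lemma resol_le_mse i w : Rs w i i <= 2 / s * M i i.
Proof.
by apply: le_trans (resol_diag_le _ Qpd _) _; have := le_M (delta_mx i 0); rewrite !quad_delta.
Qed.

End Risk.

(** * Deviation of the target Gram matrix *)

Section Arith.
Context {R : realType}.

(** If dv > (c/2)^2, then 4 m, which bounds 2 s r, is at most 16 m dv / c^2. *)
Lemma resol_arith (s c r m dv : R) : 0 < s -> 0 < c -> 0 <= m -> 0 <= dv -> 0 <= r ->
  (dv <= (c / 2) ^+ 2 -> r <= (c / 2)^-1) -> r <= 2 / s * m ->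
  2 * s * r <= 4 * s / c + 16 * m / c ^+ 2 * dv.
Proof.
move=> s0 c0 m0 dv0 r0 good bad.
have h1 : 0 <= 4 * s / c by rewrite divr_ge0 ?mulr_ge0 ?(ltW s0) ?(ltW c0).
have h3 : 0 <= 16 * m / c ^+ 2 by apply: divr_ge0; [exact: mulr_ge0|exact: sqr_ge0].
have h2 : 0 <= 16 * m / c ^+ 2 * dv by exact: mulr_ge0.
have [/good h|h] := leP dv ((c / 2) ^+ 2).
  apply: le_trans (_ : 4 * s / c <= _); last by rewrite lerDl.
  have -> : 4 * s / c = 2 * s * (c / 2)^-1 by field; rewrite gt_eqF.
  by rewrite ler_wpM2l// mulr_ge0// ltW.
apply: le_trans (_ : 4 * m <= _).
  have -> : 4 * m = 2 * s * (2 / s * m) by field; rewrite gt_eqF.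
  by rewrite ler_wpM2l// mulr_ge0// ltW.
apply: le_trans (_ : 16 * m / c ^+ 2 * dv <= _); last by rewrite lerDr.
have -> : 4 * m = 16 * m / c ^+ 2 * ((c / 2) ^+ 2) by field; rewrite gt_eqF.
by rewrite ler_wpM2l// ltW.
Qed.
Lemma half_lower (a b c y : R) : 0 <= y -> c * y <= b -> (a - b) ^+ 2 <= (c / 2) ^+ 2 * y ^+ 2 -> 0 < c ->
  c / 2 * y <= a.
Proof.
move=> y0 cb h c0; rewrite -exprMn in h.
have cy : 0 <= c / 2 * y by rewrite mulr_ge0// divr_ge0// ltW.
have : `|a - b| <= c / 2 * y by rewrite -(ger0_norm cy) -ler_sqr ?nnegrE// !real_normK ?num_real.
rewrite ler_norml => /andP[h1 _]; lra.
Qed.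
End Arith.

Section GramDeviation.
Context {R : realType} {p K : nat}.
Variable n : 'I_K.+1 -> nat.
Context {d : measure_display} {Omega : measurableType d}.
Variables (P : probability Omega R) (U : 'I_K.+1 -> Omega -> R).
Variables (X : obs n -> Omega -> 'rV[R]_p) (eps : obs n -> Omega -> R).
Variables (Q : 'M[R]_p) (c s : R).
Hypothesis n00 : (0 < n ord0)%N.
Hypothesis mdata : measurable_data U X eps.
Hypothesis split_ind : sample_split P U X.
Hypothesis Xbnd : bounded_covariates P X.
Hypothesis Qpd : posdef Q.
Hypothesis s0 : 0 < s.
Hypothesis c0 : 0 < c.
Hypothesis second : forall (t : 'cV[R]_p) i, sqn t = 1 ->
  c <= expect P (fun w => covproj X t (obs2 i) w ^+ 2).
Let E := expect P.
Let n0 := n ord0.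
Let n0R : 0 < n0%:R :> R. Proof. by rewrite ltr0n. Qed.

Let f i j m w := Xclip X w m i * Xclip X w m j.

Let sndM k : sigma_snd X k `<=` measurable.
Proof. move=> D sD; apply: (snd_gensM mdata); exact: (ex_intro _ k sD). Qed.

Let fstM : sigma_fst U X `<=` measurable.
Proof. move=> D; apply: gen_measurable; exact: (fst_gensM mdata). Qed.

Let gm m := genset (fun (j : 'I_p) w => X (obs2 m) w 0 j).

Let f_smeas i j m : smeas (gm m) (f i j m).
Proof.
have mX k : smeas (gm m) (fun w => X (obs2 m) w 0 k).
  exact: (@genset_smeas _ _ _ _ (fun (j : 'I_p) w => X (obs2 m) w 0 j) k).
have mXt k : smeas (gm m) (fun w => Xclip X w m k).
  under eq_fun do rewrite mxE; apply: measurable_funM; first exact: mX.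
  apply: measurable_le_bool; last exact: measurable_cst.
  by apply: measurableT_comp => //; exact: mX.
by apply: measurable_funM; exact: mXt.
Qed.

Let f_le1 i j m w : `|f i j m w| <= 1.
Proof. by rewrite normrM -[leRHS]mulr1; apply: ler_pM => //; exact: Xclip_le1. Qed.

Let gmM m : gm m `<=` measurable.
Proof. by move=> D gD; apply: (@sndM m); exact: sub_sigma_algebra. Qed.

Let mf i j m : measurable_fun setT (f i j m).
Proof. apply: smeasW; [exact: (@gmM m)|exact: f_smeas]. Qed.

Let If i j m : intg P (f i j m).
Proof. exact: (intg_bnd P (mf i j m) (f_le1 i j m)). Qed.

Let f_uncor i j m m' : m != m' ->
  E (fun w => f i j m w * f i j m' w) = E (f i j m) * E (f i j m').
Proof.
move=> mm; apply: (@indep_expectM _ _ _ P (gm m) (gm m') (f i j m) (f i j m') 1 1) => //.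
move=> A B sA sB; apply: (@indep_pair _ _ _ P _ _ (Some m) (Some m') _ _ split_ind) => //.
- move=> [k|]; exact: (@measurableT _ (g_sigma_algebraType _)).
- by move=> [k|]; [exact: sndM|exact: fstM].
Qed.

Let Gbar : 'M[R]_p := \matrix_(i, j) (n0%:R^-1 * \sum_m E (f i j m)).

Let gramE w i j : snd_gram (Xclip X w) i j = n0%:R^-1 * \sum_m f i j m w.
Proof.
rewrite /snd_gram mxE; congr (_ * _); rewrite mxE; apply: eq_bigr => m _.
by rewrite /f [_^T i m]mxE.
Qed.

Let Dev w := \sum_i \sum_j (snd_gram (Xclip X w) - Gbar) i j ^+ 2.

Let devE w i j : (snd_gram (Xclip X w) - Gbar) i j ^+ 2 =
  n0%:R^-1 ^+ 2 * (\sum_m (f i j m w - E (f i j m))) ^+ 2.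
Proof.
have gb : Gbar i j = n0%:R^-1 * \sum_m E (f i j m) by rewrite mxE.
by rewrite mxE [(- Gbar) i j]mxE gramE gb -mulrBr -sumrB exprMn.
Qed.

Let Idev i j : intg P (fun w => (\sum_m (f i j m w - E (f i j m))) ^+ 2).
Proof.
have m1 : measurable_fun setT (fun w => \sum_m (f i j m w - E (f i j m))).
  by apply: measurable_sum => m; apply: measurable_funB => //; exact: measurable_cst.
have b1 w : `|\sum_m (f i j m w - E (f i j m))| <= \sum_(m < n0) (1 + `|E (f i j m)|).
  apply: le_trans (ler_norm_sum _ _ _) _; apply: ler_sum => m _.
  by apply: le_trans (ler_normB _ _) _; rewrite lerD2r.
by under eq_fun do rewrite expr2; apply: (intg_bndM m1 b1); apply: (intg_bnd P m1 b1).
Qed.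

Let Dev_intg : intg P Dev.
Proof.
apply: intg_sum => i _; apply: intg_sum => j _; under eq_fun do rewrite devE.
exact: intgZ.
Qed.

(** Each of the p^2 entries is an average of n0 pairwise independent products
    bounded by 1. *)
Lemma gram_deviation : E Dev <= p%:R ^+ 2 / n0%:R.
Proof.
rewrite /E /Dev expect_sum => [|i _]; last first.
  by apply: intg_sum => j _; under eq_fun do rewrite devE; exact: intgZ.
have -> : p%:R ^+ 2 / n0%:R = \sum_(i < p) \sum_(j < p) n0%:R^-1 :> R.
  by rewrite !sumr_const !card_ord -mulrnA -[RHS]mulr_natl natrM expr2.
apply: ler_sum => i _; rewrite expect_sum => [|j _]; last first.
  by under eq_fun do rewrite devE; exact: intgZ.
apply: ler_sum => j _; rewrite (expect_ext P (devE ^~ i ^~ j)) expectZ//.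
have h := var_sum_le (mf i j) (f_le1 i j) (@f_uncor i j).
have e : n0%:R^-1 = n0%:R^-1 ^+ 2 * n0%:R :> R by field; rewrite gt_eqF.
rewrite [leRHS]e.
rewrite ler_wpM2l ?sqr_ge0//; apply: le_trans h _.
rewrite -[n0 in leRHS]card_ord -sumr_const; apply: ler_sum => m _.
rewrite -[leRHS](expect_cst P); apply: expect_le; last 2 first.
- exact: intg_cst.
- by move=> w; rewrite -(real_normK (num_real _)) expr_le1.
by under eq_fun do rewrite expr2; apply: (intg_bndM (mf i j m) (f_le1 i j m)).
Qed.

Let Gbar_lower t : c * sqn t <= quad Gbar t.
Proof.
have quadG x : quad Gbar x = n0%:R^-1 * \sum_m E (fun w => (Xclip X w *m x) m 0 ^+ 2).
  rewrite quad_sum.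
  have e m : E (fun w => (Xclip X w *m x) m 0 ^+ 2) = \sum_i \sum_j x i 0 * x j 0 * E (f i j m).
    transitivity (E (fun w => \sum_i \sum_j x i 0 * x j 0 * f i j m w)).
      apply: expect_ext => w; rewrite mxE expr2 mulr_suml; apply: eq_bigr => i _.
      by rewrite mulr_sumr; apply: eq_bigr => j _; rewrite /f; ring.
    rewrite /E expect_sum => [|i _]; last by apply: intg_sum => j _; exact: intgZ.
    apply: eq_bigr => i _; rewrite expect_sum => [|j _]; last exact: intgZ.
    by apply: eq_bigr => j _; rewrite expectZ.
  under [in RHS]eq_bigr do rewrite e.
  rewrite [in RHS]exchange_big/= mulr_sumr; apply: eq_bigr => i _.
  rewrite [in RHS]exchange_big/= mulr_sumr; apply: eq_bigr => j _.
  by rewrite mxE mulrCA mulr_sumr.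
have unit x : sqn x = 1 -> c <= quad Gbar x.
  move=> x1; rewrite quadG ler_pdivlMl// mulr_natl -[X in _ *+ X](card_ord n0) -sumr_const.
  apply: ler_sum => m _; apply: le_trans (second m x1) _.
  rewrite le_eqVlt; apply/orP; left; apply/eqP; symmetry; apply: expect_ae.
  - have mx : measurable_fun setT (fun w => (Xclip X w *m x) m 0).
      apply: mxmeasM; last exact: mxmeas_cst.
      by move=> a b; apply: smeasW (snd_gensM mdata) _; exact: Xclip_smeas.
    have xb w : `|(Xclip X w *m x) m 0| <= \sum_j `|x j 0|.
      rewrite mxE; apply: le_trans (ler_norm_sum _ _ _) _; apply: ler_sum => j _.
      by rewrite normrM ler_piMl// Xclip_le1.
    by under eq_fun do rewrite expr2; apply: (intg_bndM mx xb); apply: (intg_bnd P mx xb).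
  - by apply: measurable_funX; exact: measurable_covproj mdata _ _.
  - apply: filterS (Xclip_ae Xbnd) => w ->; congr (_ ^+ 2); rewrite /covproj !mxE.
    by apply: eq_bigr => j _; rewrite mxE.
have [->|t0] := eqVneq t 0.
  by rewrite quadE mulmx0 sqn_sum /dot !big1 ?mulr0// => i _; rewrite !mxE ?mul0r ?expr0n.
have q0 : 0 < sqn t.
  rewrite lt_neqAle sqn_ge0 andbT eq_sym; apply: contra t0 => /eqP h.
  by apply/eqP; exact: sqn_eq0.
pose a := Num.sqrt (sqn t); have a2 : a ^+ 2 = sqn t by rewrite sqr_sqrtr// ltW.
have a0 : a != 0 by rewrite gt_eqF// sqrtr_gt0.
have tE : t = a *: (a^-1 *: t) by rewrite scalerA mulfV// scale1r.
have H : c <= quad Gbar (a^-1 *: t).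
  apply: unit; have -> : sqn (a^-1 *: t) = a^-1 * a^-1 * sqn t by rewrite /sqn dotZr dotZl mulrA.
  by rewrite -a2; field.
rewrite -a2 {1}tE quadE -scalemxAr dotZr dotZl mulrA -quadE -expr2 mulrC.
by rewrite ler_wpM2l ?sqr_ge0.
Qed.

(** If S is within c/2 of its mean in Frobenius norm, then S >= (c/2) I and
    R_ii <= 2/c.  Otherwise the crude bound 2 Mi / s is paid, on an event
    controlled by Chebyshev's inequality. *)
Lemma resol_moment (i : 'I_p) (Mi : R) : 0 <= Mi ->
  (forall w, resol (Xclip X w) Q i i <= 2 / s * Mi) ->
  2 * s * E (fun w => resol (Xclip X w) Q i i) <=
    4 * s / c + 16 * Mi / c ^+ 2 * (p%:R ^+ 2 / n0%:R).
Proof.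
move=> Mi0 Rle.
have IR : intg P (fun w => resol (Xclip X w) Q i i).
  exact: (badapted_intg P (snd_gensM mdata) (resol_badapted X Qpd i i)).
rewrite /E -expectZ//.
apply: (@le_trans _ _ (E (fun w => 4 * s / c + 16 * Mi / c ^+ 2 * Dev w))); last first.
  rewrite /E expectD; [|exact: intg_cst|exact: intgZ].
  rewrite expect_cst expectZ// lerD2l ler_wpM2l ?gram_deviation//.
  by apply: divr_ge0; [exact: mulr_ge0|exact: sqr_ge0].
apply: expect_le; [exact: intgZ|by apply: intgD; [exact: intg_cst|exact: intgZ]|] => w.
apply: resol_arith => //.
- by apply: sumr_ge0 => a _; apply: sumr_ge0 => b _; exact: sqr_ge0.
- by rewrite -quad_delta resol_ge0.
move=> Dle; apply: resol_good => //; first by rewrite divr_gt0.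
move=> t; apply: (half_lower (sqn_ge0 t) (Gbar_lower t)) => //.
rewrite -quadB; apply: le_trans (quad_sqr_le _ _) _.
by rewrite ler_wpM2r ?sqr_ge0.
Qed.

End GramDeviation.

(** * The risk bound *)

Section Arith.
Context {R : realType}.

Lemma bias_var_arith (a b l e N rt CN Cv : R) : 0 <= a -> 0 <= l -> 0 <= Cv ->
  e <= b * rt -> N <= CN * rt ->
  a * l * e + Cv * (l * N) <= (a * b * l + Cv * CN * l) * rt.
Proof.
move=> a0 l0 C0 h1 h2.
have := ler_wpM2l (mulr_ge0 a0 l0) h1; have := ler_wpM2l (mulr_ge0 C0 l0) h2; lra.
Qed.

Lemma min_bound (a b r n0 y : R) : 0 <= a -> 0 <= b -> 0 <= r -> 0 <= n0 ->
  y <= a * r -> y <= b * n0 -> y <= (a + b) * Num.min n0 r.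
Proof.
move=> a0 b0 r0 n00 h1 h2; rewrite minEle; case: ifP => _.
  by apply: le_trans h2 _; rewrite ler_wpM2r// lerDr.
by apply: le_trans h1 _; rewrite ler_wpM2r// lerDl.
Qed.
Lemma sn_arith (s sg noise_bound n0 c m p : R) : s = sg / n0 -> sg <= noise_bound -> 0 < n0 -> 0 < c ->
  4 * s / c + 16 * m / c ^+ 2 * (p / n0) <= (4 * noise_bound / c + 16 * m / c ^+ 2 * p) * n0^-1.
Proof.
move=> -> h n00 c0.
have -> : 4 * (sg / n0) / c + 16 * m / c ^+ 2 * (p / n0) =
  (4 * sg / c + 16 * m / c ^+ 2 * p) * n0^-1 by field; rewrite !gt_eqF.
rewrite ler_wpM2r ?invr_ge0 ?(ltW n00)// lerD2r ler_wpM2r ?invr_ge0 ?(ltW c0)//.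
by rewrite ler_wpM2l.
Qed.
End Arith.

Section ModelRisk.
Context {R : realType} {p : nat}.
Variables (beta L : R) (Ucal B : set R) (f : R -> R).
Variables (ustar a0' a0 lambda0 b0' b0 e0 : R) (sigma2 : R -> R).
Variables (m4 : ('I_p -> R -> R) -> R -> R) (u0 : R).
Hypothesis beta0 : 0 < beta.
Hypothesis L0 : 0 <= L.
Hypothesis a0'0 : 0 < a0'.
Hypothesis Hf : base_density f B a0' a0.
Hypothesis lam0 : 0 < lambda0.
Hypothesis b0'0 : 0 < b0'.
Hypothesis e00 : 0 < e0.
Hypothesis Uu0 : Ucal u0.
Hypothesis m4c : forall theta, hoelder_class beta L theta -> {within Ucal, continuous (m4 theta)}.
Variables (c Db Hm Cm : R).
Hypothesis c0 : 0 < c.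
Hypothesis Hc : forall b t, B b -> 0 < t <= 1 ->
  ((c * t)%:E <= lebesgue_measure (B `&` `[(b - t)%R, (b + t)%R]))%E.
Hypothesis Db1 : 1 <= Db.
Hypothesis HDb : forall b b', B b -> B b' -> `|b - b'| <= Db.
Hypothesis Hm0 : 0 <= Hm.
Hypothesis HHm : forall u, Ucal u -> `|u - u0| <= Hm.
Hypothesis Cm0 : 0 <= Cm.
Hypothesis HCm : forall u, Ucal u -> m4 (fun _ _ => 0) u <= Cm.

Variables (K : nat) (n : 'I_K.+1 -> nat) (gamma : R).
Context {d : measure_display} {Omega : measurableType d}.
Variables (P : probability Omega R) (U : 'I_K.+1 -> Omega -> R).
Variables (X : obs n -> Omega -> 'rV[R]_p) (eps : obs n -> Omega -> R).
Hypothesis K0 : (0 < K)%N.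
Hypothesis n00 : (0 < n ord0)%N.
Hypothesis gamma0 : 0 < gamma.
Hypothesis sub_supp : [set ustar + gamma * b | b in B] `<=` Ucal.
Hypothesis u0_supp : [set ustar + gamma * b | b in B] u0.
Hypothesis mdata : measurable_data U X eps.
Hypothesis HU : identifiers P U u0 gamma ustar f.
Hypothesis Hn : noise P U X eps sigma2.
Hypothesis split_ind : sample_split P U X.
Hypothesis Xbnd : bounded_covariates P X.
Hypothesis fm : forall theta, hoelder_class beta L theta ->
  fourth_moment P U X eps theta (m4 theta).
Hypothesis design : design_cond P U X beta e0 gamma u0 lambda0.
Hypothesis bal : balanced n b0' b0.

Let E := expect P.
Let kp := kap a0' c Db.
Let hw w := bandwidth n beta e0 gamma u0 (ids U w).

Let kp0 : 0 < kp. Proof. exact: kap_gt0. Qed.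
Let mU k : measurable_fun setT (U k). Proof. by case: mdata. Qed.
Let U00 w : U ord0 w = u0. Proof. by case: HU. Qed.

Let bu_ex : exists2 bu, B bu & u0 = ustar + gamma * bu.
Proof. by case: u0_supp => bu Bbu <-; exists bu. Qed.

Let U_supp : {ae P, forall w, forall k : 'I_K, Ucal (U (lift ord0 k) w)}.
Proof.
apply: filterS (near_supp_ae mU Hf HU) => w H k; apply: sub_supp.
exists ((U (lift ord0 k) w - ustar) / gamma); first exact: H.
by rewrite mulrCA mulfV ?gt_eqF// mulr1 addrC subrK.
Qed.

Let dist_gt0 := dist_gt0_ae mU HU.

Let dist_le : {ae P, forall w, forall k : 'I_K, `|U (lift ord0 k) w - u0| <= gamma * Db}.
Proof. by have [bu Bbu u0E] := bu_ex; exact: (dist_le_ae mU gamma0 Hf HU HDb Bbu u0E). Qed.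

Let hpos : {ae P, forall w, 0 < hw w}. Proof. exact: bandwidth_gt0. Qed.

Let hle : {ae P, forall w, hw w <= Hm}.
Proof.
apply: filterS U_supp => w H.
apply: le_trans (bandwidth_le_last K0 _ _ _ _ _ _) _.
by have [|k ->] := @dist_ord_mem _ _ u0 (ids U w) K; rewrite ?K0 ?leqnn//; exact/HHm/H.
Qed.

(** E h^(2 beta) is at most [bias_rate] times the rate, and E (1/N) at most
    [var_rate] times the rate. *)
Definition bias_rate : R := e0 `^ (2 * beta) + dist_const kp (2 * beta).
Definition var_rate : R := 1 + 12 / (b0' * kp * e0).

Let h_moment : E (fun w => hw w `^ (2 * beta)) <= bias_rate * rate gamma n beta.
Proof.
have [bu Bbu u0E] := bu_ex.
apply: (bandwidth_moment K0 mU gamma0 kp0 Db1 _ dist_le n00 beta0 e00).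
by move=> t t0 tD; exact: (far_prob mU gamma0 a0'0 Hf HU c0 Hc Db1 Bbu u0E).
Qed.

Let N_moment : E (fun w => (window_count n (hw w) u0 (ids U w))^-1) <= var_rate * rate gamma n beta.
Proof.
have [bu Bbu u0E] := bu_ex.
apply: (inv_count_moment K0 mU U00 gamma0 kp0 _ _ _ dist_le n00 beta0 e00 b0'0 bal).
- by move=> k t tD; exact: (near_event_lower mU gamma0 a0'0 Hf HU c0 Hc Db1 Bbu u0E).
- by move=> k k' s kk; exact: (near_event_pair mU HU).
- by move=> k k' s; exact: (near_event_prob_eq HU).
Qed.

Let z_class : hoelder_class beta L (fun (_ : 'I_p) _ => 0).
Proof. by move=> j; exact: hoelder_cst. Qed.

Let fm0 := fm z_class.
Let v := cond_var Cm sigma2 U : obs n -> Omega -> R.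
Let Cv := noise_bound Cm.
Let sg := sigma2 u0.

Let second (t : 'cV[R]_p) i : sqn t = 1 ->
  lambda0 ^+ 2 / 128 <= E (fun w => covproj X t (obs2 i) w ^+ 2).
Proof.
have [bu Bbu u0E] := bu_ex.
move=> t1; apply: (target_second_moment L0 lam0 K0 n00 gamma0 Db1 Uu0 m4c mdata U00 _ U_supp dist_gt0 Xbnd fm design i t1).
by move=> t' tD; exact: (near_all_prob mU gamma0 a0'0 Hf HU c0 Hc Db1 Bbu u0E).
Qed.

(** The diagonal of the DVCM mean squared error matrix is at most [mse_rate] times
    the rate, and at most [mse_max] in any case. *)
Definition mse_rate : R :=
  p%:R * L ^+ 2 * bias_rate * lambda0^-1 + noise_bound Cm * var_rate * lambda0^-1.
Definition mse_max : R := bias_max (p := p) beta L lambda0 Hm + noise_bound Cm * lambda0^-1.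
Definition snd_const : R := lambda0 ^+ 2 / 128.
Definition target_rate : R :=
  4 * noise_bound Cm / snd_const + 16 * mse_max / snd_const ^+ 2 * p%:R ^+ 2.

Lemma bias_rate_ge0 : 0 <= bias_rate.
Proof.
apply: addr_ge0; first exact: powR_ge0.
apply: mulr_ge0; first by apply: mulr_ge0 => //; exact: expR_ge0.
by apply: divr_ge0 => //; apply: exprn_ge0; exact: ltW.
Qed.

Lemma var_rate_ge0 : 0 <= var_rate.
Proof.
apply: addr_ge0 => //; apply: divr_ge0 => //.
by apply: mulr_ge0; [apply: mulr_ge0|]; exact: ltW.
Qed.

Lemma mse_rate_ge0 : 0 <= mse_rate.
Proof.
have l0 : 0 <= lambda0^-1 by rewrite invr_ge0 ltW.
apply: addr_ge0; apply: mulr_ge0 => //; apply: mulr_ge0; try exact: bias_rate_ge0; try exact: var_rate_ge0.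
  by rewrite mulr_ge0 ?sqr_ge0.
exact: noise_bound_ge0.
Qed.

Section Fixed.
Variables (theta : 'I_p -> R -> R) (Q : 'M[R]_p).
Hypothesis th_class : hoelder_class beta L theta.
Let M := mse_dvcm P U X eps beta e0 gamma u0 theta.
Let s := sg / (n ord0)%:R.
Hypothesis Mu : M \in unitmx.
Hypothesis Qpd : posdef Q.
Hypothesis lower : loewner_le ((2^-1 * s) *: invmx M) Q.
Hypothesis upper : loewner_le Q ((2 * s) *: invmx M).
Let errT w := theta_tl U X eps beta e0 gamma u0 Q theta w - \col_j theta j u0.

(** 2 s R_ii is bounded in the two ways described at the top: by 4 M_ii through
    [resol_le_mse], and by a multiple of 1/n0 through [resol_moment]. *)
Lemma coord_risk i :
  intg P (fun w => errT w i 0 ^+ 2) /\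
  E (fun w => errT w i 0 ^+ 2) <=
    (4 * mse_rate + target_rate) * Num.min (n ord0)%:R^-1 (rate gamma n beta).
Proof.
have n0R : 0 < (n ord0)%:R :> R by rewrite ltr0n.
have [bt [Ht [btad Htad Ht0 bnd dec]]] :=
  dvcm_decomp eps beta0 L0 lam0 K0 n00 Hm0 U00 hpos hle Xbnd design th_class.
have vsm : forall o, smeas (ids_gens U) (v o) by exact: cond_var_smeas Hn.
have vb : forall o w, 0 <= v o w <= Cv by exact: cond_var_bnd.
have vt : forall i w, v (obs2 i) w = sg.
  exact: (cond_var_target n00 Uu0 Cm0 HCm mdata U00 U_supp Hn fm0).
have bil := model_bilinear Uu0 Cm0 HCm mdata U00 U_supp Hn fm0.
have Mpsd := mse_ge0 beta0 L0 K0 mdata th_class vsm vb bil btad Htad dec.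
have Msym := mse_sym beta e0 u0 gamma P U X eps theta.
have s0 : 0 < s := noise_level_gt0 Mu Mpsd Qpd upper i.
have M_le := mse_le_inv Msym Mu Qpd upper s0.
have le_M := inv_le_mse Msym Mu Mpsd Qpd lower s0.
have [IT ET] := transfer_moment beta0 L0 K0 mdata U00 split_ind Xbnd th_class
  vsm vb vt bil btad Htad Ht0 dec Qpd s0 M_le i.
split => //.
have Rle w := resol_le_mse Qpd le_M i w.
have sgle : sg <= Cv by have /andP[] := sigma2_target n00 Uu0 Cm0 HCm mdata U00 U_supp Hn fm0.
have Mi0 : 0 <= M i i by rewrite -quad_delta.
have Cv0 : 0 <= Cv by exact: noise_bound_ge0.
have l0 : 0 <= lambda0^-1 by rewrite invr_ge0 ltW.
have Iv : intg P (var_bound beta lambda0 e0 u0 gamma n U).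
  have -> : var_bound beta lambda0 e0 u0 gamma n U =
      fun w => lambda0^-1 * (window_count n (hw w) u0 (ids U w))^-1.
    by apply/funext => w; exact: var_boundE.
  by apply: intgZ; exact: intg_inv_count.
have biasE : bias_bound (p := p) beta L lambda0 e0 u0 gamma n U =
    fun w => (p%:R * L ^+ 2 * lambda0^-1) * hw w `^ (2 * beta).
  by apply/funext => w; rewrite /bias_bound mulrAC.
have Ihw : intg P (fun w => hw w `^ (2 * beta)).
  by apply: (intg_bandwidth K0 mU gamma0 Db1 dist_le); rewrite mulr_gt0.
have M_rate : M i i <= mse_rate * rate gamma n beta.
  have h : M i i <= E (bias_bound (p := p) beta L lambda0 e0 u0 gamma n U) +
      Cv * E (var_bound beta lambda0 e0 u0 gamma n U).
    apply: (mse_diag_le beta0 L0 K0 mdata th_class vsm vb bil btad Htad dec) => //.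
    - by rewrite biasE; exact: intgZ.
    - by apply: aeW => w; case: (bnd i w).
    - by move=> w; case: (bnd i w).
  apply: le_trans h _.
  have -> : E (var_bound beta lambda0 e0 u0 gamma n U) =
      lambda0^-1 * E (fun w => (window_count n (hw w) u0 (ids U w))^-1).
    rewrite /E -expectZ; last exact: intg_inv_count.
    by apply: expect_ext => w; exact: var_boundE.
  rewrite biasE /E expectZ//; apply: bias_var_arith => //.
  by rewrite mulr_ge0 ?sqr_ge0.
have M_max : M i i <= mse_max.
  have h : M i i <= E (fun=> bias_max (p := p) beta L lambda0 Hm) + Cv * E (fun=> lambda0^-1).
    apply: (mse_diag_le beta0 L0 K0 mdata th_class vsm vb bil btad Htad dec) => //.
    - exact: intg_cst.
    - exact: intg_cst.
    - by apply: aeW => w; case: (bnd i w).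
    - move=> w; case: (bnd i w) => h _ _; apply: le_trans h _; exact: var_bound_le.
  by move: h; rewrite /E !expect_cst.
have mm0 : 0 <= mse_max := le_trans Mi0 M_max.
have c'0 : 0 < snd_const by rewrite divr_gt0// exprn_gt0.
have R0 := rate_ge0 gamma n beta.
apply: min_bound => //.
- by rewrite mulr_ge0// mse_rate_ge0.
- apply: addr_ge0; first by apply: divr_ge0; [exact: mulr_ge0|exact: ltW].
  by rewrite mulr_ge0 ?sqr_ge0// divr_ge0 ?sqr_ge0// mulr_ge0.
- apply: le_trans ET _; rewrite -[leRHS]mulrA.
  apply: (@le_trans _ _ (2 * s * (2 / s * M i i))).
    apply: ler_wpM2l; first by apply: mulr_ge0 => //; exact: ltW s0.
    rewrite -[leRHS](expect_cst P); apply: expect_le; [|exact: intg_cst|exact: Rle].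
    exact: (badapted_intg P (snd_gensM mdata) (resol_badapted X Qpd i i)).
  have -> : 2 * s * (2 / s * M i i) = 4 * M i i by field; rewrite gt_eqF.
  by rewrite ler_wpM2l.
apply: le_trans ET _.
have h := resol_moment n00 mdata split_ind Xbnd Qpd s0 c'0 second mm0
  (fun w => le_trans (Rle w) (ler_wpM2l (ltW (divr_gt0 (ltr0Sn R 1) s0)) M_max)).
by apply: le_trans h _; exact: (sn_arith _ _ (erefl s)).
Qed.

Variable A : 'M[R]_p.
Hypothesis Apsd : psd A.

Lemma risk_bound : (risk_tl P U X eps beta e0 gamma u0 A Q theta <=
  ((\sum_i \sum_j `|A i j|) * (p%:R * (4 * mse_rate + target_rate)) *
    Num.min (n ord0)%:R^-1 (rate gamma n beta))%:E)%E.
Proof.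
have Is : intg P (fun w => sqn (errT w)).
  by under eq_fun do rewrite sqn_sum; apply: intg_sum => i _; case: (coord_risk i).
have cA0 : 0 <= \sum_i \sum_j `|A i j|.
  by apply: sumr_ge0 => i _; apply: sumr_ge0.
have IcA : intg P (fun w => (\sum_i \sum_j `|A i j|) * sqn (errT w)) by exact: intgZ.
have mq : measurable_fun setT (fun w => quad A (errT w)).
  by apply: measurable_quad; [exact: mxmeas_cst|exact: mxmeas_errT beta0 L0 K0 mdata th_class Q].
have Iq : intg P (fun w => quad A (errT w)).
  apply: (intg_le mq IcA) => w; rewrite ger0_norm; last by case: Apsd => _; apply.
  exact: quad_le_norm1.
rewrite /risk_tl unlock (expect_fin Iq) lee_fin.
apply: (@le_trans _ _ (E (fun w => (\sum_i \sum_j `|A i j|) * sqn (errT w)))).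
  by apply: expect_le => // w; exact: quad_le_norm1.
rewrite /E expectZ// -mulrA ler_wpM2l//.
have -> : expect P (fun w => sqn (errT w)) = \sum_i expect P (fun w => errT w i 0 ^+ 2).
  rewrite -expect_sum => [|i _]; last by case: (coord_risk i).
  by apply: expect_ext => w; rewrite sqn_sum.
rewrite -[leRHS]mulrA [leRHS]mulr_natl -[X in _ *+ X]card_ord -sumr_const.
by apply: ler_sum => i _; case: (coord_risk i).
Qed.

End Fixed.
End ModelRisk.

Lemma compact_norm_le (R : realType) (A : set R) :
  compact A -> exists2 M, 0 <= M & forall x, A x -> `|x| <= M.
Proof.
move=> /compact_bounded [M [_ HM]].
exists (Num.max 0 (M + 1)); first by rewrite le_max lexx.
move=> x Ax; apply: (HM _ _ x Ax).
by rewrite lt_max ltrDl ltr01 orbT.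
Qed.

Theorem theorem3p6 (R : realType) (p : nat) (beta L : R)
    (Ucal B : set R) (f : R -> R) (ustar a0' a0 lambda0 b0' b0 e0 : R)
    (sigma2 : R -> R) (m4 : ('I_p -> R -> R) -> R -> R)
    (u0 : R) (A : 'M[R]_p) :
  0 < beta -> 0 < L ->
  0 < a0' <= a0 -> base_density f B a0' a0 -> mass_regular B -> B ustar ->
  0 < lambda0 -> 0 < b0' -> 0 < b0 -> 0 < e0 ->
  compact Ucal -> Ucal u0 ->
  (forall theta, hoelder_class beta L theta ->
     {within Ucal, continuous (m4 theta)}) ->
  psd A ->
  exists2 C : R, 0 < C &
  forall (K : nat) (n : 'I_K.+1 -> nat) (gamma : R)
    (d : measure_display) (Omega : measurableType d) (P : probability Omega R)
    (U : 'I_K.+1 -> Omega -> R) (X : obs n -> Omega -> 'rV[R]_p)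
    (eps : obs n -> Omega -> R) (Q : ('I_p -> R -> R) -> 'M[R]_p),
  (0 < K)%N -> (0 < n ord0)%N -> 0 < gamma ->
  [set ustar + gamma * b | b in B] `<=` Ucal ->
  [set ustar + gamma * b | b in B] u0 ->
  measurable_data U X eps ->
  identifiers P U u0 gamma ustar f ->
  noise P U X eps sigma2 ->
  sample_split P U X ->
  bounded_covariates P X ->
  (forall theta, hoelder_class beta L theta ->
     fourth_moment P U X eps theta (m4 theta)) ->
  design_cond P U X beta e0 gamma u0 lambda0 ->
  balanced n b0' b0 ->
  (forall theta, hoelder_class beta L theta ->
     let M := mse_dvcm P U X eps beta e0 gamma u0 theta in
     let s := sigma2 u0 / (n ord0)%:R in
     [/\ M \in unitmx, posdef (Q theta),
         loewner_le ((2^-1 * s) *: invmx M) (Q theta) &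
         loewner_le (Q theta) ((2 * s) *: invmx M)]) ->
  (ereal_sup [set risk_tl P U X eps beta e0 gamma u0 A (Q theta) theta
             | theta in hoelder_class beta L] <=
   (C * Num.min (n ord0)%:R^-1
          (Num.max ((K%:R / gamma) `^ (- (2 * beta)))
             (Num.max (((ntot n)%:R / gamma) `^ (- (2 * beta / (2 * beta + 1))))
                (ntot n)%:R^-1)))%:E)%E.

Proof.
move=> beta0 L0 /andP[a0'0 _] Hf [c c0 Hc] _ lam0 b0'0 b00 e00 cU Uu0 m4c Apsd.
have [MB MB0 HB] : exists2 M, 0 <= M & forall x, B x -> `|x| <= M.
  by apply: compact_norm_le; case: Hf.
have [MU MU0 HMU] := compact_norm_le cU.
have [Cm Cm0 HCm] : exists2 M, 0 <= M &
    forall x, (m4 (fun _ _ => 0) @` Ucal) x -> `|x| <= M.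
  apply: compact_norm_le; apply: continuous_compact => //; apply: m4c => j.
  exact/hoelder_cst/ltW.
pose Db := 1 + 2 * MB; pose Hm := 2 * MU.
pose X := (\sum_i \sum_j `|A i j|) * (p%:R *
  (4 * @mse_rate _ p beta L a0' lambda0 b0' e0 c Db Cm +
   @target_rate _ p beta L lambda0 Hm Cm)).
exists (`|X| + 1); first by rewrite ltr_wpDl.
move=> K n gamma d Omega P U Xo eps Q K0 n00 gamma0 sub u0s mdata HU Hn Hs Xb fm des bal HQ.
apply: ub_ereal_sup => _ [theta th <-].
have [Mu Qpd lo up] := HQ theta th.
apply: le_trans (@risk_bound R p beta L Ucal B f ustar a0' a0 lambda0 b0' b0 e0 sigma2 m4 u0
  beta0 (ltW L0) a0'0 Hf lam0 b0'0 e00 Uu0 m4c c Db Hm Cm c0 Hc _ _ _ _ Cm0 _ K n gamma d Omega P U Xo eps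
  K0 n00 gamma0 sub u0s mdata HU Hn Hs Xb fm des bal theta (Q theta) th Mu Qpd lo up A Apsd) _.
- by rewrite /Db lerDl mulr_ge0.
- move=> b b' Bb Bb'; apply: le_trans (ler_normB _ _) _.
  have h1 := HB _ Bb; have h2 := HB _ Bb'; rewrite /Db; lra.
- by rewrite mulr_ge0.
- move=> u Uu; apply: le_trans (ler_normB _ _) _.
  have h1 := HMU _ Uu; have h2 := HMU _ Uu0; rewrite /Hm; lra.
- by move=> u Uu; apply: le_trans (ler_norm _) _; apply: HCm; exists u.
rewrite lee_fin -/X; apply: ler_wpM2r.
  by rewrite le_min invr_ge0 ler0n rate_ge0.
by apply: le_trans (ler_norm _) _; rewrite lerDl.
Qed.
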